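(* For any fixed continuous $F_{X,Y}$, $$\lim_{n\to\infty}\big\{n\operatorname{Var}[\xi_n-\xi_n^*]\big\}=0,\qquad\text{and, if }d=1,\qquad\lim_{n\to\infty}\big\{n\operatorname{Var}[\overline\xi_n-\overline\xi_n^*]\big\}=0.$$
   Context: $Y$ is a real random variable and $X$ is a random vector in $\mathbb{R}^d$, defined on the same probability space, with joint distribution function $F_{X,Y}$, which is fixed (not depending on $n$) and continuous; $F_Y$ is the distribution function of $Y$. $(X_1,Y_1),\ldots,(X_n,Y_n)$ are $n$ independent copies of $(X,Y)$. $R_i:=\sum_{j=1}^n\mathbf{1}(Y_j\le Y_i)$ is the rank of $Y_i$. $N_1(i)$ is the index of the nearest neighbor of $X_i$ among $\{X_j\}_{j\neq i}$ in the Euclidean metric. When $d=1$, $\overline{N}_1(i)$ is the index of the right nearest neighbor of $X_i$ (the closest sample point larger than $X_i$), with $\overline{N}_1(i):=i$ if $X_i$ is the largest. Define $$\xi_n:=\frac{6}{n^2-1}\sum_{i=1}^n\min\{R_i,R_{N_1(i)}\}-\frac{2n+1}{n-1}\ (d\ge 1),\qquad \overline{\xi}_n:=1-\frac{3}{n^2-1}\sum_{i=1}^n\big|R_{\overline{N}_1(i)}-R_i\big|\ (d=1).$$ For $t\in\mathbb R$, $G_X(t):=\mathrm P(Y\ge t\mid X)$ and $h(t):=\mathrm E[G_X^2(t)]$. Define $$\xi_n^*:=\frac{6n}{n^2-1}\Big(\sum_{i=1}^n\min\{F_Y(Y_i),F_Y(Y_{N_1(i)})\}+\sum_{i=1}^nh(Y_i)\Big),$$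 $$\overline\xi_n^*:=\frac{6n}{n^2-1}\Big(\sum_{i=1}^n\min\{F_Y(Y_i),F_Y(Y_{\overline N_1(i)})\}+\sum_{i=1}^nh(Y_i)\Big)\ (d=1).$$ *)

(* Defs.v *)
From HB Require Import structures.
From mathcomp Require Export all_boot all_order all_algebra.
From mathcomp Require Export all_classical all_reals all_analysis.

Set Implicit Arguments.
Unset Strict Implicit.
Unset Printing Implicit Defensive.

Export Order.TTheory GRing.Theory Num.Theory.
Export numFieldNormedType.Exports.

Local Open Scope classical_set_scope.
Local Open Scope ring_scope.

Section Probability.
Context {d1 d2 : measure_display} {T : measurableType d1}
  {S : measurableType d2} {R : realType} (P : probability T R).

(* [g] is a version of the conditional probability P(E | X): it is measurable
   with respect to sigma(X), integrable, and has the same integral as the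
   indicator of [E] over every event of sigma(X). *)
Definition is_cond_prob (X : {RV P >-> S}) (E : set T) (g : T -> R) : Prop :=
  let sigmaX := preimage_set_system setT X measurable in
  [/\ forall B : set R, measurable B -> sigmaX (g @^-1` B),
      P.-integrable setT (EFin \o g) &
      forall A, sigmaX A -> (\int[P]_(w in A) (g w)%:E)%E = P (A `&` E)].

Definition mutually_independent (Z : nat -> T -> S) : Prop :=
  forall (J : seq nat) (B : nat -> set S), uniq J ->
    (forall j, measurable (B j)) ->
    P (\bigcap_(j in [set` J]) (Z j @^-1` B j))
      = (\prod_(j <- J) P (Z j @^-1` B j))%E.

(* The sequence [Z] on (T, P) consists of independent copies of the variable
   [Z0], which may live on another probability space (T0, P0). *)
Definition independent_copies (d0 : measure_display) (T0 : measurableType d0)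
    (P0 : probability T0 R) (Z0 : T0 -> S) (Z : nat -> T -> S) : Prop :=
  mutually_independent Z /\
  forall i (B : set S), measurable B -> P (Z i @^-1` B) = P0 (Z0 @^-1` B).

Definition joint_cdf (d : nat) (X : {RV P >-> d.-tuple R}) (Y : {RV P >-> R})
    (z : 'rV[R]_d * R) : R :=
  fine (P [set w | (forall k, tnth (X w) k <= z.1 0 k) /\ Y w <= z.2]).

End Probability.

Section Statistics.
Context {R : realType} {n : nat}.

Definition eucl_dist {d : nat} (x y : d.-tuple R) : R :=
  Num.sqrt (\sum_(k < d) (tnth x k - tnth y k) ^+ 2).

(* Distance ties are resolved by the enumeration order of 'I_n, that is, in
   favour of the smallest index; when n = 1 the value is i itself. *)
Definition nearest {d : nat} (x : 'I_n -> d.-tuple R) (i : 'I_n) : 'I_n :=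
  [arg min_(j < i | j != i) eucl_dist (x i) (x j)]%O.

(* [arg min] returns its default i when no j satisfies x i < x j. *)
Definition right_nearest (x : 'I_n -> R) (i : 'I_n) : 'I_n :=
  [arg min_(j < i | x i < x j) x j]%O.

Definition rank (y : 'I_n -> R) (i : 'I_n) : nat :=
  (\sum_(j < n) (y j <= y i)%R)%N.

Definition xi (y : 'I_n -> R) (N : 'I_n -> 'I_n) : R :=
  6 / (n%:R ^+ 2 - 1) * (\sum_(i < n) (minn (rank y i) (rank y (N i)))%:R)
    - (2 * n%:R + 1) / (n%:R - 1).

Definition xi_bar (y : 'I_n -> R) (N : 'I_n -> 'I_n) : R :=
  1 - 3 / (n%:R ^+ 2 - 1)
      * (\sum_(i < n) `|(rank y (N i))%:R - (rank y i)%:R|).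

Definition xi_star (F h : R -> R) (y : 'I_n -> R) (N : 'I_n -> 'I_n) : R :=
  6 * n%:R / (n%:R ^+ 2 - 1)
    * (\sum_(i < n) Num.min (F (y i)) (F (y (N i))) + \sum_(i < n) h (y i)).

End Statistics.

(* Main.v *)
From HB Require Import structures.
Require Import Defs.
From mathcomp Require Import all_boot all_order all_algebra.
From mathcomp Require Import all_classical all_reals all_analysis.
From mathcomp Require Import measurable_realfun ring lra zify.

(** Let x_i, y_i denote the observations, N the neighbor map, M_i the minimum of
    y_i and y_(N i), F_n the empirical distribution function of the y_i. Ranks
    are monotone, so min(R_i, R_(N i)) = n F_n(M_i), and up to a constant the
    difference of the two statistics is 6/(n^2-1) times
      sum_i (n F_n(M_i) - n F(M_i)) - n sum_i h(y_i)
    ([core], [xi_core]). For the right nearest neighbor, |a - b| is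
    a + b - 2 min(a, b), and the additional sums of ranks are deterministic up to
    an error of at most n ([xi_bar_core], [sum_rank_shift]). The claim becomes
    that the variance of [core] is o(n^3) ([core_variance]).

    By the Efron-Stein inequality ([efron_stein]) it is enough that replacing one
    observation changes [core] by o(n) in quadratic mean. One point is the neighbor
    of a bounded number of points only, so a replacement affects a bounded number
    of the M_i. Writing L(t) for the fraction of the indices with M_i >= t, the
    change is at most a constant times n sup |F_n - F|, plus n |L(t) - h(t)| with
    for t the old and the new y-value, plus a constant ([core_repl]). The supremum
    is small because F is continuous ([cdf_grid], [ecdf_L2]). The levels t are
    independent of the sample defining L, so that it remains to see that L(t)
    tends to h(t) in quadratic mean for each t ([upper_frac_L2]).

    The variance of L(t) is O(1/n), by the Efron-Stein inequality again. As for its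
    mean ([mean_upper_frac]), let g be the regression function of the event
    Y >= t. Given the x-values, the y-values are independent, so the mean of L(t)
    is the average of E g(x_i) g(x_(N i)), to be compared to h(t) = E g(x_i)^2.
    It remains that g(x_(N i)) is close to g(x_i) on average
    ([osc_vanishes_measurable]). Edges of the neighbor graph are short, which
    gives this for indicators of half-spaces; the sets for whose indicators it is
    true form a sigma-algebra, because the in-degree is bounded, and a measurable g
    is a uniform limit of combinations of indicators.

    The neighbor maps enter through few combinatorial properties
    ([neighbor_rule]), and the probabilistic part takes place on the space of
    sequences, under the law of the sample. *)

Set Implicit Arguments.
Unset Strict Implicit.
Unset Printing Implicit Defensive.

Local Open Scope classical_set_scope.
Local Open Scope ring_scope.

(** * Bounded measurable functions and their means *)
Section BoundedMeasurable.
Context {d : measure_display} {T : measurableType d} {R : realType}.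
Implicit Types (f g : T -> R).

(** Every statistic below is bounded, so membership in this class is the only
    side condition that linearity, monotonicity and Fubini require. *)
Definition bmeas f :=
  measurable_fun [set: T] f /\ exists K, forall w, `|f w| <= K.

Lemma bmeas_cst c : bmeas (fun=> c).
Proof. by split; [exact: measurable_cst | exists `|c|]. Qed.

Lemma bmeasD f g : bmeas f -> bmeas g -> bmeas (fun w => f w + g w).
Proof.
move=> [mf [K fK]] [mg [L gL]]; split; first exact: measurable_funD.
by exists (K + L) => w; rewrite (le_trans (ler_normD _ _))// lerD.
Qed.

Lemma bmeasM f g : bmeas f -> bmeas g -> bmeas (fun w => f w * g w).
Proof.
move=> [mf [K fK]] [mg [L gL]]; split; first exact: measurable_funM.
by exists (K * L) => w; rewrite normrM ler_pM.
Qed.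

Lemma bmeasN f : bmeas f -> bmeas (fun w => - f w).
Proof.
move=> [mf [K fK]]; split; first exact: measurableT_comp.
by exists K => w; rewrite normrN.
Qed.

Lemma bmeasB f g : bmeas f -> bmeas g -> bmeas (fun w => f w - g w).
Proof. by move=> mf mg; apply: bmeasD => //; exact: bmeasN. Qed.

Lemma bmeasX f k : bmeas f -> bmeas (fun w => f w ^+ k).
Proof.
move=> mf; elim: k => [|k IH]; first exact: bmeas_cst.
by under eq_fun do rewrite exprS; exact: bmeasM.
Qed.

Lemma bmeas_norm f : bmeas f -> bmeas (fun w => `|f w|).
Proof.
move=> [mf [K fK]]; split; first exact: measurableT_comp.
by exists K => w; rewrite normr_id.
Qed.

Lemma bmeas_min f g : bmeas f -> bmeas g -> bmeas (fun w => Num.min (f w) (g w)).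
Proof.
move=> mf mg; under eq_fun do rewrite minr_absE.
apply: bmeasM (bmeas_cst _); apply: bmeasB; first exact: bmeasD.
by apply: bmeas_norm; exact: bmeasB.
Qed.

Lemma bmeas_sum (I : Type) (r : seq I) (P : pred I) (F : I -> T -> R) :
  (forall i, bmeas (F i)) -> bmeas (fun w => \sum_(i <- r | P i) F i w).
Proof.
move=> mF; elim: r => [|i r IH].
  by under eq_fun do rewrite big_nil; exact: bmeas_cst.
under eq_fun do rewrite big_cons; case: (P i) => //.
by apply: bmeasD.
Qed.

Lemma bmeas_bool (b : T -> bool) :
  measurable [set w | b w] -> bmeas (fun w => (b w)%:R).
Proof.
move=> mb; split; last by exists 1 => w; case: (b w); rewrite ?normr1 ?normr0.
rewrite (_ : (fun w => _) = \1_[set w | b w]); first exact: measurable_indic.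
by apply/funext => w; rewrite indicE mem_setE.
Qed.

Lemma bmeas_of01 f : measurable_fun [set: T] f -> (forall w, 0 <= f w <= 1) ->
  bmeas f.
Proof.
move=> mf f01; split=> //; exists 1 => w.
by case/andP: (f01 w) => ? ?; rewrite ger0_norm.
Qed.

End BoundedMeasurable.

Lemma bmeas_comp d d' (T : measurableType d) (T' : measurableType d')
    (R : realType) (f : T' -> R) (phi : T -> T') :
  measurable_fun setT phi -> bmeas f -> bmeas (fun w => f (phi w)).
Proof.
move=> mphi [mf [K fK]]; split; last by exists K.
exact: measurableT_comp.
Qed.

Section Mean.
Context {d : measure_display} {T : measurableType d} {R : realType}.
Variable P : probability T R.
Implicit Types (f g : T -> R).

Definition mean f : R := Rintegral P setT f.

Lemma bmeas_integrable f : bmeas f -> P.-integrable setT (EFin \o f).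
Proof.
move=> [mf [K fK]]; apply: measurable_bounded_integrable => //.
  by rewrite ltey_eq fin_num_measure.
exists K; split; first exact: num_real.
by move=> x Kx w _; apply: (le_trans (fK w)); exact: ltW.
Qed.

Lemma integral_mean f : bmeas f -> (\int[P]_w (f w)%:E)%E = (mean f)%:E.
Proof.
by move=> mf; rewrite /mean /Rintegral fineK//; apply: integrable_fin_num => //;
  exact: bmeas_integrable.
Qed.

Lemma mean_cst c : mean (fun=> c) = c.
Proof.
by rewrite /mean Rintegral_cst// (congr1 fine (probability_setT P)) mulr1.
Qed.

Lemma meanD f g : bmeas f -> bmeas g ->
  mean (fun w => f w + g w) = mean f + mean g.
Proof. by move=> mf mg; apply: RintegralD => //; exact: bmeas_integrable. Qed.

Lemma meanB f g : bmeas f -> bmeas g ->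
  mean (fun w => f w - g w) = mean f - mean g.
Proof. by move=> mf mg; apply: RintegralB => //; exact: bmeas_integrable. Qed.

Lemma meanZ c f : bmeas f -> mean (fun w => c * f w) = c * mean f.
Proof. by move=> mf; apply: RintegralZl => //; exact: bmeas_integrable. Qed.

Lemma mean_sum (I : Type) (r : seq I) (p : pred I) (F : I -> T -> R) :
  (forall i, bmeas (F i)) ->
  mean (fun w => \sum_(i <- r | p i) F i w) = \sum_(i <- r | p i) mean (F i).
Proof.
move=> mF; elim: r => [|i r IH].
  by rewrite big_nil -[RHS](mean_cst 0); congr mean; apply/funext => w;
    rewrite big_nil.
rewrite big_cons -IH; under eq_fun do rewrite big_cons.
by case: (p i) => //; rewrite meanD//; exact: bmeas_sum.
Qed.

Lemma ler_mean f g : bmeas f -> bmeas g -> (forall w, f w <= g w) ->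
  mean f <= mean g.
Proof. by move=> mf mg fg; apply: le_Rintegral => //; exact: bmeas_integrable. Qed.

Lemma mean_ge0 f : (forall w, 0 <= f w) -> 0 <= mean f.
Proof. by move=> f0; exact: Rintegral_ge0. Qed.

Lemma mean_le1 f : bmeas f -> (forall w, f w <= 1) -> mean f <= 1.
Proof.
by move=> mf f1; rewrite -[leRHS]mean_cst; apply: ler_mean => //; exact: bmeas_cst.
Qed.

Lemma ae_imply (A B : T -> Prop) : (forall w, A w -> B w) ->
  {ae P, forall w, A w} -> {ae P, forall w, B w}.
Proof. by move=> AB; exact: filterS. Qed.

Lemma eq_mean_ae f g : bmeas f -> bmeas g -> {ae P, forall w, f w = g w} ->
  mean f = mean g.
Proof.
move=> [mf _] [mg _] fg; rewrite /mean /Rintegral; congr fine.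
apply: ae_eq_integral => //; [exact/measurable_EFinP..|].
by apply: filterS fg => w fg _ /=; rewrite fg.
Qed.

(** The pointwise inequalities on neighbor graphs hold for pairwise distinct
    points only, that is, outside a null set. *)
Lemma ler_mean_ae f g : bmeas f -> bmeas g -> {ae P, forall w, f w <= g w} ->
  mean f <= mean g.
Proof.
move=> mf mg fg.
rewrite (@eq_mean_ae f (fun w => Num.min (f w) (g w)))//.
- apply: ler_mean => //; first exact: bmeas_min.
  by move=> w; rewrite ge_min lexx orbT.
- exact: bmeas_min.
- by apply: filterS fg => w /min_idPl ->.
Qed.

Lemma mean_bool (b : T -> bool) : measurable [set w | b w] ->
  mean (fun w => (b w)%:R) = fine (P [set w | b w]).
Proof.
move=> mb; rewrite /mean /Rintegral; congr fine.
transitivity (\int[P]_w (\1_[set w | b w] w)%:E)%E.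
  by apply: eq_integral => w _; rewrite indicE mem_setE.
by rewrite integral_indic// setIT.
Qed.

Lemma mean_norm f : bmeas f -> `|mean f| <= mean (fun w => `|f w|).
Proof. by move=> mf; apply: le_normr_Rintegral => //; exact: bmeas_integrable. Qed.

Lemma mean_cvg0 (F : nat -> T -> R) (K : R) : (forall n, bmeas (F n)) ->
  (forall n w, `|F n w| <= K) -> (forall w, F n w @[n --> \oo] --> 0) ->
  mean (F n) @[n --> \oo] --> 0.
Proof.
move=> mF FK F0.
have /= h := @dominated_cvg _ T R P setT measurableT
  (fun n w => (F n w)%:E) (cst 0%E) (cst K%:E).
suff : (mean (F n))%:E @[n --> \oo] --> 0%E by move/fine_cvg.
under eq_fun do rewrite -integral_mean//.
rewrite -(integral0 P setT); apply: h => //.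
- by move=> n; apply/measurable_EFinP; case: (mF n).
- by move=> w _; apply: cvg_EFin; [exact: nearW | exact: F0].
- exact: (bmeas_integrable (bmeas_cst K)).
- by move=> n w _; rewrite lee_fin.
Qed.

End Mean.

Lemma mean_pushforward d d' (T : measurableType d) (T' : measurableType d')
    (R : realType) (P : probability T R) (Q : probability T' R) (phi : T -> T')
    (f : T' -> R) :
  measurable_fun setT phi -> (forall A, measurable A -> Q A = P (phi @^-1` A)) ->
  bmeas f -> mean Q f = mean P (fun w => f (phi w)).
Proof.
move=> mphi QP mf; rewrite /mean /Rintegral; congr fine.
pose phi' : {mfun T >-> T'} := HB.pack phi (isMeasurableFun.Build _ _ _ _ phi mphi).
transitivity (\int[distribution P phi']_y (f y)%:E)%E.
  by apply: eq_measure_integral => A mA _; exact: QP.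
rewrite integral_distribution//; first by apply/measurable_EFinP; case: mf.
by apply: bmeas_integrable; exact: bmeas_comp.
Qed.

Section Fubini.
Context {d1 d2 : measure_display} {T1 : measurableType d1}
  {T2 : measurableType d2} {R : realType}.
Variables (P1 : probability T1 R) (P2 : probability T2 R).
Variable (f : T1 * T2 -> R).
Hypothesis mf : bmeas f.

Lemma bmeas_mean_r : bmeas (fun x => mean P2 (fun y => f (x, y))).
Proof.
have mfx x : bmeas (fun y => f (x, y)).
  by apply: bmeas_comp mf; exact: measurable_pair1.
split.
- apply/measurable_EFinP.
  rewrite (_ : _ \o _ = fubini_F P2 (EFin \o f)).
    by apply: measurable_fubini_F; exact: bmeas_integrable.
  by apply/funext => x /=; rewrite /fubini_F /= integral_mean.
- case: (mf) => _ [K fK]; exists K => x; rewrite (le_trans (mean_norm _ (mfx x)))//.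
  rewrite -[leRHS](mean_cst P2); apply: ler_mean => //.
    exact: bmeas_norm.
  exact: bmeas_cst.
Qed.

Lemma bmeas_mean_l : bmeas (fun y => mean P1 (fun x => f (x, y))).
Proof.
have mfx y : bmeas (fun x => f (x, y)).
  by apply: bmeas_comp mf; exact: measurable_pair2.
split.
- apply/measurable_EFinP.
  rewrite (_ : _ \o _ = fubini_G P1 (EFin \o f)).
    by apply: measurable_fubini_G; exact: bmeas_integrable.
  by apply/funext => y /=; rewrite /fubini_G /= integral_mean.
- case: (mf) => _ [K fK]; exists K => y; rewrite (le_trans (mean_norm _ (mfx y)))//.
  rewrite -[leRHS](mean_cst P1); apply: ler_mean => //.
    exact: bmeas_norm.
  exact: bmeas_cst.
Qed.

Lemma mean_prod_r : mean (P1 \x P2)%E f =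
  mean P1 (fun x => mean P2 (fun y => f (x, y))).
Proof.
apply: EFin_inj; rewrite -integral_mean// -integral_mean; last exact: bmeas_mean_r.
rewrite -(integral12_prod_meas1 (bmeas_integrable _ mf)).
apply: eq_integral => x _; rewrite /fubini_F /= integral_mean//.
by apply: bmeas_comp mf; exact: measurable_pair1.
Qed.

Lemma mean_prod_l : mean (P1 \x P2)%E f =
  mean P2 (fun y => mean P1 (fun x => f (x, y))).
Proof.
apply: EFin_inj; rewrite -integral_mean// -integral_mean; last exact: bmeas_mean_l.
rewrite -(integral21_prod_meas1 (bmeas_integrable _ mf)).
apply: eq_integral => y _; rewrite /fubini_G /= integral_mean//.
by apply: bmeas_comp mf; exact: measurable_pair2.
Qed.

End Fubini.

(** * Independent identically distributed sequences *)
Section SequenceSpace.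
Context {d : measure_display} {S : measurableType d}.

(** Boxes constraining an initial segment form a pi-system, which suffices to
    identify a law; constraining a coordinate to [setT] leaves it free. *)
Definition prefix_box (m : nat) (B : nat -> set S) : set (nat -> S) :=
  [set z | forall i, (i < m)%N -> B i (z i)].

Definition prefix_boxes : set (set (nat -> S)) :=
  [set A | exists m B, (forall i, measurable (B i)) /\ A = prefix_box m B].

(** All statistics are functions of the whole infinite sample. On this space
    renumbering the sample and inserting a fresh observation are compositions
    with a map of the indices, whatever the sample size. *)
Definition seq_space := g_sigma_algebraType prefix_boxes.

Lemma setI_closed_prefix_boxes : setI_closed prefix_boxes.
Proof.
move=> _ _ [m [B [mB ->]]] [m' [B' [mB' ->]]].
exists (maxn m m'), (fun i => (if (i < m)%N then B i else setT) `&`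
  (if (i < m')%N then B' i else setT)); split.
  by move=> i; apply: measurableI; case: ifP.
apply/seteqP; split=> z /=.
  by move=> [zB zB'] i _; split; case: ifP => // ?; [exact: zB|exact: zB'].
move=> zBB; split=> i im.
  by case: (zBB i); rewrite ?leq_max ?im.
by case: (zBB i); rewrite ?leq_max ?im ?orbT.
Qed.

Lemma measurable_coord i : measurable_fun [set: seq_space] (fun z => z i).
Proof.
move=> _ A mA; rewrite setTI; apply: sub_sigma_algebra.
exists i.+1, (fun j => if j == i then A else setT); split.
  by move=> j; case: ifP.
apply/seteqP; split=> z /=.
  by move=> Az j _; case: eqP => // ->.
by move/(_ i); rewrite eqxx ltnSn; exact.
Qed.

Lemma measurable_seq_space d' (T : measurableType d') (phi : T -> seq_space) :
  (forall i, measurable_fun setT (fun w => phi w i)) -> measurable_fun setT phi.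
Proof.
move=> mphi; apply: (@measurability _ _ T seq_space setT phi prefix_boxes erefl) => _ [_ [m [B [mB ->]]] <-].
rewrite setTI (_ : _ @^-1` _ = \bigcap_(i in [set i | (i < m)%N])
  ((fun w => phi w i) @^-1` B i)); last by [].
apply: bigcap_measurableType => i _; rewrite -[X in measurable X]setTI.
exact: mphi.
Qed.

Lemma measurable_reindex (pi : nat -> nat) :
  measurable_fun [set: seq_space] (fun z => (z \o pi : seq_space)).
Proof. by apply: measurable_seq_space => i; exact: measurable_coord. Qed.

Lemma seq_space_law_unique (R : realType) (P Q : probability seq_space R) :
  (forall m B, (forall i, measurable (B i)) ->
    P (prefix_box m B) = Q (prefix_box m B)) ->
  forall A, measurable A -> P A = Q A.
Proof.
move=> PQ A mA.
apply: (@measure_unique _ R seq_space prefix_boxes (fun=> setT) _ _ _ _ P Q) => //.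
- exact: setI_closed_prefix_boxes.
- move=> _; exists 0%N, (fun=> setT); split=> //.
  by apply/seteqP; split.
- by rewrite bigcup_const.
- by move=> _ [m [B [mB ->]]]; exact: PQ.
- by move=> _; rewrite ltey_eq fin_num_measure.
Qed.

End SequenceSpace.
Arguments seq_space {d} S.

Section IndependentLaw.
Context {d : measure_display} {S : measurableType d} {R : realType}.
Notation Omega := (seq_space S).

Definition iid_law (Q : probability Omega R) :=
  forall (J : seq nat) (B : nat -> set S), uniq J ->
    (forall j, measurable (B j)) ->
    Q [set z : Omega | forall j, j \in J -> B j (z j)] =
    (\prod_(j <- J) Q [set z : Omega | B j (z 0%N)])%E.

Variable Q : probability Omega R.
Hypothesis iidQ : iid_law Q.

Lemma iid_reindex_box (pi : nat -> nat) m (B : nat -> set S) : injective pi ->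
  (forall i, measurable (B i)) ->
  Q [set z : Omega | prefix_box m B (z \o pi)] =
  (\prod_(i < m) Q [set z : Omega | B i (z 0%N)])%E.
Proof.
move=> ipi mB.
pose B' j := B (index j (map pi (iota 0 m))).
have idx i : (i < m)%N -> index (pi i) (map pi (iota 0 m)) = i.
  move=> im; rewrite index_map//.
  have {1}<- : nth 0%N (iota 0 m) i = i by rewrite nth_iota.
  by rewrite index_uniq ?size_iota ?iota_uniq.
have -> : [set z : Omega | prefix_box m B (z \o pi)] =
    [set z : Omega | forall j, j \in map pi (iota 0 m) -> B' j (z j)].
  apply/seteqP; split=> z /=.
    move=> zB j /mapP[i]; rewrite mem_iota add0n => /= im ->.
    by rewrite /B' idx//; exact: zB.
  move=> zB i im; have := zB (pi i); rewrite /B' idx//; apply.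
  by rewrite map_f// mem_iota.
rewrite iidQ ?map_inj_uniq ?iota_uniq// => [|j]; last exact: mB.
rewrite big_map (_ : iota 0 m = index_iota 0 m) ?big_mkord; last first.
  by rewrite /index_iota subn0.
by apply: eq_bigr => i _; rewrite /B' idx.
Qed.

(** Exchangeability: both laws give a prefix box the product of the marginal
    probabilities of its sides. *)
Lemma iid_reindex (pi : nat -> nat) (A : set Omega) : injective pi -> measurable A ->
  Q A = Q [set z : Omega | A (z \o pi)].
Proof.
move=> ipi mA.
pose pi' : {mfun Omega >-> Omega} :=
  HB.pack (fun z : Omega => (z \o pi : Omega))
  (isMeasurableFun.Build _ _ _ _ _ (measurable_reindex pi)).
apply: (@seq_space_law_unique _ _ _ _ (distribution Q pi')) => // m B mB.
rewrite -[RHS]/(Q [set z : Omega | prefix_box m B (z \o pi)]) iid_reindex_box//.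
by rewrite -(@iid_reindex_box id m B).
Qed.

Lemma mean_reindex (pi : nat -> nat) (f : Omega -> R) : injective pi -> bmeas f ->
  mean Q f = mean Q (fun z => f (z \o pi)).
Proof.
move=> ipi mf; apply: mean_pushforward => //; first exact: measurable_reindex.
by move=> A mA; exact: iid_reindex.
Qed.

Definition evens (i : nat) : nat := i.*2.
Definition odds (i : nat) : nat := i.*2.+1.

(** Two independent copies of the sequence can be read off a single one, along
    the even and the odd indices. *)
Definition interleave (p : Omega * Omega) : Omega :=
  fun i => if odd i then p.2 i./2 else p.1 i./2.

Lemma interleave_evens p : interleave p \o evens = p.1.
Proof. by apply/funext => i; rewrite /interleave/= odd_double doubleK. Qed.

Lemma interleave_odds p : interleave p \o odds = p.2.
Proof.
by apply/funext => i; rewrite /interleave/= odd_double/= uphalf_double.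
Qed.

Lemma measurable_interleave : measurable_fun setT interleave.
Proof.
apply: measurable_seq_space => i; rewrite /interleave; case: (odd i).
  exact: measurableT_comp (measurable_coord _) measurable_snd.
exact: measurableT_comp (measurable_coord _) measurable_fst.
Qed.

Lemma iid_interleave (A : set Omega) : measurable A ->
  Q A = (Q \x Q)%E (interleave @^-1` A).
Proof.
move=> mA.
pose il' : {mfun (Omega * Omega)%type >-> Omega} :=
  HB.pack interleave (isMeasurableFun.Build _ _ _ _ _ measurable_interleave).
apply: (@seq_space_law_unique _ _ _ _ (distribution (Q \x Q)%E il')) => // m B mB.
rewrite -[RHS]/((Q \x Q)%E (interleave @^-1` prefix_box m B)).
pose Bh i := if (i < m)%N then B i else setT.
have mBh i : measurable (Bh i) by rewrite /Bh; case: ifP.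
have -> : prefix_box m B = prefix_box m.*2 Bh.
  apply/seteqP; split=> z zB i im; first by rewrite /Bh; case: ifP => // /zB.
  have := zB i; rewrite /Bh im; apply.
  by rewrite (leq_trans im)// -addnn leq_addr.
have -> : interleave @^-1` prefix_box m.*2 Bh =
    prefix_box m (fun i => Bh i.*2) `*` prefix_box m (fun i => Bh i.*2.+1).
  apply/seteqP; split=> -[z z'] /=.
    move=> zB; split=> i im.
      have := zB i.*2; rewrite /interleave odd_double doubleK; apply.
      by rewrite ltn_double.
    have := zB i.*2.+1; rewrite /interleave/= odd_double/= uphalf_double; apply.
    by rewrite ltn_Sdouble.
  move=> [zB zB'] i im; rewrite /interleave.
  have hm : (i./2 < m)%N by rewrite ltn_half_double.
  have := odd_double_half i; case: (odd i) => /= iE.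
    by have := zB' _ hm; rewrite /= -add1n iE.
  by have := zB _ hm; rewrite /= -[(i./2).*2]add0n iE.
have mbox (B' : nat -> set S) : (forall i, measurable (B' i)) ->
    measurable (prefix_box m B' : set Omega).
  by move=> mB'; apply: sub_sigma_algebra; exists m, B'.
rewrite product_measure1E//; try exact: mbox.
have QE k (B' : nat -> set S) : (forall i, measurable (B' i)) ->
    Q (prefix_box k B') =
    (\prod_(i < k) Q [set z : Omega | B' i (z 0%N)])%E.
  by move=> mB'; exact: (@iid_reindex_box id).
transitivity (\prod_(i < m.*2) Q [set z : Omega | Bh i (z 0%N)])%E.
  exact: QE.
transitivity (\prod_(i < m) Q [set z : Omega | Bh i.*2 (z 0%N)] *
    \prod_(i < m) Q [set z : Omega | Bh i.*2.+1 (z 0%N)])%E; last first.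
  by congr (_ * _)%E; apply/esym; exact: QE.
elim: (m) => [|k IH]; first by rewrite !big_ord0 mule1.
by rewrite doubleS !big_ord_recr/= IH -!muleA; congr (_ * _)%E; rewrite !muleA;
  congr (_ * _)%E; rewrite muleC.
Qed.

End IndependentLaw.

(** * Resampling and the Efron-Stein inequality *)
Section EfronStein.
Context {d : measure_display} {S : measurableType d} {R : realType}.
Notation Omega := (seq_space S).
Variable Q : probability Omega R.
Hypothesis iidQ : iid_law Q.

Lemma bmeas_reindex (pi : nat -> nat) (f : Omega -> R) :
  bmeas f -> bmeas (fun z : Omega => f (z \o pi)).
Proof. exact: bmeas_comp (measurable_reindex pi). Qed.

(** Independence enters through this identity: what depends on the even
    coordinates is independent of what depends on the odd ones. *)
Lemma mean_two_copies (f : Omega * Omega -> R) : bmeas f ->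
  mean Q (fun z => f (z \o evens, z \o odds)) = mean (Q \x Q)%E f.
Proof.
move=> mf.
have mg : bmeas (fun z : Omega => f (z \o evens, z \o odds)).
  apply: bmeas_comp mf; apply: measurable_fun_pair; exact: measurable_reindex.
rewrite (mean_pushforward measurable_interleave (iid_interleave iidQ) mg).
by congr mean; apply/funext => p; rewrite interleave_evens interleave_odds -surjective_pairing.
Qed.

Definition upd (z : Omega) (j : nat) (s : S) : Omega :=
  fun i => if i == j then s else z i.

Lemma measurable_upd j :
  measurable_fun setT (fun p : Omega * Omega => upd p.1 j (p.2 j)).
Proof.
apply: measurable_seq_space => i; rewrite /upd; case: eqP => _.
  exact: measurableT_comp (measurable_coord _) measurable_snd.
exact: measurableT_comp (measurable_coord _) measurable_fst.
Qed.

(** By exchangeability the sequence may be read along the even indices, except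
    for its j-th entry, which is read along the odd ones. *)
Lemma mean_resample_prod j (f : Omega -> R) : bmeas f ->
  mean Q f = mean (Q \x Q)%E (fun p => f (upd p.1 j (p.2 j))).
Proof.
move=> mf; pose th i := if i == j then odds j else evens i.
have ith : injective th.
  by move=> a b; rewrite /th /odds /evens; case: eqP; case: eqP; lia.
rewrite (mean_reindex iidQ ith mf) -mean_two_copies.
  congr mean; apply/funext => z; congr f; apply/funext => i.
  by rewrite /upd /th /=; case: eqP => // ->.
exact: bmeas_comp (measurable_upd j) mf.
Qed.

(** Fubini on the previous identity; the order of integration decides whether
    the resampled coordinate or the rest of the sequence is frozen. *)
Lemma mean_resample j (f : Omega -> R) : bmeas f ->
  mean Q f = mean Q (fun z' => mean Q (fun z => f (upd z j (z' j)))).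
Proof.
move=> mf; rewrite (mean_resample_prod j mf) mean_prod_l//.
exact: bmeas_comp (measurable_upd j) mf.
Qed.

Lemma mean_resample_r j (f : Omega -> R) : bmeas f ->
  mean Q f = mean Q (fun z => mean Q (fun z' => f (upd z j (z' j)))).
Proof.
move=> mf; rewrite (mean_resample_prod j mf) mean_prod_r//.
exact: bmeas_comp (measurable_upd j) mf.
Qed.

Definition mean_sqr_dev (f : Omega -> R) := mean Q (fun z => (f z - mean Q f) ^+ 2).

Lemma mean_sqrB_cst (f : Omega -> R) c : bmeas f ->
  mean Q (fun z => (f z - c) ^+ 2) =
  mean Q (fun z => f z ^+ 2) - 2 * c * mean Q f + c ^+ 2.
Proof.
move=> mf.
have m2 : bmeas (fun z => f z ^+ 2) by exact: bmeasX.
rewrite -meanZ// -meanB//; last by apply: bmeasM => //; exact: bmeas_cst.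
rewrite -[c ^+ 2 in RHS](mean_cst Q) -meanD//; last exact: bmeas_cst.
  by congr mean; apply/funext => z; ring.
by apply: bmeasB => //; apply: bmeasM => //; exact: bmeas_cst.
Qed.

Lemma mean_sqr_devE (f : Omega -> R) : bmeas f ->
  mean_sqr_dev f = mean Q (fun z => f z ^+ 2) - mean Q f ^+ 2.
Proof. by move=> mf; rewrite /mean_sqr_dev mean_sqrB_cst//; ring. Qed.

(** The mean is the best constant predictor in the quadratic sense. *)
Lemma mean_sqr_dev_le (f : Omega -> R) c : bmeas f ->
  mean_sqr_dev f <= mean Q (fun z => (f z - c) ^+ 2).
Proof.
move=> mf; rewrite mean_sqr_devE// mean_sqrB_cst// -subr_ge0.
by rewrite (_ : _ - _ = (mean Q f - c) ^+ 2) ?sqr_ge0//; ring.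
Qed.

(** Reading the sequence along this map replaces its j-th entry by the n-th,
    which a statistic of the first n entries does not see otherwise. *)
Definition repl (n j : nat) (i : nat) := if i == j then n else i.

Variables (n : nat) (f : Omega -> R).
Hypothesis mf : bmeas f.
Hypothesis f_dep : forall z z' : Omega, (forall i, (i < n)%N -> z i = z' i) ->
  f z = f z'.

Let F (tau : nat -> nat) (z : Omega) := f (z \o tau).

Let mF tau : bmeas (F tau).
Proof. exact: bmeas_reindex. Qed.

Let eqF tau tau' : (forall i, (i < n)%N -> tau i = tau' i) -> F tau = F tau'.
Proof.
by move=> e; apply/funext => z; apply: f_dep => i im /=; rewrite e.
Qed.

Let D j := mean Q (fun z => (f z - f (z \o repl n j)) ^+ 2).

(** Any two samples that differ in one entry are jointly distributed as a sample
    and its replacement. *)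
Let mean_sqr_theta j al be th : injective th ->
  (forall i, (i < n)%N -> al i = th i) ->
  (forall i, (i < n)%N -> be i = th (repl n j i)) ->
  mean Q (fun z => (F al z - F be z) ^+ 2) = D j.
Proof.
move=> ith al_th be_th; rewrite /D [RHS](mean_reindex iidQ ith).
  by rewrite (eqF al_th) (eqF be_th).
by apply: bmeasX; apply: bmeasB => //; exact: bmeas_reindex.
Qed.

Let tau (k i : nat) := if (i < k)%N then odds i else evens i.
Let swp (j i : nat) :=
  if i == evens j then odds j else if i == odds j then evens j else i.

Let iswp j : injective (swp j).
Proof.
by move=> a b; rewrite /swp /odds /evens;
  repeat case: ifP; lia.
Qed.

(** One step of the telescoping sum. Exchanging the j-th entries of the two
    copies swaps the two hybrids, so the mean is half that of a product of two
    differences, each distributed as the effect of one replacement. *)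
Let hybrid_step j : (j < n)%N ->
  mean Q (fun z => F evens z * (F (tau j) z - F (tau j.+1) z)) <= D j / 2.
Proof.
move=> jn.
have mB al be : bmeas (fun z => F al z - F be z) by exact: bmeasB.
have mFB g al be : bmeas (fun z => F g z * (F al z - F be z)) by exact: bmeasM.
set A := mean _ _.
have AE : A = mean Q (fun z => F (swp j \o evens) z *
    (F (tau j.+1) z - F (tau j) z)).
  rewrite /A (mean_reindex iidQ (@iswp j))//.
  have sF g z : F g (z \o swp j) = F (swp j \o g) z by [].
  congr mean; apply/funext => z; rewrite !sF; congr (_ * (_ - _));
    congr (_ z); apply: eqF => i im;
    by rewrite /tau/= /swp /odds /evens; repeat case: ifP; lia.
(* average of the two expressions of A *)
have : 2 * A = mean Q (fun z => (F evens z - F (swp j \o evens) z) *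
    (F (tau j) z - F (tau j.+1) z)).
  rewrite mulr_natl mulr2n {2}AE /A -meanD//.
  by congr mean; apply/funext => z; ring.
have D1 : mean Q (fun z => (F evens z - F (swp j \o evens) z) ^+ 2) = D j.
  apply: (@mean_sqr_theta j _ _ (fun i => if i == n then odds j else evens i)).
  - by move=> a b; rewrite /odds /evens; repeat case: ifP; lia.
  - by move=> i im; repeat case: ifP; lia.
  - move=> i im; rewrite /repl /swp /odds /evens/=.
    by repeat case: ifP; lia.
have D2 : mean Q (fun z => (F (tau j) z - F (tau j.+1) z) ^+ 2) = D j.
  apply: (@mean_sqr_theta j _ _ (fun i => if (i < j)%N then odds i else
    if i == n then odds j else evens i)).
  - by move=> a b; rewrite /odds /evens; repeat case: ifP; lia.
  - by move=> i im; rewrite /tau; repeat case: ifP; lia.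
  - move=> i im; rewrite /repl /tau /odds /evens.
    by repeat case: ifP; lia.
have : mean Q (fun z => (F evens z - F (swp j \o evens) z) *
    (F (tau j) z - F (tau j.+1) z)) <=
   mean Q (fun z => 2^-1 * ((F evens z - F (swp j \o evens) z) ^+ 2 +
     (F (tau j) z - F (tau j.+1) z) ^+ 2)).
  apply: ler_mean => [||z].
  - exact: bmeasM.
  - by apply: bmeasM; [exact: bmeas_cst|apply: bmeasD; exact: bmeasX].
  - set a := _ - _; set b := _ - _; have := sqr_ge0 (a - b); nra.
rewrite meanZ; last by apply: bmeasD; exact: bmeasX.
rewrite meanD; [|exact: bmeasX..].
rewrite D1 D2; lra.
Qed.

(** The variance is E f(Z) (f(Z) - f(Z')) for an independent copy Z' of Z;
    passing from Z to Z' one entry at a time gives a telescoping sum. *)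
Theorem efron_stein :
  mean_sqr_dev f <= 2^-1 * \sum_(j < n)
    mean Q (fun z => (f z - f (z \o repl n j)) ^+ 2).
Proof.
have mFM al be : bmeas (fun z => F al z * F be z) by exact: bmeasM.
have ievens : injective evens by move=> a b; rewrite /evens; lia.
have mm : mean Q f ^+ 2 = mean Q (fun z => F evens z * F odds z).
  pose g (p : Omega * Omega) := f p.1 * f p.2.
  have mg : bmeas g.
    by apply: bmeasM; apply: bmeas_comp mf;
      [exact: measurable_fst|exact: measurable_snd].
  rewrite (_ : mean Q (fun z => _ * _) = mean (Q \x Q)%E g).
    rewrite mean_prod_r//= expr2 -meanZ//.
    by congr mean; apply/funext => z; rewrite /g /= meanZ// mulrC.
  by rewrite -mean_two_copies.
have -> : mean_sqr_dev f = \sum_(j < n)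
    mean Q (fun z => F evens z * (F (tau j) z - F (tau j.+1) z)).
  rewrite mean_sqr_devE// mm (mean_reindex iidQ ievens (bmeasX 2 mf)) -meanB//;
    last by apply: bmeasX; exact: bmeas_reindex.
  rewrite -mean_sum; last by move=> i; apply: bmeasM => //; exact: bmeasB.
  congr mean; apply/funext => z; rewrite -mulr_sumr.
  have := @telescope_sumr _ 0%N n (fun k => - F (tau k) z) (leq0n n).
  rewrite big_mkord => e.
  rewrite (eq_bigr (fun k : 'I_n => - F (tau k.+1) z - - F (tau k) z)); last first.
    by move=> i _; rewrite opprK addrC.
  rewrite e opprK (_ : F (tau 0) = F evens)// (_ : F (tau n) = F odds).
    by rewrite -/(F evens z); ring.
  by apply: eqF => i im; rewrite /tau im.
rewrite mulr_sumr; apply: ler_sum => j _; rewrite mulrC.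
exact: hybrid_step.
Qed.

End EfronStein.

(** * Minimizers over a finite type *)
Section ArgMin.
Context {R : realType} {I : finType}.
Implicit Types (P : pred I) (F : I -> R).

Let ap P F : pred I := [pred a | P a & [forall (b | P b), F a <= F b]].

Lemma pick_argmin i P F a : P a ->
  pick (ap P F) = Some [arg min_(k < i | P k) F k]%O.
Proof.
move=> Pa; rewrite /Order.arg_min /extremum -/(ap P F).
case: pickP => //= noP; exfalso.
have := @extremumP _ _ <=%R a P F lexx le_trans le_total Pa.
case=> b Pb bmin; have /negP[] := noP b; apply/andP; split=> //.
by apply/forallP => j; apply/implyP; exact: bmin.
Qed.

Lemma argmin_spec i P F a : P a ->
  P [arg min_(k < i | P k) F k]%O /\
  forall j, P j -> F [arg min_(k < i | P k) F k]%O <= F j.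
Proof.
move=> /(pick_argmin i F); case: pickP => // b /andP[Pb /forallP bmin] [<-].
by split=> // j Pj; exact: (implyP (bmin j)).
Qed.

Lemma argmin_default i P F : (forall j, ~~ P j) ->
  [arg min_(k < i | P k) F k]%O = i.
Proof.
move=> nP; rewrite /Order.arg_min /extremum; case: pickP => //= b.
by rewrite (negbTE (nP b)).
Qed.

(** [pick] returns the first witness in a fixed enumeration. *)
Lemma pick_avoid (p : pred I) a j : pick p = Some a -> a != j ->
  pick (predI p (predC1 j)) = Some a.
Proof.
rewrite /pick /enum_mem; elim: (Finite.enum I) => //= b s IH.
rewrite -[in_mem b _]/(p b) -[in_mem b (mem (predI _ _))]/(p b && (b != j)).
by case: (p b) => //= -[->] ->.
Qed.

(** When neither minimizer is j, both problems have the same minimal value off j,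
    hence the same minimizers off j, and ties are resolved identically. *)
Lemma argmin_local i P P' F F' (j : I) : i != j ->
  (forall k, k != j -> P k = P' k /\ F k = F' k) ->
  [arg min_(k < i | P k) F k]%O != j ->
  [arg min_(k < i | P' k) F' k]%O != j ->
  [arg min_(k < i | P k) F k]%O = [arg min_(k < i | P' k) F' k]%O.
Proof.
move=> ij PF; set m := Order.arg_min _ P F; set m' := Order.arg_min _ P' F' => mj m'j.
have [[k /andP[kj Pk]]|nP] := pselect (exists k, (k != j) && P k); last first.
  have noP0 k : k != j -> ~~ P k.
    by move=> kj; apply/negP => Pk; apply: nP; exists k; rewrite kj.
  have noP k : ~~ P k.
    have [->|/noP0//] := eqVneq k j; apply/negP => Pj.
    by have [/= Pm _] := argmin_spec i F Pj; have := noP0 _ mj; rewrite Pm.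
  have noP' k : ~~ P' k.
    have nok l : l != j -> ~~ P' l by move=> lj; have [<- _] := PF _ lj.
    have [->|/nok//] := eqVneq k j; apply/negP => Pj.
    by have [/= Pm _] := argmin_spec i F' Pj; have := nok _ m'j; rewrite Pm.
  by rewrite /m /m' !argmin_default.
have P'k : P' k by have [<- _] := PF _ kj.
have [Pm minm] := argmin_spec i F Pk; rewrite -/m in Pm minm.
have [Pm' minm'] := argmin_spec i F' P'k; rewrite -/m' in Pm' minm'.
have [PPm FFm] := PF _ mj; have [PPm' FFm'] := PF _ m'j.
have Fmm' : F m = F' m'.
  apply/eqP; rewrite eq_le -{1}FFm' minm ?PPm'//=.
  by rewrite FFm minm' -?PPm.
have := pick_avoid (pick_argmin i F Pk) mj.
have := pick_avoid (pick_argmin i F' P'k) m'j.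
rewrite (@eq_pick _ _ (predI (ap P F) (predC1 j))); first by move=> -> [].
move=> l /=; have [->|lj] := eqVneq l j; first by rewrite !andbF.
have [PPl FFl] := PF _ lj; rewrite !andbT. rewrite /ap/= PPl; case: (boolP (P' l)) => //= P'l.
apply/forallP/forallP => h q; apply/implyP => Pq.
  rewrite FFl (le_trans _ (minm _ Pq))// Fmm'.
  exact: (implyP (h m')).
rewrite -FFl (le_trans _ (minm' _ Pq))// -Fmm'.
exact: (implyP (h m)).
Qed.

End ArgMin.

Section MeasurableArgMin.
Context {d : measure_display} {T : measurableType d} {R : realType}.

Lemma measurable_and (a b : T -> bool) : measurable [set w | a w] ->
  measurable [set w | b w] -> measurable [set w | a w && b w].
Proof.
move=> ma mb; rewrite (_ : mkset _ = [set w | a w] `&` [set w | b w]).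
  exact: measurableI.
by apply/seteqP; split => w /= => [/andP|[-> ->]].
Qed.

Lemma measurable_neg (a : T -> bool) : measurable [set w | a w] ->
  measurable [set w | ~~ a w].
Proof.
move=> ma; rewrite (_ : mkset _ = ~` [set w | a w]); first exact: measurableC.
by apply/seteqP; split => w /= /negP.
Qed.

(** A function of finitely many measurable tests is measurable: the tests take
    finitely many joint values. *)
Lemma measurable_finbool (I : finType) (b : T -> I -> bool)
    (Phi : {ffun I -> bool} -> bool) :
  (forall i, measurable [set w | b w i]) ->
  measurable [set w | Phi [ffun i => b w i]].
Proof.
move=> mb.
rewrite (_ : mkset _ = \bigcup_(e in [set` [pred e | Phi e]])
    [set w | [forall i, b w i == e i]]); last first.
  apply/seteqP; split => w /=.
    by move=> Pw; exists [ffun i => b w i] => //=; apply/forallP => i; rewrite ffunE.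
  move=> [e /= Pe /forallP be]; rewrite (_ : [ffun _ => _] = e)//.
  by apply/ffunP => i; rewrite ffunE; exact/eqP.
apply: fin_bigcup_measurable => [|e _].
  exact: finite_finset.
rewrite (_ : mkset _ = \bigcap_(i in [set: I]) [set w | b w i == e i]); last first.
  apply/seteqP; split => w /= => [/forallP h i _|h]; first exact: h.
  by apply/forallP => i; exact: h.
apply: fin_bigcap_measurable => // i _; case: (e i).
  by under eq_set do rewrite eqb_id.
by under eq_set do rewrite eqbF_neg; exact: measurable_neg.
Qed.

(** The minimizer is determined by the finitely many comparisons. *)
Lemma measurable_argmin (I : finType) (i j : I) (P : T -> pred I)
    (F : T -> I -> R) :
  (forall k, measurable [set w | P w k]) ->
  (forall k l, measurable [set w | F w k <= F w l]) ->
  measurable [set w | [arg min_(k < i | P w k) F w k]%O == j].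
Proof.
move=> mP mF.
pose b w (u : I + I * I) := match u with
  inl k => P w k | inr kl => F w kl.1 <= F w kl.2 end.
pose Phi (e : {ffun (I + I * I)%type -> bool}) :=
  odflt i [pick a | e (inl a) && [forall (c | e (inl c)), e (inr (a, c))]] == j.
rewrite (_ : mkset _ = [set w | Phi [ffun u => b w u]]).
  by apply: measurable_finbool => -[k|[k l]] /=.
apply: eq_set => w; rewrite /Phi /Order.arg_min /extremum; congr (is_true (odflt i _ == j)).
apply: eq_pick => a /=; rewrite !ffunE /=; congr (_ && _).
by apply: eq_forallb => c; rewrite !ffunE.
Qed.

Lemma measurable_bool_set (b : T -> bool) : measurable_fun setT b ->
  measurable [set w | b w].
Proof.
move=> mb; have := mb measurableT [set true] I.
by rewrite setTI.
Qed.

Lemma measurable_ler (f g : T -> R) : measurable_fun setT f ->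
  measurable_fun setT g -> measurable [set w | f w <= g w].
Proof.
by move=> mf mg; apply: measurable_bool_set; exact: measurable_fun_ler.
Qed.

Lemma measurable_ltr (f g : T -> R) : measurable_fun setT f ->
  measurable_fun setT g -> measurable [set w | f w < g w].
Proof.
by move=> mf mg; apply: measurable_bool_set; exact: measurable_fun_ltr.
Qed.

End MeasurableArgMin.

(** * Cells and cones in Euclidean space *)

Lemma sqr_norm (R : realDomainType) (x : R) : `|x| ^+ 2 = x ^+ 2.
Proof. exact/real_normK/num_real. Qed.

Section Grid.
Context {R : realType} {d : nat}.

(** Index of the grid cell of side 1/p that contains u, for u in the cube of
    half-side m; points outside of the cube get a meaningless index. *)
Definition cell (m p : nat) (u : 'I_d -> R) : {ffun 'I_d -> 'I_(2 * m * p).+1} :=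
  [ffun l => inord (Num.truncn (p%:R * (u l + m%:R)))].

Lemma cell_close m p (u v : 'I_d -> R) l :
  (forall l, `|u l| <= m%:R) -> (forall l, `|v l| <= m%:R) ->
  cell m p u = cell m p v -> p%:R * `|u l - v l| < 1.
Proof.
move=> um vm /ffunP /(_ l); rewrite !ffunE.
have pos (w : 'I_d -> R) : (forall l, `|w l| <= m%:R) -> 0 <= p%:R * (w l + m%:R).
  move=> /(_ l); rewrite ler_norml => /andP[h _]; apply: mulr_ge0 => //; lra.
have bd (w : 'I_d -> R) : (forall l, `|w l| <= m%:R) ->
    (Num.truncn (p%:R * (w l + m%:R)) < (2 * m * p).+1)%N.
  move=> wm; rewrite ltnS -(ler_nat R) (le_trans (_ : _ <= p%:R * (w l + m%:R)))//.
    by rewrite truncn_le pos.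
  rewrite !natrM [leRHS]mulrC ler_wpM2l//.
  by move: (wm l); rewrite ler_norml => /andP[_]; lra.
move=> /(congr1 val); rewrite /= !inordK ?bd// => e.
have /andP[u1 u2] := truncn_itv (pos _ um).
have /andP[v1 v2] := truncn_itv (pos _ vm).
rewrite e -natr1 in u1 u2; rewrite -natr1 in v2.
rewrite -[p%:R]ger0_norm// -normrM ltr_norml; apply/andP; split; lra.
Qed.

Definition sqd (x y : d.-tuple R) : R := \sum_(k < d) (tnth x k - tnth y k) ^+ 2.

Lemma sqd_ge0 x y : 0 <= sqd x y.
Proof. by apply: sumr_ge0 => k _; exact: sqr_ge0. Qed.

Lemma eucl_dist_le x y y' : (eucl_dist x y <= eucl_dist x y') = (sqd x y <= sqd x y').
Proof. by rewrite /eucl_dist ler_sqrt// sqd_ge0. Qed.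

Lemma sqdC x y : sqd x y = sqd y x.
Proof. by apply: eq_bigr => k _; ring. Qed.

Lemma sqr_le_sqd x y k : (tnth x k - tnth y k) ^+ 2 <= sqd x y.
Proof.
rewrite /sqd (bigD1 k)//= lerDl; apply: sumr_ge0 => l _; exact: sqr_ge0.
Qed.

Lemma sqd_cell m p x y : (0 < p)%N ->
  (forall l, `|tnth x l| <= m%:R) -> (forall l, `|tnth y l| <= m%:R) ->
  cell m p (tnth x) = cell m p (tnth y) -> p%:R ^+ 2 * sqd x y <= d%:R.
Proof.
move=> p0 xm ym xy; rewrite /sqd mulr_sumr.
rewrite -[leRHS]mulr1 -[d in leRHS]card_ord mulr_natl -sumr_const.
apply: ler_sum => l _; rewrite -exprMn -sqr_norm normrM ger0_norm//.
by rewrite expr_le1 ?mulr_ge0// ltW//; exact: (cell_close l xm ym xy).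
Qed.

(** Two points seen from the origin under an angle of less than 60 degrees: the
    farther one is strictly closer to the nearer one than to the origin.
    The bound on the distance of the directions u and v says that their scalar
    product exceeds 1/2. *)
Lemma cone_lt (u v : 'I_d -> R) (r r' : R) : 0 < r -> r <= r' ->
  \sum_l u l ^+ 2 = 1 -> \sum_l v l ^+ 2 = 1 ->
  \sum_l (u l - v l) ^+ 2 < 1 ->
  \sum_l (r * u l - r' * v l) ^+ 2 < r' ^+ 2.
Proof.
move=> r0 rr' u1 v1 uv.
pose s := \sum_l u l * v l.
have E a b : \sum_l (a * u l - b * v l) ^+ 2 = a ^+ 2 + b ^+ 2 - 2 * a * b * s.
  transitivity (a ^+ 2 * (\sum_l u l ^+ 2) + b ^+ 2 * (\sum_l v l ^+ 2) -
      2 * a * b * s); last by rewrite u1 v1 !mulr1.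
  rewrite /s !mulr_sumr.
  by rewrite -big_split/= -sumrB; apply: eq_bigr => l _; ring.
rewrite E; have := E 1 1; under eq_bigr do rewrite !mul1r.
move: uv; set t := \sum_l (u l - v l) ^+ 2 => t1 tE.
have s2 : 1 / 2 < s by lra.
have r'0 : 0 < r' by exact: lt_le_trans rr'.
have h : 0 < 2 * r' * s - r.
  by have := mulr_gt0 r'0 (_ : 0 < 2 * s - 1); rewrite subr_gt0; lra.
have := mulr_gt0 r0 h; lra.
Qed.

End Grid.

Lemma card_le_add3 (I : finType) (A B C D : pred I) :
  (forall i, A i -> [|| B i, C i | D i]) -> (#|A| <= #|B| + #|C| + #|D|)%N.
Proof.
move=> ABCD; rewrite -!sum1_card.
rewrite !(big_mkcond (fun i => i \in _))/= -!big_split/=.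
apply: leq_sum => i _; have := ABCD i; rewrite !unfold_in.
by case: (A i) (B i) (C i) (D i) => [] [] [] [] // /(_ isT).
Qed.

(** * Neighbor rules *)

Section NeighborRules.
Context {R : realType} {d : nat} (k0 : 'I_d).
Notation S := (d.-tuple R * R)%type.
Notation Omega := (seq_space S).

(** Distinctness of a single coordinate is enough, and continuity of the
    distribution function gives it almost surely. *)
Definition distinct n (x : 'I_n -> d.-tuple R) := injective (fun i => tnth (x i) k0).

Definition xs (n : nat) (z : Omega) : 'I_n -> d.-tuple R := fun i => (z i).1.
Definition ys (n : nat) (z : Omega) : 'I_n -> R := fun i => (z i).2.

Lemma measurable_xs n i : measurable_fun setT (fun z : Omega => @xs n z i).
Proof. exact: measurableT_comp measurable_fst (measurable_coord i). Qed.

Lemma measurable_ys n i : measurable_fun setT (fun z : Omega => @ys n z i).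
Proof. exact: measurableT_comp measurable_snd (measurable_coord i). Qed.

Lemma measurable_xs_tnth n i k :
  measurable_fun setT (fun z : Omega => tnth (@xs n z i) k).
Proof.
exact: measurableT_comp (measurable_tnth k) (measurable_xs i).
Qed.

Definition crosses n (x : 'I_n -> d.-tuple R) (N : 'I_n -> 'I_n) k s : pred 'I_n :=
  fun i => (tnth (x i) k <= s) != (tnth (x (N i)) k <= s).

Definition outside n (x : 'I_n -> d.-tuple R) m : pred 'I_n :=
  fun i => ~~ [forall l, `|tnth (x i) l| <= m%:R].

Definition near_level n (x : 'I_n -> d.-tuple R) k s p : pred 'I_n :=
  fun i => `|tnth (x i) k - s| <= p.+1%:R^-1.

(** What the argument needs to know of a neighbor map, so that it applies to the
    nearest and to the right nearest neighbor alike. The in-degree bound says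
    that one point is the neighbor of few, [nb_local] that a point matters only
    to those that have it as neighbor, and [nb_crossing] that edges are short:
    up to a bounded number of exceptions, an edge crosses a hyperplane only if it
    starts near that hyperplane or outside of a large cube. *)
Record neighbor_rule (N : forall n, ('I_n -> d.-tuple R) -> 'I_n -> 'I_n)
    (C : nat) : Prop := NeighborRule {
  nb_measurable : forall n (i j : 'I_n),
    measurable [set z : Omega | N n (xs z) i == j];
  nb_indegree : forall n (x : 'I_n -> d.-tuple R) j, distinct x ->
    (#|[pred i | N n x i == j]| <= C)%N;
  nb_fixed : forall n (x : 'I_n -> d.-tuple R), (1 < n)%N -> distinct x ->
    (#|[pred i | N n x i == i]| <= 1)%N;
  nb_local : forall n (x x' : 'I_n -> d.-tuple R) (i j : 'I_n), i != j ->
    (forall k, k != j -> x k = x' k) -> N n x i != j -> N n x' i != j ->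
    N n x i = N n x' i;
  nb_crossing : forall k s m p, exists K, forall n (x : 'I_n -> d.-tuple R),
    distinct x ->
    (#|crosses x (N n x) k s| <= K + #|outside x m| + #|near_level x k s p|)%N }.

Lemma nearest_neq n (x : 'I_n -> d.-tuple R) i j : j != i ->
  nearest x i != i /\ forall k, k != i -> sqd (x i) (x (nearest x i)) <= sqd (x i) (x k).
Proof.
move=> ji; have [Pm mmin] :=
  @argmin_spec _ _ i (fun k => k != i) (fun k => eucl_dist (x i) (x k)) j ji.
by split=> // k ki; rewrite -eucl_dist_le; exact: mmin.
Qed.

(** Points having j as nearest neighbor lie in different narrow cones with apex
    x_j: of two points in one cone, the farther one is closer to the other than
    to x_j. This holds in the presence of distance ties as well. *)
Lemma nearest_indegree n (x : 'I_n -> d.-tuple R) j : distinct x ->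
  (#|[pred i | nearest x i == j]| <= (#|{ffun 'I_d -> 'I_(2 * 1 * d.+1).+1}|).+1)%N.
Proof.
move=> dx; rewrite (cardD1 j) (leq_add (leq_b1 _))//.
pose r i := Num.sqrt (sqd (x i) (x j)).
pose u i l := (tnth (x i) l - tnth (x j) l) / r i.
apply: (@leq_card_in _ _ (fun i => cell 1 d.+1 (u i))).
have r0 i : i != j -> 0 < r i.
  move=> ij; rewrite sqrtr_gt0 (lt_le_trans _ (sqr_le_sqd _ _ k0))//.
  by rewrite exprn_even_gt0//= subr_eq0; apply: contraNneq ij => /dx ->.
have uE i l : i != j -> r i * u i l = tnth (x i) l - tnth (x j) l.
  by move=> /r0 ri; rewrite /u mulrC divfK ?gt_eqF.
have u1 i : i != j -> \sum_l u i l ^+ 2 = 1.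
  move=> ij; have ri := r0 _ ij; rewrite /u.
  under eq_bigr do rewrite expr_div_n.
  rewrite -mulr_suml -/(sqd _ _) /r sqr_sqrtr ?sqd_ge0// divff//.
  by rewrite gt_eqF// -sqrtr_gt0.
have ule i l : i != j -> `|u i l| <= 1%:R.
  move=> ij; rewrite -(@expr_le1 _ 2)// sqr_norm -(u1 _ ij) (bigD1 l)//= lerDl.
  by apply: sumr_ge0 => ? _; exact: sqr_ge0.
have key i i' : i != i' -> i != j -> i' != j -> nearest x i' = j ->
    cell 1 d.+1 (u i) = cell 1 d.+1 (u i') -> r i <= r i' -> False.
  move=> ii' ij i'j Ni' cii' rii'.
  have [_] := nearest_neq x ii'; rewrite Ni' => /(_ _ ii'); apply/negP.
  rewrite -ltNge [X in X < _]sqdC -[X in _ < X](sqr_sqrtr (sqd_ge0 _ _)) -/(r i').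
  rewrite /sqd (eq_bigr (fun l => (r i * u i l - r i' * u i' l) ^+ 2)); last first.
    by move=> l _; rewrite !uE//; ring.
  apply: cone_lt; rewrite ?u1 ?r0//.
  have h l : d.+1%:R ^+ 2 * (u i l - u i' l) ^+ 2 <= 1 :> R.
    rewrite -exprMn -sqr_norm normrM ger0_norm//.
    rewrite expr_le1 ?mulr_ge0// ltW//.
    by apply: (cell_close _ _ _ cii') => ?; exact: ule.
  have : d.+1%:R ^+ 2 * \sum_l (u i l - u i' l) ^+ 2 <= d%:R :> R.
    rewrite mulr_sumr -[leRHS]mulr1 -[d in leRHS]card_ord mulr_natl -sumr_const.
    by apply: ler_sum => l _.
  rewrite -natr1; have : 0 <= d%:R :> R by []; nra.
move=> i i'; rewrite !inE => /andP[ij /eqP Ni] /andP[i'j /eqP Ni'] c.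
apply/eqP; apply: contraT => ii'.
by have [h|h] := lerP (r i) (r i'); exfalso;
  [apply: (key i i')|apply: (key i' i) => //; [rewrite eq_sym|exact/ltW]].
Qed.

Lemma nearest_local n (x x' : 'I_n -> d.-tuple R) (i j : 'I_n) : i != j ->
  (forall k, k != j -> x k = x' k) -> nearest x i != j -> nearest x' i != j ->
  nearest x i = nearest x' i.
Proof.
move=> ij xx'; apply: argmin_local => // k kj; split=> //.
by rewrite xx'// xx'.
Qed.

(** A point of the cube that shares its cell with another point has its nearest
    neighbor within the diameter of the cell; the points alone in their cell are
    at most as many as the cells. *)
Lemma nearest_crossing k s m p : exists K, forall n (x : 'I_n -> d.-tuple R),
    distinct x ->
    (#|crosses x (nearest x) k s| <=
     K + #|outside x m| + #|near_level x k s p|)%N.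
Proof.
pose P := (d.+1 * p.+1)%N; pose c (t : d.-tuple R) := cell m P (tnth t).
(* the side 1/P is so small that the diameter of a cell is less than 1/(p+1) *)
exists #|{ffun 'I_d -> 'I_(2 * m * P).+1}| => n x _.
set out := outside x m; set near := near_level x k s p.
pose alone := [pred i | ~~ out i && [forall (j | ~~ out j), (c (x j) == c (x i)) ==> (j == i)]].
have Al : (#|alone| <= #|{ffun 'I_d -> 'I_(2 * m * P).+1}|)%N.
  apply: (@leq_card_in _ _ (fun i => c (x i))) => i j /andP[oi _] /andP[_ /forallP aj] e.
  by have := aj i; rewrite oi/= e eqxx/= => /eqP.
rewrite -(addnA _ #|out|); apply: leq_trans (leq_add Al (leqnn _)).
rewrite addnA; apply: (@card_le_add3 _ _ alone out near) => i; rewrite /crosses => cross.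
case: (boolP (out i)) => oi; first by rewrite orbT.
rewrite /=.
apply/orP; case: (boolP (alone i)) => [|nal]; first by left.
right; move: nal; rewrite /alone/= oi/= negb_forall => /existsP[j].
rewrite negb_imply => /andP[oj]; rewrite negb_imply => /andP[/eqP cji ji].
have ri : forall l, `|tnth (x i) l| <= m%:R.
  by move: oi; rewrite /out /outside negbK => /forallP.
have rj : forall l, `|tnth (x j) l| <= m%:R.
  by move: oj; rewrite /out /outside negbK => /forallP.
have P0 : (0 < P)%N by rewrite muln_gt0.
have h1 := sqd_cell P0 ri rj (esym cji).
have [_ /(_ _ ji) h2] := nearest_neq x ji.
have h3 := sqr_le_sqd (x i) (x (nearest x i)) k.
set a := tnth (x i) k in cross h3 *.
set b := tnth (x (nearest x i)) k in cross h3.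
have : P%:R ^+ 2 * (a - b) ^+ 2 <= d%:R :> R.
  rewrite (le_trans _ h1)// ler_wpM2l ?sqr_ge0//.
  exact: le_trans h3 h2.
rewrite /P natrM exprMn -natr1 => h4.
have h5 : (p.+1%:R * (a - b)) ^+ 2 <= 1 :> R.
  rewrite exprMn; move: h4; rewrite -mulrA.
  have : 0 <= p.+1%:R ^+ 2 * (a - b) ^+ 2 by rewrite mulr_ge0 ?sqr_ge0.
  move: (_ * _) => w w0 h4; rewrite leNgt; apply/negP => w1.
  have := ler_wpM2l (sqr_ge0 (d%:R + 1 : R)) (ltW w1).
  by have : 0 <= d%:R :> R by []; nra.
have h6 : p.+1%:R * `|a - b| <= 1.
  rewrite -[p.+1%:R]ger0_norm// -normrM -(@expr_le1 _ 2)// sqr_norm.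
  exact: h5.
have : `|a - s| <= `|a - b|.
  move: cross; case: (lerP a s) => ha; case: (lerP b s) => hb //= _.
    by have := ler_norm (b - a); rewrite distrC; lra.
  by have := ler_norm (a - b); lra.
by move/le_trans; apply; rewrite -[leRHS]mul1r ler_pdivlMr// mulrC.
Qed.

End NeighborRules.

Section Rules.
Context {R : realType} {d : nat} (k0 : 'I_d).
Notation S := (d.-tuple R * R)%type.
Notation Omega := (seq_space S).

Lemma nearest_rule : neighbor_rule k0 (fun n => @nearest R n d)
  (#|{ffun 'I_d -> 'I_(2 * 1 * d.+1).+1}|).+1.
Proof.
split.
- move=> n i j; apply: measurable_argmin => [k|k l] /=.
    by apply: measurable_bool_set; exact: measurable_cst.
  under eq_set do rewrite eucl_dist_le.
  by apply: measurable_ler; apply: measurable_sum => q; apply: measurable_funX;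
    apply: measurable_funB; exact: measurable_xs_tnth.
- exact: nearest_indegree.
- move=> n x n1 _; rewrite (@eq_card0 _ _ _)//= => i; rewrite !inE.
  have [j ji] : exists j : 'I_n, j != i.
    case: n n1 {x} i => [//|[//|n]] _ i.
    exists (if i == ord0 then ord_max else ord0).
    by case: (eqVneq i ord0) => [->//|]; rewrite eq_sym.
  by have [/negbTE ->] := nearest_neq x ji.
- exact: nearest_local.
- exact: nearest_crossing.
Qed.

Section RightNearest.
Variables (n : nat) (x : 'I_n -> d.-tuple R).
Let t i := tnth (x i) k0.
Let N := right_nearest t.

(** The default value of the minimum shows up for the largest point only. *)
Lemma right_nearest_spec i : N i = i /\ (forall k, t k <= t i) \/
  t i < t (N i) /\ forall k, t i < t k -> t (N i) <= t k.
Proof.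
have [[j tij]|no] := pselect (exists j, t i < t j).
  right; exact: (@argmin_spec _ _ i (fun k => t i < t k) t j tij).
left; have no' j : ~~ (t i < t j) by apply/negP => tij; apply: no; exists j.
split; last by move=> k; have := no' k; rewrite -leNgt.
exact: argmin_default.
Qed.

Lemma right_nearest_inj i i' : injective t -> N i != i -> N i' != i' ->
  N i = N i' -> i = i'.
Proof.
move=> inj; case: (right_nearest_spec i) => [[->]|[a1 a2] _]; first by rewrite eqxx.
case: (right_nearest_spec i') => [[->]|[b1 b2] _]; first by rewrite eqxx.
move=> e; apply: inj; have [h|h|//] := ltgtP (t i) (t i').
  by have := a2 _ h; rewrite e leNgt b1.
by have := b2 _ h; rewrite -e leNgt a1.
Qed.

Lemma right_nearest_last i i' : injective t -> N i = i -> N i' = i' -> i = i'.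
Proof.
move=> inj; case: (right_nearest_spec i) => [[_ h]|[a1 _] e]; last first.
  by rewrite e ltxx in a1.
case: (right_nearest_spec i') => [[_ h']|[b1 _] _ e']; last first.
  by rewrite e' ltxx in b1.
by move=> _ _; apply: inj; apply/eqP; rewrite eq_le h h'.
Qed.

End RightNearest.

Hypothesis d1 : forall k : 'I_d, k = k0.

(** On the line the right neighbor map is injective off the largest point, which
    is its own neighbor, and a single edge passes over any given level. *)
Lemma right_nearest_rule :
  neighbor_rule k0 (fun n (x : 'I_n -> d.-tuple R) => right_nearest (fun i => tnth (x i) k0)) 2.
Proof.
split.
- move=> n i j; apply: measurable_argmin => [k|k l] /=.
    by apply: measurable_ltr; exact: measurable_xs_tnth.
  by apply: measurable_ler; exact: measurable_xs_tnth.
- move=> n x j dx; rewrite (cardD1 j) (leq_add (leq_b1 _))//.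
  apply/card_le1_eqP => i i'; rewrite !inE => /andP[ij /eqP e] /andP[ij' /eqP e'].
  apply: (right_nearest_inj dx); rewrite ?e ?e'// eq_sym//.
- move=> n x n1 dx; apply/card_le1_eqP => i i'; rewrite !inE => /eqP e /eqP e'.
  exact: (right_nearest_last dx).
- move=> n x x' i j ij xx'; apply: argmin_local => // k kj.
  by rewrite xx'// xx'.
- move=> k s m p; exists 1%N => n x dx; rewrite -addnA.
  apply: (@leq_trans 1%N); last by rewrite leq_addr.
  rewrite (d1 k); apply/card_le1_eqP => i i'; rewrite !unfold_in /crosses.
  set t := fun i => tnth (x i) k0.
  have st l : (t l <= s) != (t (right_nearest t l) <= s) ->
      t l <= s < t (right_nearest t l) /\
      forall k, t l < t k -> t (right_nearest t l) <= t k.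
    case: (right_nearest_spec x l) => [[->]|[a1 a2]]; first by rewrite eqxx.
    move=> h; split=> //; move: h; rewrite -/t.
    case: (lerP (t l) s) => h1; case: (lerP _ s) => h2 //= _.
    by have := lt_le_trans h1 (le_trans (ltW a1) h2); rewrite ltxx.
  move=> /st[/andP[a1 a2] a3] /st[/andP[b1 b2] b3].
  apply: dx; have [h|h|//] := ltgtP (t i) (t i').
    by have := le_trans (a3 _ h) b1; rewrite leNgt a2.
  by have := le_trans (b3 _ h) a1; rewrite leNgt b2.
Qed.

End Rules.

(** * Absence of ties *)

Lemma cvg0_ge0 (R : realType) (u : nat -> R) : (forall n, 0 <= u n) ->
  (forall e, 0 < e -> \forall n \near \oo, u n <= e) -> u @ \oo --> 0.
Proof.
move=> u0 ue; apply/cvgrPdist_le => e e0; near=> n.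
rewrite sub0r normrN ger0_norm//; near: n; exact: ue.
Unshelve. all: by end_near. Qed.

Lemma cvg0_le (R : realType) (u : nat -> R) e : u @ \oo --> 0 -> 0 < e ->
  \forall n \near \oo, u n <= e.
Proof.
move=> /cvgrPdist_le u0 e0; near=> n.
have : `|0 - u n| <= e by near: n; exact: u0.
by rewrite sub0r normrN; apply: le_trans; exact: ler_norm.
Unshelve. all: by end_near. Qed.

Section IID.
Context {d' : measure_display} {S : measurableType d'} {R : realType}.
Notation Omega := (seq_space S).
Variable Q : probability Omega R.
Hypothesis iidQ : iid_law Q.

Lemma mean_coord (f : S -> R) i : bmeas f ->
  mean Q (fun z => f (z i)) = mean Q (fun z => f (z 0%N)).
Proof.
move=> mf.
have mf0 j : bmeas (fun z : Omega => f (z j)).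
  exact: bmeas_comp (measurable_coord j) mf.
pose sw j := if j == 0%N then i else if j == i then 0%N else j.
rewrite [RHS](mean_reindex iidQ (_ : injective sw) (mf0 0%N))//.
by move=> a b; rewrite /sw; repeat case: ifP; lia.
Qed.

Lemma bmeas_coord_le (phi : S -> R) i s : measurable_fun setT phi ->
  bmeas (fun z : Omega => (phi (z i) <= s)%R%:R : R).
Proof.
move=> mphi; apply: bmeas_bool; apply: measurable_ler; last exact: measurable_cst.
exact: measurableT_comp mphi (measurable_coord i).
Qed.

(** Freezing all entries but the j-th one, the latter hits the value taken at
    the i-th one with probability zero. *)
Lemma ae_coord_neq (phi : S -> R) : measurable_fun setT phi ->
  (forall s, Q [set z | phi (z 0%N) == s] = 0%E) ->
  {ae Q, forall z, forall i j, i != j -> phi (z i) != phi (z j)}.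
Proof.
move=> mphi atomless.
have mp i : measurable_fun setT (fun z : Omega => phi (z i)).
  exact: measurableT_comp mphi (measurable_coord i).
have mE i j : measurable [set z : Omega | phi (z i) == phi (z j)].
  by apply: measurable_bool_set; exact: measurable_fun_eqr.
have mEs s : measurable [set z : Omega | phi (z 0%N) == s].
  by apply: measurable_bool_set; apply: measurable_fun_eqr.
have Eij i j : i != j -> Q [set z : Omega | phi (z i) == phi (z j)] = 0%E.
  move=> ij; suff : mean Q (fun z => (phi (z i) == phi (z j))%:R) = 0.
    rewrite mean_bool// => e.
    by rewrite -[LHS]fineK ?fin_num_measure// e.
  rewrite (mean_resample_r iidQ j); last exact: bmeas_bool.
  rewrite -[RHS](mean_cst Q 0); congr mean; apply/funext => z.
  transitivity (mean Q (fun z' : Omega => (phi (z i) == phi (z' j))%:R)).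
    by congr mean; apply/funext => z'; rewrite /upd (negbTE ij) eqxx.
  rewrite (@mean_coord (fun s => (phi (z i) == phi s)%:R) j).
    rewrite mean_bool.
      under eq_set do rewrite eq_sym.
      by rewrite atomless.
    by under eq_set do rewrite eq_sym.
  apply: bmeas_bool; apply: measurable_bool_set; exact: measurable_fun_eqr.
pose bad (p : nat * nat) := [set z : Omega | (p.1 != p.2) && (phi (z p.1) == phi (z p.2))].
have nbad p : Q.-negligible (bad p).
  exists [set z | (p.1 != p.2) && (phi (z p.1) == phi (z p.2))]; split=> //.
    by case: (p.1 != p.2) => /=; [exact: mE|apply: measurable_bool_set].
  have [->|p12] := eqVneq p.1 p.2; last exact: Eij.
  by rewrite (_ : mkset _ = set0) ?measure0//; apply/seteqP; split.
have := @negligible_bigcup _ _ _ Q (fun k => bad (odflt (0, 0)%N (unpickle k)))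
  (fun k => nbad _).
apply: negligibleS => z /= /existsNP[i /existsNP[j /not_implyP[ij /negP/negPn e]]].
by exists (pickle (i, j)) => //; rewrite /bad pickleK/= ij.
Qed.

(** The shrinking events decrease to the event of hitting s. *)
Lemma mean_near_atom (phi : S -> R) s : measurable_fun setT phi ->
  Q [set z | phi (z 0%N) == s] = 0%E ->
  mean Q (fun z => (`|phi (z 0%N) - s| <= p.+1%:R^-1)%R%:R) @[p --> \oo] --> 0.
Proof.
move=> mphi atomless.
have mp : measurable_fun setT (fun z : Omega => phi (z 0%N)).
  exact: measurableT_comp mphi (measurable_coord 0%N).
have meq : measurable [set z : Omega | phi (z 0%N) == s].
  by apply: measurable_bool_set; apply: measurable_fun_eqr.
have mnear p : measurable [set z : Omega | `|phi (z 0%N) - s| <= p.+1%:R^-1].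
  apply: measurable_ler; last exact: measurable_cst.
  by apply: measurableT_comp => //; apply: measurable_funB.
pose near' p (z : Omega) := (`|phi (z 0%N) - s| <= p.+1%:R^-1) && (phi (z 0%N) != s).
have mnear' p : bmeas (fun z : Omega => (near' p z)%:R : R).
  by apply: bmeas_bool; apply: measurable_and => //; exact: measurable_neg.
rewrite (_ : (fun p => _) = (fun p => mean Q (fun z => (near' p z)%:R))); last first.
  apply/funext => p; apply: eq_mean_ae => //; first exact: bmeas_bool.
  have : {ae Q, forall z, phi (z 0%N) != s}.
    exists [set z : Omega | phi (z 0%N) == s]; split=> // z /= /negP.
    by rewrite negbK.
  by apply: ae_imply => z h; rewrite /near' h andbT.
apply: (@mean_cvg0 _ _ _ _ _ 1) => [//|m z|z].
  by case: (near' _ _); rewrite ?normr1 ?normr0.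
apply: cvg_near_cst; rewrite /near'.
have [->|zs] := eqVneq (phi (z 0%N)) s; first by apply: nearW => p; rewrite andbF.
have e0 : 0 < `|phi (z 0%N) - s| by rewrite normr_gt0 subr_eq0.
apply: filterS (near_infty_natSinv_lt (PosNum e0)) => p /=.
by rewrite ltNge => /negbTE ->.
Qed.

Lemma continuous_atomless_cdf (phi : S -> R) : measurable_fun setT phi ->
  (forall s, Q [set z | phi (z 0%N) == s] = 0%E) ->
  continuous (fun t => mean Q (fun z => (phi (z 0%N) <= t)%R%:R)).
Proof.
move=> mphi atomless t; apply/cvgrPdist_le => e e0.
have [p _ /(_ p (leqnn p)) /= hp] := cvg0_le (mean_near_atom mphi (atomless t)) e0.
near=> u.
have tu : `|t - u| < p.+1%:R^-1.
  by near: u; apply: cvgr_dist_lt; rewrite // invr_gt0.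
have ble v := bmeas_coord_le 0%N v mphi.
apply: le_trans hp; rewrite -meanB//.
have bn : bmeas (fun z : Omega => (`|phi (z 0%N) - t| <= p.+1%:R^-1)%R%:R : R).
  apply: bmeas_bool; apply: measurable_ler; last exact: measurable_cst.
  apply: measurableT_comp => //; apply: measurable_funB => //.
  exact: measurableT_comp mphi (measurable_coord 0%N).
apply: le_trans (mean_norm _ (bmeasB (ble t) (ble u))) _.
apply: ler_mean => [||z] //; first by apply: bmeas_norm; exact: bmeasB.
move: tu; rewrite ltr_norml; set q := _^-1; move=> /andP[t1 t2].
case: (boolP (phi (z 0%N) <= t)) => h1; case: (boolP (phi (z 0%N) <= u)) => h2;
  rewrite ?subrr ?subr0 ?sub0r ?normrN ?normr1 ?normr0 ?ler0n//.
- rewrite (_ : `|_ - _| <= _)//; rewrite -ltNge in h2.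
  by rewrite ler_norml; apply/andP; split; move: h1 h2 t1 t2; move: (phi _) q => v q; lra.
- rewrite (_ : `|_ - _| <= _)//; rewrite -ltNge in h1.
  by rewrite ler_norml; apply/andP; split; move: h1 h2 t1 t2; move: (phi _) q => v q; lra.
Unshelve. all: by end_near. Qed.

End IID.

Lemma sum_pred_card (R : realType) (I : finType) (A : pred I) :
  \sum_(i : I) (A i)%:R = #|A|%:R :> R.
Proof.
rewrite -sum1_card natr_sum [RHS]big_mkcond/=; apply: eq_bigr => i _.
by rewrite unfold_in; case: (A i).
Qed.

(** * Oscillation along the edges of the neighbor graph *)

Section Oscillation.
Context {R : realType} {d : nat} (k0 : 'I_d).
Notation S := (d.-tuple R * R)%type.
Notation Omega := (seq_space S).
Variable Q : probability Omega R.
Hypothesis iidQ : iid_law Q.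
Hypothesis atomlessX : forall k s,
  Q [set z : Omega | tnth (z 0%N).1 k == s] = 0%E.
Variables (N : forall n, ('I_n -> d.-tuple R) -> 'I_n -> 'I_n) (C : nat).
Hypothesis rule : neighbor_rule k0 N C.

Definition neighbor n (z : Omega) (i : 'I_n) : 'I_n := N (xs z) i.

Lemma ae_distinct : {ae Q, forall z, forall n, distinct k0 (@xs R d n z)}.
Proof.
have mphi : measurable_fun setT (fun s : S => tnth s.1 k0).
  exact: measurableT_comp (measurable_tnth k0) measurable_fst.
apply: ae_imply (ae_coord_neq iidQ mphi (atomlessX k0)) => z h n i j /= e.
apply/eqP; apply: contraT => ij; have := h i j ij.
by rewrite [X in X != _]e eqxx.
Qed.

(** Decompose according to the value of the neighbor. *)
Lemma bmeas_nb n (i : 'I_n) (psi : 'I_n -> Omega -> R) :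
  (forall j, bmeas (psi j)) -> bmeas (fun z => psi (neighbor z i) z).
Proof.
move=> mpsi.
rewrite (_ : (fun z => _) = fun z => \sum_j (neighbor z i == j)%:R * psi j z).
  apply: bmeas_sum => j; apply: bmeasM => //; apply: bmeas_bool.
  exact: nb_measurable rule _ _ _.
apply/funext => z; rewrite (bigD1 (neighbor z i))//= eqxx mul1r big1 ?addr0// => j.
by rewrite eq_sym => /negbTE ->; rewrite mul0r.
Qed.

Lemma bmeas_xs n (i : 'I_n) (f : d.-tuple R -> R) : bmeas f ->
  bmeas (fun z : Omega => f (xs z i)).
Proof. by move=> mf; apply: bmeas_comp mf; exact: measurable_xs. Qed.

Lemma bmeas_xs_nb n (i : 'I_n) (f : d.-tuple R -> R) : bmeas f ->
  bmeas (fun z : Omega => f (xs z (neighbor z i))).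
Proof.
by move=> mf; apply: (@bmeas_nb n i (fun j z => f (xs z j))) => j; exact: bmeas_xs.
Qed.

Lemma mean_xs n (i : 'I_n) (f : d.-tuple R -> R) : bmeas f ->
  mean Q (fun z => f (xs z i)) = mean Q (fun z => f (z 0%N).1).
Proof.
move=> mf; rewrite /xs (mean_coord iidQ (f := fun s => f s.1))//.
exact: bmeas_comp measurable_fst mf.
Qed.

(** Each point is counted at most C times as a neighbor. *)
Lemma sum_nb_le n (z : Omega) (f : d.-tuple R -> R) : distinct k0 (@xs R d n z) ->
  (forall u, 0 <= f u) ->
  \sum_(i < n) f (xs z (neighbor z i)) <= C%:R * \sum_(i < n) f (xs z i).
Proof.
move=> dz f0; rewrite (partition_big (@neighbor n z) xpredT)//= mulr_sumr.
apply: ler_sum => j _; rewrite (eq_bigr (fun=> f (xs z j))); last first.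
  by move=> i /eqP ->.
rewrite sumr_const -[leLHS]mulr_natl ler_wpM2r// ler_nat.
exact: nb_indegree rule _ _ _ dz.
Qed.

Definition osc_sum n (f : d.-tuple R -> R) (z : Omega) : R :=
  \sum_(i < n) `|f (xs z i) - f (xs z (neighbor z i))|.

Definition mean_osc (f : d.-tuple R -> R) (n : nat) : R :=
  n%:R^-1 * mean Q (osc_sum n f).

Lemma bmeas_osc_sum n f : bmeas f -> bmeas (osc_sum n f).
Proof.
move=> mf; apply: bmeas_sum => i; apply: bmeas_norm; apply: bmeasB.
  exact: bmeas_xs.
exact: bmeas_xs_nb.
Qed.

Lemma osc_ge0 f n : 0 <= mean_osc f n.
Proof.
by rewrite mulr_ge0// mean_ge0// => z; exact: sumr_ge0.
Qed.

(** The approximation error is paid at both ends of an edge, and at the far end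
    it is controlled through the in-degree. *)
Lemma osc_perturb f g n : bmeas f -> bmeas g ->
  mean_osc f n <= mean_osc g n + (1 + C%:R) * mean Q (fun z => `|f (z 0%N).1 - g (z 0%N).1|).
Proof.
move=> mf mg; pose h u := `|f u - g u|.
have mh : bmeas h by apply: bmeas_norm; exact: bmeasB.
case: n => [|n].
  by rewrite /mean_osc invr0 !mul0r add0r mulr_ge0 ?addr_ge0// mean_ge0.
rewrite /mean_osc -(ler_pM2l (_ : 0 < n.+1%:R))// mulrDr !mulVKf ?pnatr_eq0//.
have mS : bmeas (fun z => \sum_(i < n.+1) h (xs z i)).
  by apply: bmeas_sum => i; exact: bmeas_xs.
have -> : n.+1%:R * ((1 + C%:R) * mean Q (fun z => `|f (z 0%N).1 - g (z 0%N).1|)) =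
    mean Q (fun z => (1 + C%:R) * \sum_(i < n.+1) h (xs z i)).
  rewrite meanZ// mulrCA; congr (_ * _); rewrite mean_sum; last first.
    by move=> i; exact: bmeas_xs.
  rewrite (eq_bigr _ (fun i _ => mean_xs i mh)) sumr_const card_ord.
  by rewrite mulr_natl.
rewrite -meanD; [|exact: bmeas_osc_sum|by apply: bmeasM => //; exact: bmeas_cst].
apply: ler_mean_ae.
- exact: bmeas_osc_sum.
- by apply: bmeasD; [exact: bmeas_osc_sum|apply: bmeasM => //; exact: bmeas_cst].
apply: ae_imply ae_distinct => z dz.
have h0 u : 0 <= h u by exact: normr_ge0.
rewrite mulrDl mul1r.
apply: le_trans (_ : osc_sum n.+1 g z + (\sum_(i < n.+1) h (xs z i) +
  \sum_(i < n.+1) h (xs z (neighbor z i))) <= _); last first.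
  by rewrite !lerD2l sum_nb_le.
rewrite /osc_sum -!big_split/=; apply: ler_sum => i _.
rewrite /h; set a := xs z i; set b := xs z (neighbor z i).
rewrite (_ : f a - f b = (g a - g b) + ((f a - g a) + - (f b - g b))); last ring.
rewrite (le_trans (ler_normD _ _))// lerD2l.
by rewrite (le_trans (ler_normD _ _))// normrN.
Qed.

Definition vanishing_osc f := mean_osc f n @[n --> \oo] --> 0.

Lemma osc_vanishes_approx f : bmeas f -> (forall e, 0 < e -> exists g,
    [/\ bmeas g, vanishing_osc g &
        mean Q (fun z => `|f (z 0%N).1 - g (z 0%N).1|) <= e]) ->
  vanishing_osc f.
Proof.
move=> mf app; apply: cvg0_ge0 => [n|e e0]; first exact: osc_ge0.
have C0 : 0 < 1 + C%:R :> R by rewrite ltr_pwDl.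
have [g [mg g0 fg]] := app (e / 2 / (1 + C%:R)) ltac:(by rewrite !divr_gt0).
have e2 : 0 < e / 2 by rewrite divr_gt0.
apply: filterS (cvg0_le g0 e2) => n hn; rewrite (le_trans (osc_perturb _ mf mg))//.
apply: (@le_trans _ _ (e / 2 + e / 2)); last by lra.
by rewrite lerD// mulrC -ler_pdivlMr.
Qed.

Lemma osc_vanishes_sum (I : Type) (r : seq I) (f : I -> d.-tuple R -> R) :
  (forall i, bmeas (f i)) -> (forall i, vanishing_osc (f i)) ->
  vanishing_osc (fun u => \sum_(i <- r) f i u).
Proof.
move=> mf f0.
have h : (\sum_(i <- r) mean_osc (f i) n) @[n --> \oo] --> 0.
  elim: r => [|i r IH].
    by under eq_fun do rewrite big_nil; exact: cvg_cst.
  under eq_fun do rewrite big_cons.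
  have h := cvgD (f0 i) IH; rewrite addr0 in h; exact: h.
apply: cvg0_ge0 => [n|e e0]; first exact: osc_ge0.
apply: filterS (cvg0_le h e0) => n; apply: le_trans.
rewrite /mean_osc -mulr_sumr ler_wpM2l// -mean_sum; last by move=> i; exact: bmeas_osc_sum.
apply: ler_mean => [||z].
- by apply: bmeas_osc_sum; exact: bmeas_sum.
- by apply: bmeas_sum => i; exact: bmeas_osc_sum.
rewrite /osc_sum exchange_big/=; apply: ler_sum => i _.
by rewrite -sumrB ler_norm_sum.
Qed.

Lemma osc_vanishesZ c f : bmeas f -> vanishing_osc f -> vanishing_osc (fun u => c * f u).
Proof.
move=> mf f0.
have E n : mean_osc (fun u => c * f u) n = `|c| * mean_osc f n.
  rewrite /mean_osc mulrCA -[in RHS]meanZ; last exact: bmeas_osc_sum.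
  congr (_ * mean Q _); apply/funext => z; rewrite /osc_sum mulr_sumr.
  by apply: eq_bigr => i _; rewrite -mulrBr normrM.
rewrite /vanishing_osc; under eq_fun do rewrite E.
by have h := cvgM (cvg_cst `|c|) f0; rewrite mulr0 in h; exact: h.
Qed.

End Oscillation.

Section OscillationVanishes.
Context {R : realType} {d : nat} (k0 : 'I_d).
Notation S := (d.-tuple R * R)%type.
Notation Omega := (seq_space S).
Variable Q : probability Omega R.
Hypothesis iidQ : iid_law Q.
Hypothesis atomlessX : forall k s,
  Q [set z : Omega | tnth (z 0%N).1 k == s] = 0%E.
Variables (N : forall n, ('I_n -> d.-tuple R) -> 'I_n -> 'I_n) (C : nat).
Hypothesis rule : neighbor_rule k0 N C.

Notation osc := (mean_osc Q N).
Notation osc_vanishes := (vanishing_osc Q N).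

Lemma osc_vanishes_le2 f g h : bmeas f -> bmeas g -> bmeas h ->
  (forall u v, `|f u - f v| <= `|g u - g v| + `|h u - h v|) ->
  osc_vanishes g -> osc_vanishes h -> osc_vanishes f.
Proof.
move=> mf mg mh fgh g0 h0; apply: cvg0_ge0 => [n|e e0]; first exact: osc_ge0.
have e2 : 0 < e / 2 by rewrite divr_gt0.
apply: filterS2 (cvg0_le g0 e2) (cvg0_le h0 e2) => n gn hn.
apply: (@le_trans _ _ (osc g n + osc h n)); last lra.
rewrite /mean_osc -mulrDr ler_wpM2l// -meanD; [|exact: (bmeas_osc_sum rule)..].
apply: ler_mean => [||z]; first exact: (bmeas_osc_sum rule).
  by apply: bmeasD; exact: (bmeas_osc_sum rule).
by rewrite /osc_sum -big_split/=; apply: ler_sum.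
Qed.

Let mtnth k : measurable_fun [set: d.-tuple R] (fun u => tnth u k).
Proof. exact: measurable_tnth. Qed.

(** The oscillation of the indicator counts the crossing edges: a bounded number
    of them, and those that start outside of a large cube or near the hyperplane,
    both of small probability. *)
Lemma osc_vanishes_halfspace k s : osc_vanishes (fun u => (tnth u k <= s)%R%:R).
Proof.
pose hs (u : d.-tuple R) : R := (tnth u k <= s)%R%:R.
pose out m (u : d.-tuple R) := ~~ [forall l, `|tnth u l| <= m%:R].
pose near p (u : d.-tuple R) := `|tnth u k - s| <= p.+1%:R^-1.
have mout m : bmeas (fun u => (out m u)%:R : R).
  apply: bmeas_bool; apply: measurable_neg.
  pose Phi (e : {ffun 'I_d -> bool}) := [forall l, e l].
  rewrite (_ : mkset _ = [set u | Phi [ffun l => `|tnth u l| <= m%:R]]).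
    apply: measurable_finbool => l; apply: measurable_ler; last exact: measurable_cst.
    exact: measurableT_comp (mtnth l).
  by apply: eq_set => u; rewrite /Phi; congr is_true; apply: eq_forallb => l;
    rewrite ffunE.
have mnear p : bmeas (fun u => (near p u)%:R : R).
  apply: bmeas_bool; apply: measurable_ler; last exact: measurable_cst.
  apply: measurableT_comp => //; apply: measurable_funB => //.
have mhs : bmeas hs.
  by apply: bmeas_bool; apply: measurable_ler => //; exact: measurable_cst.
have mx (f : d.-tuple R -> R) : bmeas f -> bmeas (fun z : Omega => f (z 0%N).1).
  move=> mf; apply: bmeas_comp mf.
  exact: measurableT_comp measurable_fst (measurable_coord 0%N).
have out0 : mean Q (fun z => (out m (z 0%N).1)%:R) @[m --> \oo] --> 0.
  apply: (@mean_cvg0 _ _ _ _ _ 1) => [m|m z|z].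
  - exact: mx (mout m).
  - by case: (out _ _); rewrite ?normr1 ?normr0.
  apply: cvg_near_cst.
  near=> m; rewrite /out (_ : [forall l, _] = true)//.
  apply/forallP => l.
  apply: (@le_trans _ _ (\sum_l `|tnth (z 0%N).1 l|)).
    by rewrite (bigD1 l)//= lerDl sumr_ge0.
  by near: m; exact: nbhs_infty_ger.
have near0 : mean Q (fun z => (near p (z 0%N).1)%:R) @[p --> \oo] --> 0.
  apply: (mean_near_atom (phi := fun s : S => tnth s.1 k) _ (atomlessX k s)).
  exact: measurableT_comp (mtnth k) measurable_fst.
apply: cvg0_ge0 => [n|e e0]; first exact: osc_ge0.
have e3 : 0 < e / 3 by rewrite divr_gt0.
have [m _ /(_ m (leqnn m)) om] := cvg0_le out0 e3.
have [p _ /(_ p (leqnn p)) np] := cvg0_le near0 e3.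
rewrite /= in om np.
have [K HK] := nb_crossing rule k s m p.
have mS n f : bmeas f -> bmeas (fun z : Omega => \sum_(i < n) f (xs z i) : R).
  by move=> mf; apply: bmeas_sum => i; exact: bmeas_xs.
have bound n : mean Q (osc_sum N n hs) <= K%:R +
    n%:R * mean Q (fun z => (out m (z 0%N).1)%:R) +
    n%:R * mean Q (fun z => (near p (z 0%N).1)%:R).
  have sumE f : bmeas f -> n%:R * mean Q (fun z => f (z 0%N).1) =
      mean Q (fun z => \sum_(i < n) f (xs z i)).
    move=> mf; rewrite mean_sum; last by move=> i; exact: bmeas_xs.
    rewrite (eq_bigr _ (fun i _ => mean_xs iidQ i mf)) sumr_const card_ord.
    by rewrite mulr_natl.
  rewrite (sumE (fun u => (out m u)%:R))// (sumE (fun u => (near p u)%:R))//.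
  rewrite -[K%:R](mean_cst Q) -!meanD//;
    [|by apply: bmeasD; [exact: bmeas_cst|exact: (mS n (fun u => (out m u)%:R))]
     |exact: (mS n (fun u => (near p u)%:R))|exact: bmeas_cst
     |exact: (mS n (fun u => (out m u)%:R))].
  apply: ler_mean_ae.
  - exact: (bmeas_osc_sum rule).
  - apply: bmeasD; last exact: (mS n (fun u => (near p u)%:R)).
    by apply: bmeasD; [exact: bmeas_cst|exact: (mS n (fun u => (out m u)%:R))].
  apply: ae_imply (ae_distinct k0 iidQ atomlessX) => z dz.
  have := HK n (xs z) (dz n); rewrite -(ler_nat R) !natrD -!sum_pred_card.
  apply: le_trans; rewrite le_eqVlt; apply/orP; left; apply/eqP.
  apply: eq_bigr => i _; rewrite /crosses /hs.
  by case: (_ <= s); case: (_ <= s); rewrite ?subrr ?subr0 ?sub0r ?normrN ?normr0 ?normr1.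
near=> n.
have n0 : 0 < n%:R :> R by rewrite ltr0n; near: n; exact: nbhs_infty_gt.
have Kn : K%:R / (e / 3) <= n%:R by near: n; exact: nbhs_infty_ger.
rewrite /mean_osc mulrC ler_pdivrMr// (le_trans (bound n))//.
have h1 := ler_wpM2l (ltW n0) om; have h2 := ler_wpM2l (ltW n0) np.
move: Kn; rewrite ler_pdivrMr// => Kn.
move: h1 h2; rewrite /= => h1 h2; lra.
Unshelve. all: by end_near. Qed.

End OscillationVanishes.

Lemma sum_ltn_nat (R : realType) (q m : nat) :
  \sum_(l < m) (l < q)%N%:R = (minn m q)%:R :> R.
Proof.
elim: m => [|m IH]; first by rewrite big_ord0 min0n.
by rewrite big_ord_recr/= IH -natrD; congr _%:R; case: ltnP; lia.
Qed.

(** The sum of the threshold indicators is the integer part of (m+1)a. *)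
Lemma layer_approx (R : realType) (a : R) m : 0 <= a <= 1 ->
  `|a - m.+1%:R^-1 * \sum_(l < m.+1) (l.+1%:R <= m.+1%:R * a)%R%:R| <= m.+1%:R^-1.
Proof.
move=> /andP[a0 a1].
have b0 : 0 <= m.+1%:R * a by rewrite mulr_ge0.
have bm : m.+1%:R * a <= m.+1%:R by rewrite ler_piMr.
set b := m.+1%:R * a in b0 bm *.
have -> : \sum_(l < m.+1) (l.+1%:R <= b)%R%:R = (Num.truncn b)%:R :> R.
  have /minn_idPr <- : (Num.truncn b <= m.+1)%N.
    by rewrite -(ler_nat R) (le_trans _ bm)// truncn_le.
  by rewrite -sum_ltn_nat; apply: eq_bigr => l _; rewrite truncn_ge_nat.
have /andP[t1 t2] := truncn_itv b0; rewrite -natr1 in t2.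
have m0 : 0 < m.+1%:R :> R by [].
rewrite -(ler_pM2l m0) -{1}[m.+1%:R]gtr0_norm// -normrM mulrBr -/b mulVKf ?gt_eqF//.
by rewrite divff ?gt_eqF// ger0_norm; lra.
Qed.

Section OscillationVanishes2.
Context {R : realType} {d : nat} (k0 : 'I_d).
Notation S := (d.-tuple R * R)%type.
Notation Omega := (seq_space S).
Variable Q : probability Omega R.
Hypothesis iidQ : iid_law Q.
Hypothesis atomlessX : forall k s,
  Q [set z : Omega | tnth (z 0%N).1 k == s] = 0%E.
Variables (N : forall n, ('I_n -> d.-tuple R) -> 'I_n -> 'I_n) (C : nat).
Hypothesis rule : neighbor_rule k0 N C.

Notation osc := (mean_osc Q N).
Notation osc_vanishes := (vanishing_osc Q N).

Definition osc_set : set (set (d.-tuple R)) :=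
  [set A | measurable A /\ osc_vanishes \1_A].

Lemma bmeas_indic (A : set (d.-tuple R)) : measurable A -> bmeas (\1_A : _ -> R).
Proof.
move=> mA; apply: bmeas_of01 => [|u]; first exact: measurable_indic.
by rewrite indicE; case: (_ \in _); rewrite ?lexx ?ler01.
Qed.

Let mx (f : d.-tuple R -> R) : bmeas f -> bmeas (fun z : Omega => f (z 0%N).1).
Proof.
move=> mf; apply: bmeas_comp mf.
exact: measurableT_comp measurable_fst (measurable_coord 0%N).
Qed.

Lemma osc_vanishes_cst c : osc_vanishes (fun=> c).
Proof.
rewrite /vanishing_osc /mean_osc (_ : (fun n => _) = fun=> 0); first exact: cvg_cst.
apply/funext => n; rewrite (_ : osc_sum _ _ _ = fun=> 0) ?mean_cst ?mulr0//.
by apply/funext => z; rewrite /osc_sum big1// => i _; rewrite subrr normr0.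
Qed.

Lemma osc_setU A B : osc_set A -> osc_set B -> osc_set (A `|` B).
Proof.
move=> [mA A0] [mB B0]; split; first exact: measurableU.
apply: (osc_vanishes_le2 rule _ _ _ _ A0 B0); try apply: bmeas_indic => //.
  exact: measurableU.
move=> u v; rewrite !indicE !in_setU.
by case: (u \in A); case: (v \in A); case: (u \in B); case: (v \in B) => /=;
  rewrite ?subrr ?subr0 ?sub0r ?normrN ?normr1 ?normr0; lra.
Qed.

(** A countable union is approximated in probability by its finite subunions,
    and [osc_vanishes_approx] passes to the limit. *)
Lemma osc_set_sigma_algebra : sigma_algebra setT osc_set.
Proof.
split.
- split; first exact: measurable0.
  by rewrite indic0; exact: osc_vanishes_cst.
- move=> A [mA A0]; rewrite setTD; split; first exact: measurableC.
  apply: (osc_vanishes_le2 rule _ _ _ _ A0 (osc_vanishes_cst 0)).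
  + by apply: bmeas_indic; exact: measurableC.
  + exact: bmeas_indic.
  + exact: bmeas_cst.
  move=> u v; rewrite !indicE !in_setC subrr normr0 addr0.
  by case: (u \in A); case: (v \in A) => /=;
    rewrite ?subrr ?subr0 ?sub0r ?normrN ?normr1 ?normr0.
move=> A oA.
have mA i : measurable (A i) by case: (oA i).
split; first exact: bigcupT_measurable.
pose B m := \big[setU/set0]_(l < m) A l.
have oB m : osc_set (B m).
  rewrite /B; elim: m => [|m IH].
    rewrite big_ord0; split; first exact: measurable0.
    by rewrite indic0; exact: osc_vanishes_cst.
  by rewrite big_ord_recr/=; apply: osc_setU.
have mU : measurable (\bigcup_k A k) by exact: bigcupT_measurable.
apply: (osc_vanishes_approx iidQ atomlessX rule); first exact: bmeas_indic.
have mdiff m : bmeas (fun z : Omega =>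
    `|\1_(\bigcup_k A k) (z 0%N).1 - \1_(B m) (z 0%N).1| : R).
  apply: bmeas_norm; apply: bmeasB; apply: mx; apply: bmeas_indic => //.
  by case: (oB m).
have diff0 : mean Q (fun z => `|\1_(\bigcup_k A k) (z 0%N).1 -
    \1_(B m) (z 0%N).1|) @[m --> \oo] --> 0.
  apply: (@mean_cvg0 _ _ _ _ _ 1) => [//|m z|z].
    rewrite normr_id !indicE.
    by case: (_ \in _); case: (_ \in _);
      rewrite ?subrr ?subr0 ?sub0r ?normrN ?normr1 ?normr0.
  apply: cvg_near_cst; have [[i _ Ai]|nA] := pselect ((\bigcup_k A k) (z 0%N).1).
    near=> m; rewrite !indicE !mem_set ?subrr ?normr0//; last by exists i.
    rewrite /B -bigcup_mkord; exists i => //=.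
    by near: m; exact: nbhs_infty_gt.
  apply: nearW => m; rewrite !indicE !memNset ?subrr ?normr0//.
  by rewrite /B -bigcup_mkord => -[i _ Ai]; apply: nA; exists i.
move=> e e0; have [m _ /(_ m (leqnn m)) hm] := cvg0_le diff0 e0.
by exists \1_(B m); case: (oB m) => mB oBm; split=> //; exact: bmeas_indic.
Unshelve. all: by end_near. Qed.

Lemma osc_set_halfspace k s : osc_set [set u | tnth u k <= s].
Proof.
have mk : measurable [set u : d.-tuple R | tnth u k <= s].
  by apply: measurable_ler; [exact: measurable_tnth|exact: measurable_cst].
split=> //.
have := @osc_vanishes_halfspace _ _ _ Q iidQ atomlessX N C rule k s.
congr (vanishing_osc Q N _); apply/funext => u.
by rewrite indicE mem_setE.
Qed.

(** Half-spaces generate the Borel sets. *)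
Lemma measurable_osc_set (A : set (d.-tuple R)) : measurable A -> osc_set A.
Proof.
have sA := osc_set_sigma_algebra.
move: A; apply: smallest_sub => // A.
have coord k (B : set R) : measurable B -> osc_set ((fun u => tnth u k) @^-1` B).
  move=> mB; suff : image_set_system setT (fun u : d.-tuple R => tnth u k) osc_set B.
    by rewrite /image_set_system /= setTI.
  have : (@RGenOInfty.G R).-sigma.-measurable B by rewrite -RGenOInfty.measurableE.
  move: B {mB}; apply: smallest_sub.
    exact: sigma_algebra_image.
  move=> _ [s ->]; rewrite /image_set_system/= setTI.
  have [_ /(_ _ (osc_set_halfspace k s)) + _] := sA.
  rewrite setTD; congr osc_set; apply/seteqP; split => u /=.
    by move/negP; rewrite -ltNge in_itv/= andbT.
  by rewrite in_itv/= andbT ltNge => /negP.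
move: A; apply: (big_ind (fun G => G `<=` osc_set)).
- by [].
- by move=> G H hG hH A [/hG|/hH].
- by move=> i _ A [B mB <-]; rewrite setTI; exact: coord.
Qed.

(** The averages of threshold indicators approximate g uniformly. *)
Lemma osc_vanishes_measurable (g : d.-tuple R -> R) : measurable_fun setT g ->
  (forall u, 0 <= g u <= 1) -> osc_vanishes g.
Proof.
move=> mg g01; have bg := bmeas_of01 mg g01.
pose st m l (u : d.-tuple R) : R := (l.+1%:R <= m.+1%:R * g u)%R%:R.
have mst m l : measurable [set u | l.+1%:R <= m.+1%:R * g u].
  by apply: measurable_ler; [exact: measurable_cst|exact: measurable_funM].
have bst m l : bmeas (st m l) by exact: bmeas_bool.
have ost m l : osc_vanishes (st m l).
  have [_] := measurable_osc_set (mst m l); congr (vanishing_osc Q N _).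
  by apply/funext => u; rewrite indicE mem_setE.
pose gm m u := m.+1%:R^-1 * \sum_(l < m.+1) st m l u.
have bgm m : bmeas (gm m) by apply: bmeasM; [exact: bmeas_cst|exact: bmeas_sum].
apply: (osc_vanishes_approx iidQ atomlessX rule) => // e e0.
have [m _ /(_ m (leqnn m)) /= me] := near_infty_natSinv_lt (PosNum e0).
exists (gm m); split=> //.
  apply: (osc_vanishesZ rule); first exact: bmeas_sum.
  exact: (osc_vanishes_sum rule).
rewrite -[leRHS](mean_cst Q); apply: ler_mean => [||z].
- by apply: bmeas_norm; apply: bmeasB; exact: mx.
- exact: bmeas_cst.
by rewrite (le_trans (layer_approx m (g01 _)))// ltW.
Qed.

End OscillationVanishes2.

(** * The mean fraction of pairs above a level *)

Section MeanUpperFrac.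
Context {R : realType} {d : nat} (k0 : 'I_d).
Notation S := (d.-tuple R * R)%type.
Notation Omega := (seq_space S).
Variable Q : probability Omega R.
Hypothesis iidQ : iid_law Q.
Hypothesis atomlessX : forall k s,
  Q [set z : Omega | tnth (z 0%N).1 k == s] = 0%E.
Variables (N : forall n, ('I_n -> d.-tuple R) -> 'I_n -> 'I_n) (C : nat).
Hypothesis rule : neighbor_rule k0 N C.

Definition pair_min n (z : Omega) (i : 'I_n) : R := Num.min (ys z i) (ys z (neighbor N z i)).

Definition upper_frac n (z : Omega) (t : R) : R :=
  n%:R^-1 * \sum_(i < n) (t <= pair_min z i)%R%:R.

Lemma measurable_nbmin n i : measurable_fun setT (fun z : Omega => @pair_min n z i).
Proof.
apply: measurable_minr; first exact: measurable_ys.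
rewrite (_ : (fun z => _) = fun z => \sum_j (neighbor N z i == j)%:R * ys z j).
  apply: measurable_sum => j; apply: measurable_funM; last exact: measurable_ys.
  by case: (@bmeas_bool _ _ R (fun z : Omega => neighbor N z i == j)) => //;
    exact: nb_measurable rule _ _ _.
apply/funext => z; rewrite (bigD1 (neighbor N z i))//= eqxx mul1r big1 ?addr0// => j.
by rewrite eq_sym => /negbTE ->; rewrite mul0r.
Qed.

Lemma bmeas_upper_frac n t : bmeas (fun z : Omega => upper_frac n z t).
Proof.
apply: bmeasM; first exact: bmeas_cst.
apply: bmeas_sum => i; apply: bmeas_bool; apply: measurable_ler.
  exact: measurable_cst.
exact: measurable_nbmin.
Qed.

Lemma upper_frac_ge0 n z t : 0 <= upper_frac n z t.
Proof. by rewrite mulr_ge0// sumr_ge0. Qed.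

Lemma upper_frac_le1 n z t : upper_frac n z t <= 1.
Proof.
case: n => [|n] in z *; first by rewrite /upper_frac invr0 mul0r.
rewrite /upper_frac mulrC ler_pdivrMr// mul1r -[n.+1 in leRHS]card_ord -sumr_const.
by apply: ler_sum => i _; case: (t <= _)%R; rewrite ?ler01.
Qed.

Lemma upper_frac_anti n z s t : s <= t -> upper_frac n z t <= upper_frac n z s.
Proof.
move=> st; rewrite ler_wpM2l//; apply: ler_sum => i _.
by case: (boolP (t <= _)) => //= h; rewrite (le_trans st h).
Qed.

Variables (t : R) (g : d.-tuple R -> R).
Hypothesis mg : measurable_fun setT g.
Hypothesis g01 : forall u, 0 <= g u <= 1.
Hypothesis g_cond : forall B, measurable B ->
  mean Q (fun z => \1_B (z 0%N).1 * (t <= (z 0%N).2)%R%:R) =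
  mean Q (fun z => \1_B (z 0%N).1 * g (z 0%N).1).

Let A (s : S) : R := (t <= s.2)%R%:R.
Let g' (s : S) : R := g s.1.

Let bA : bmeas A.
Proof. by apply: bmeas_bool; apply: measurable_ler; [exact: measurable_cst|]. Qed.

Let bg : bmeas g.
Proof. exact: bmeas_of01. Qed.

Let bg' : bmeas g'.
Proof. exact: bmeas_comp measurable_fst bg. Qed.

Let bcoord (f : S -> R) i : bmeas f -> bmeas (fun z : Omega => f (z i)).
Proof. exact: bmeas_comp (measurable_coord i). Qed.

Lemma measurable_upd_l (z : Omega) j : measurable_fun setT (fun s : S => upd z j s).
Proof.
apply: measurable_seq_space => i; rewrite /upd; case: eqP => _ //.
Qed.

(** With all other entries frozen, e is an event about x_j, and on such events
    the indicator of y_j >= t and g(x_j) have the same mean. *)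
Lemma mean_cond_indep j (e : Omega -> bool) (B : Omega -> R) :
  measurable [set z | e z] -> bmeas B ->
  (forall z s s', s.1 = s'.1 -> e (upd z j s) = e (upd z j s')) ->
  (forall z s, B (upd z j s) = B z) ->
  mean Q (fun z => (e z)%:R * B z * (A (z j) - g' (z j))) = 0.
Proof.
move=> me mB ej Bj.
rewrite (mean_resample_r iidQ j); last first.
  apply: bmeasM; first by apply: bmeasM => //; exact: bmeas_bool.
  by apply: bmeasB; exact: bcoord.
rewrite -[RHS](mean_cst Q 0); congr mean; apply/funext => z.
pose Ez := [set u : d.-tuple R | e (upd z j (u, 0))].
have mu0 : measurable_fun setT (fun u : d.-tuple R => upd z j (u, 0) : Omega).
  apply: measurableT_comp (measurable_upd_l z j) _.
  exact: measurable_pair2.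
have mEz : measurable Ez.
  by have := mu0 measurableT _ me; rewrite setTI.
transitivity (mean Q (fun z' : Omega => B z * (\1_Ez (z' j).1 * (A (z' j) - g' (z' j))))).
  congr mean; apply/funext => z'; rewrite Bj mulrCA -mulrA; congr (_ * (_ * _)).
    by rewrite indicE /Ez mem_setE; congr (_%:R); congr nat_of_bool; exact: ej.
  by rewrite /upd eqxx.
have bE : bmeas (fun s : S => \1_Ez s.1 : R).
  exact: bmeas_comp measurable_fst (bmeas_indic mEz).
have bEA : bmeas (fun s : S => \1_Ez s.1 * A s) by exact: bmeasM.
have bEg : bmeas (fun s : S => \1_Ez s.1 * g' s) by exact: bmeasM.
rewrite meanZ; last first.
  exact: (bcoord j (bmeasM bE (bmeasB bA bg'))).
rewrite (@mean_coord _ _ _ _ iidQ (fun s => \1_Ez s.1 * (A s - g' s))); last first.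
  by apply: bmeasM => //; exact: bmeasB.
rewrite (_ : mean Q _ = 0) ?mulr0//.
transitivity (mean Q (fun z' : Omega => \1_Ez (z' 0%N).1 * A (z' 0%N) -
    \1_Ez (z' 0%N).1 * g' (z' 0%N))).
  by congr mean; apply/funext => z'; rewrite mulrBr.
rewrite meanB; [|exact: (bcoord 0%N bEA)|exact: (bcoord 0%N bEg)].
by rewrite /A /g' g_cond// subrr.
Qed.

Let xs_upd n z (j : 'I_n) (s s' : S) : s.1 = s'.1 ->
  xs (upd z j s) = xs (upd z j s') :> ('I_n -> _).
Proof.
by move=> ss'; apply/funext => i; rewrite /xs /upd; case: eqP => // _.
Qed.

Let bnb n (i j : 'I_n) : bmeas (fun z : Omega => (neighbor N z i == j)%:R : R).
Proof. by apply: bmeas_bool; exact: nb_measurable rule _ _ _. Qed.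

Let gR (z : Omega) (i : nat) : R := g (z i).1.
Let AR (z : Omega) (i : nat) : R := A (z i).

(** For i and j distinct, the conditioning identity is applied to y_i, then to
    y_j; the neighbor relation depends on the x-values only. *)
Let step_l n (i j : 'I_n) : i != j ->
  mean Q (fun z => (neighbor N z i == j)%:R * (AR z i * AR z j)) =
  mean Q (fun z => (neighbor N z i == j)%:R * (gR z i * gR z j)).
Proof.
move=> ij.
have bAR k : bmeas (AR ^~ k) by exact: (bcoord k bA).
have bgR k : bmeas (gR ^~ k) by exact: (bcoord k bg').
have bM f h : bmeas f -> bmeas h ->
    bmeas (fun z : Omega => (neighbor N z i == j)%:R * (f z * h z) : R).
  by move=> mf mh; apply: bmeasM => //; exact: bmeasM.
have ee k z s s' : s.1 = s'.1 -> (k == i) || (k == j) ->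
    (neighbor N (upd z k s) i == j) = (neighbor N (upd z k s') i == j).
  move=> ss'; rewrite /neighbor.
  by case/orP => /eqP ->; rewrite (xs_upd z _ ss').
apply/eqP; rewrite -subr_eq0.
transitivity (mean Q (fun z => (neighbor N z i == j)%:R * AR z j * (A (z i) - g' (z i))) +
  mean Q (fun z => (neighbor N z i == j)%:R * gR z i * (A (z j) - g' (z j))) == 0).
  rewrite -meanD; last 2 first.
  - apply: bmeasM; [exact: bmeasM|apply: bmeasB];
      [exact: (bcoord i bA)|exact: (bcoord i bg')].
  - apply: bmeasM; [exact: bmeasM|apply: bmeasB];
      [exact: (bcoord j bA)|exact: (bcoord j bg')].
  rewrite -meanB; [|exact: bM|exact: bM].
  congr (mean Q _ == 0); apply/funext => z; rewrite /AR /gR /g'; ring.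
have nj (k : nat) : k != i :> nat -> forall z s, gR (upd z k s) i = gR z i.
  by move=> ki z s; rewrite /gR /upd eq_sym (negbTE ki).
have nA (k : nat) : k != j :> nat -> forall z s, AR (upd z k s) j = AR z j.
  by move=> kj z s; rewrite /AR /upd eq_sym (negbTE kj).
have mnb : measurable [set z : Omega | neighbor N z i == j].
  exact: nb_measurable rule _ _ _.
rewrite (mean_cond_indep (j := i) mnb)//; last 2 first.
- by move=> z s s' ss'; apply: (ee i) => //; rewrite eqxx.
- exact: nA.
rewrite (mean_cond_indep (j := j) mnb) ?addr0 ?eqxx//.
- by move=> z s s' ss'; apply: (ee j) => //; rewrite eqxx orbT.
- by apply: nj; rewrite eq_sym.
Qed.

(** Given the x-values, the probability that the pair (i, N i) lies above t is
    g(x_i) g(x_(N i)), which is g(x_i)^2 up to the oscillation of g. The few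
    fixed points of the neighbor map cost at most 1/n. *)
Lemma mean_upper_frac :
  mean Q (fun z => upper_frac n z t) @[n --> \oo] -->
  mean Q (fun z => g (z 0%N).1 ^+ 2).
Proof.
pose H := mean Q (fun z => g (z 0%N).1 ^+ 2).
have bAR k : bmeas (AR ^~ k) by exact: (bcoord k bA).
have bgR k : bmeas (gR ^~ k) by exact: (bcoord k bg').
have b1 n (i : 'I_n) (f : Omega -> nat -> R) : (forall k, bmeas (f ^~ k)) ->
    bmeas (fun z => f z i * f z (neighbor N z i)).
  move=> bf; apply: bmeasM => //.
  exact: (bmeas_nb rule i (fun j => bf j)).
have AA n z (i : 'I_n) : (t <= pair_min z i)%R%:R = AR z i * AR z (neighbor N z i).
  rewrite /pair_min le_min /AR /A /ys.
  by case: (t <= _); case: (t <= _); rewrite ?mulr1 ?mulr0.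
have step1 n (i : 'I_n) : `|mean Q (fun z => AR z i * AR z (neighbor N z i)) -
    mean Q (fun z => gR z i * gR z (neighbor N z i))| <=
    mean Q (fun z => (neighbor N z i == i)%:R).
  have dec (f : Omega -> nat -> R) : (forall k, bmeas (f ^~ k)) ->
      mean Q (fun z => f z i * f z (neighbor N z i)) =
      mean Q (fun z => (neighbor N z i == i)%:R * (f z i * f z i)) +
      \sum_(j < n | j != i) mean Q (fun z => (neighbor N z i == j)%:R * (f z i * f z j)).
    move=> bf; have bfj j : bmeas (fun z => (neighbor N z i == j)%:R * (f z i * f z j)).
      by apply: bmeasM => //; exact: bmeasM.
    rewrite -mean_sum// -meanD//; last exact: bmeas_sum.
    congr mean; apply/funext => z.
    transitivity (\sum_(j < n) (neighbor N z i == j)%:R * (f z i * f z j)); last first.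
      by rewrite (bigD1 i).
    rewrite (bigD1 (neighbor N z i))//= eqxx mul1r big1 ?addr0// => j.
    by rewrite eq_sym => /negbTE ->; rewrite mul0r.
  rewrite (dec AR)// (dec gR)//.
  rewrite (eq_bigr (fun j => mean Q (fun z => (neighbor N z i == j)%:R * (gR z i * gR z j)))); last first.
    by move=> j ji; apply: step_l; rewrite eq_sym.
  rewrite opprD addrACA subrr addr0 -meanB; [|by apply: bmeasM => //; exact: bmeasM..].
  apply: le_trans (mean_norm _ _) _.
    by apply: bmeasB; apply: bmeasM => //; exact: bmeasM.
  apply: ler_mean => [||z] //.
    by apply: bmeas_norm; apply: bmeasB; apply: bmeasM => //; exact: bmeasM.
  rewrite -mulrBr normrM normr_nat ler_piMr//.
  have /andP[g0 g1] := g01 (z i).1; rewrite /AR /A /gR.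
  have gg : 0 <= g (z i).1 * g (z i).1 <= 1 by rewrite mulr_ge0//= mulr_ile1.
  case/andP: gg => gg0 gg1; rewrite ler_norml.
  by case: (t <= _)%R; rewrite /= ?mulr1 ?mulr0; apply/andP; split; lra.
have step2 n (i : 'I_n) : `|mean Q (fun z => gR z i * gR z (neighbor N z i)) - H| <=
    mean Q (fun z => `|g (xs z i) - g (xs z (neighbor N z i))|).
  have -> : H = mean Q (fun z => gR z i * gR z i).
    rewrite /H -(mean_coord iidQ (f := fun s => g s.1 ^+ 2) i) //.
    by apply: bmeasX; exact: bg'.
  rewrite -meanB; [|exact: b1|exact: bmeasM].
  apply: le_trans (mean_norm _ _) _; first by apply: bmeasB; [exact: b1|exact: bmeasM].
  apply: ler_mean => [||z].
  - by apply: bmeas_norm; apply: bmeasB; [exact: b1|exact: bmeasM].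
  - apply: bmeas_norm; apply: bmeasB; first exact: bmeas_xs.
    exact: (bmeas_xs_nb rule).
  rewrite -mulrBr normrM distrC /gR -/(xs z i) -/(xs z (neighbor N z i)).
  by have /andP[g0 g1] := g01 (xs z i); rewrite ler_piMl// ger0_norm.
have main n : (1 < n)%N -> `|mean Q (fun z => upper_frac n z t) - H| <=
    n%:R^-1 + mean_osc Q N g n.
  move=> n1; have n0 : 0 < n%:R :> R by rewrite ltr0n; lia.
  rewrite /upper_frac meanZ; last first.
    apply: bmeas_sum => i; rewrite (_ : (fun z => _) = fun z => AR z i * AR z (neighbor N z i)).
      exact: b1.
    by apply/funext => z; rewrite AA.
  have -> : (fun z => \sum_(i < n) (t <= pair_min z i)%R%:R) =
      (fun z => \sum_(i < n) AR z i * AR z (neighbor N z i)) :> (Omega -> R).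
    by apply/funext => z; apply: eq_bigr => i _.
  rewrite mean_sum; last by move=> i; exact: b1.
  rewrite -[H](mulKf (lt0r_neq0 n0)) -mulrBr normrM gtr0_norm ?invr_gt0//.
  rewrite /mean_osc -[X in _ <= X + _]mulr1 -mulrDr ler_wpM2l ?invr_ge0//.
  have -> : n%:R * H = \sum_(i < n) H by rewrite sumr_const card_ord mulr_natl.
  rewrite -sumrB; apply: le_trans (ler_norm_sum _ _ _) _.
  apply: (@le_trans _ _ (\sum_(i < n) (mean Q (fun z => (neighbor N z i == i)%:R) +
    mean Q (fun z => `|g (xs z i) - g (xs z (neighbor N z i))|)))).
    apply: ler_sum => i _; apply: le_trans (lerD (step1 n i) (step2 n i)).
    by apply: le_trans (ler_normD _ _); rewrite addrA subrK.
  rewrite big_split/= lerD//.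
    rewrite -mean_sum// -[leRHS](mean_cst Q); apply: ler_mean_ae.
    - exact: bmeas_sum.
    - exact: bmeas_cst.
    apply: ae_imply (ae_distinct k0 iidQ atomlessX) => z dz.
    rewrite (sum_pred_card R (fun i => neighbor N z i == i)) lern1.
    exact: (nb_fixed rule n1 (dz n)).
  rewrite -mean_sum//= => i; apply: bmeas_norm; apply: bmeasB; first exact: bmeas_xs.
  exact: (bmeas_xs_nb rule).
have og : mean_osc Q N g n @[n --> \oo] --> 0.
  exact: (osc_vanishes_measurable iidQ atomlessX rule).
apply/cvgrPdist_le => e e0.
have e2 : 0 < e / 2 by rewrite divr_gt0.
have ne := cvg0_le og e2.
near=> n.
have n1 : (1 < n)%N by near: n; exact: nbhs_infty_gt.
have n0 : 0 < n%:R :> R by rewrite ltr0n; lia.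
rewrite distrC (le_trans (main n n1))//.
apply: (@le_trans _ _ (e / 2 + e / 2)); last lra.
rewrite lerD//; last by near: n; exact: ne.
rewrite -[leLHS]mul1r ler_pdivrMr// mulrC -ler_pdivrMr//.
by near: n; exact: nbhs_infty_ger.
Unshelve. all: by end_near. Qed.

End MeanUpperFrac.

(** * Uniform control of distribution functions *)

Lemma sqr_sum_le (R : realType) (I : Type) (r : seq I) (f : I -> R) :
  (\sum_(i <- r) f i) ^+ 2 <= (size r)%:R * \sum_(i <- r) f i ^+ 2.
Proof.
rewrite expr2 mulr_suml.
apply: (@le_trans _ _ (\sum_(i <- r) \sum_(j <- r) 2^-1 * (f i ^+ 2 + f j ^+ 2))).
  apply: ler_sum => i _; rewrite mulr_sumr; apply: ler_sum => j _.
  by have := sqr_ge0 (f i - f j); nra.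
have E c : \sum_(j <- r) c = (size r)%:R * c :> R.
  by rewrite big_const_seq count_predT iter_addr_0 mulr_natl.
rewrite le_eqVlt; apply/orP; left; apply/eqP.
under eq_bigr do rewrite -mulr_sumr big_split/= E.
by rewrite -mulr_sumr big_split/= -mulr_sumr E; field.
Qed.

Lemma pred_between a b : (1 < a <= b)%N -> (0 < a.-1 < b)%N.
Proof. by case: a => [|[|a]]. Qed.

Lemma natr_pred (R : pzRingType) a : (0 < a)%N -> a.-1%:R = a%:R - 1 :> R.
Proof. by case: a => // a _; rewrite -natr1 addrK. Qed.

(** Polya's argument: between two neighboring quantiles of F both monotone
    functions vary little, except for the error of K at these quantiles. *)
Lemma cdf_grid (R : realType) (F : R -> R) : continuous F ->
  (forall s t, s <= t -> F s <= F t) -> (forall t, 0 <= F t <= 1) ->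
  (forall e, 0 < e -> exists t, F t <= e) ->
  (forall e, 0 < e -> exists t, 1 - e <= F t) ->
  forall e, 0 < e -> exists r : seq R, forall K : R -> R,
    (forall s t, s <= t -> K s <= K t) -> (forall t, 0 <= K t <= 1) ->
    forall t, `|K t - F t| <= \sum_(a <- r) `|K a - F a| + e.
Proof.
move=> cF mF cdf_unit F0 F1 e e0.
(* two steps of the grid make up the tolerance e *)
pose q := (Num.truncn (2 / e)).+1.
have q0 : 0 < q%:R :> R by [].
have qe : 2 / q%:R <= e.
  rewrite ler_pdivrMr// mulrC -ler_pdivrMr// ltW//.
  by have /andP[] := truncn_itv (ltW (divr_gt0 (ltr0Sn R 1) e0)).
have quantile (l : nat) : exists a, (0 < l < q)%N -> F a = l%:R / q%:R.
  have [/andP[l0 lq]|_] := boolP (0 < l < q)%N; last by exists 0.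
  have v0 : 0 < l%:R / q%:R :> R by rewrite divr_gt0// ltr0n.
  have v1 : 0 < 1 - l%:R / q%:R :> R.
    by rewrite subr_gt0 ltr_pdivrMr// mul1r ltr_nat.
  have [a ha] := F0 _ v0; have [b] := F1 _ v1; rewrite subKr => hb.
  have [ab|ba] := lerP a b; last first.
    have := mF _ _ (ltW ba) => hh; exists a => _; apply/eqP; rewrite eq_le ha/=.
    exact: le_trans hb hh.
  have [||c _ Fc] := @IVT R F a b (l%:R / q%:R) ab.
  - exact: continuous_subspaceT.
  - by rewrite ge_min ha/= le_max hb orbT.
  by exists c.
have [a Fa] := choice quantile.
exists [seq a l | l <- iota 0 q] => K mK K01 t.
set Sg := \sum_(b <- _) _.
have Sg_ge l : (l < q)%N -> `|K (a l) - F (a l)| <= Sg.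
  move=> lq; rewrite /Sg (big_rem (a l)); first by rewrite lerDl sumr_ge0.
  by apply: map_f; rewrite mem_iota.
have S0 : 0 <= Sg by apply: sumr_ge0.
have /andP[Ft0 Ft1] := cdf_unit t; have /andP[Kt0 Kt1] := K01 t.
have qF0 : 0 <= q%:R * F t by rewrite mulr_ge0.
have /andP[T1 T2] := truncn_itv qF0; set T := Num.truncn _ in T1 T2.
rewrite -natr1 in T2.
have qF1 : q%:R * F t <= q%:R by rewrite ler_piMr.
have q2 : q%:R * (2 / q%:R) = 2 :> R by rewrite mulrC divfK ?gt_eqF.
have cmp (x y : R) : q%:R * x <= q%:R * y -> x <= y by rewrite ler_pM2l.
rewrite ler_norml; apply/andP; split.
- have [h|h] := lerP (q%:R * F t) 2.
    have : F t <= 2 / q%:R by apply: cmp; rewrite q2.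
    lra.
  have Tq : (T <= q)%N by rewrite -(ler_nat R); lra.
  have T2' : (2 <= T)%N.
    rewrite /T truncn_ge_nat//; exact: ltW.
  have lq : (0 < T.-1 < q)%N by apply: pred_between; rewrite T2'.
  have T1E : T.-1%:R = T%:R - 1 :> R by rewrite natr_pred// ltnW.
  have Fl := Fa _ lq; set b := a T.-1 in Fl.
  have qFb : q%:R * F b = T%:R - 1 by rewrite Fl mulrC divfK ?gt_eqF.
  have bt : b <= t.
    rewrite leNgt; apply/negP => tb; have := mF _ _ (ltW tb).
    by rewrite -(ler_pM2l q0) qFb; lra.
  have h1 := mK _ _ bt.
  have := Sg_ge _ (proj2 (andP lq)); rewrite -/b ler_norml => /andP[h2 _].
  have : F t - 2 / q%:R <= F b by apply: cmp; rewrite mulrBr q2 qFb; lra.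
  lra.
- have [h|h] := lerP (q%:R - 2) (q%:R * F t).
    have : 1 - 2 / q%:R <= F t by apply: cmp; rewrite mulrBr q2 mulr1.
    lra.
  have lq : (0 < T.+1 < q)%N.
    have : (T.+1 < q)%N by rewrite -(ltr_nat R) -natr1; lra.
    by move=> ->.
  have Fl := Fa _ lq; set b := a T.+1 in Fl.
  have qFb : q%:R * F b = T%:R + 1 by rewrite Fl mulrC divfK ?gt_eqF// natr1.
  have bt : t <= b.
    rewrite leNgt; apply/negP => tb; have := mF _ _ (ltW tb).
    by rewrite -(ler_pM2l q0) qFb; lra.
  have h1 := mK _ _ bt.
  have := Sg_ge _ (proj2 (andP lq)); rewrite -/b ler_norml => /andP[_ h2].
  have : F b <= F t + 2 / q%:R by apply: cmp; rewrite mulrDr q2 qFb; lra.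
  lra.
Qed.

(** * Replacing one observation *)

Section Replacement.
Context {R : realType} {d : nat} (k0 : 'I_d).
Notation S := (d.-tuple R * R)%type.
Notation Omega := (seq_space S).
Variable Q : probability Omega R.
Hypothesis iidQ : iid_law Q.
Hypothesis atomlessX : forall k s,
  Q [set z : Omega | tnth (z 0%N).1 k == s] = 0%E.
Variables (N : forall n, ('I_n -> d.-tuple R) -> 'I_n -> 'I_n) (C : nat).
Hypothesis rule : neighbor_rule k0 N C.

Notation nb := (neighbor N).
Notation nbmin := (pair_min N).
Notation L := (upper_frac N).

Definition separated (z : Omega) : Prop :=
  forall i j : nat, i != j -> tnth (z i).1 k0 != tnth (z j).1 k0.

Lemma ae_separated : {ae Q, forall z, separated z}.
Proof.
have mphi : measurable_fun setT (fun s : S => tnth s.1 k0).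
  exact: measurableT_comp (measurable_tnth k0) measurable_fst.
exact: (ae_coord_neq iidQ mphi (atomlessX k0)).
Qed.

Lemma separated_distinct n z (tau : nat -> nat) : separated z ->
  {in gtn n &, injective tau} -> distinct k0 (@xs R d n (z \o tau)).
Proof.
move=> gz itau i j /= e; apply/val_inj; apply: itau; rewrite ?inE ?ltn_ord//.
apply/eqP; apply: contraT => /gz; rewrite /xs/= in e.
by rewrite [X in X != _]e eqxx.
Qed.

Lemma repl_inj n j : {in gtn n &, injective (repl n j)}.
Proof. by move=> a b; rewrite !inE /repl; repeat case: ifP; lia. Qed.

(** Superset of the indices whose pair is affected when the j-th observation is
    replaced. *)
Definition changed n (z : Omega) (j : 'I_n) : pred 'I_n := fun i =>
  [|| i == j, nb z i == j | nb (z \o repl n j) i == j].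

Lemma ys_repl n (z : Omega) (i j : 'I_n) : i != j -> ys (z \o repl n j) i = ys z i.
Proof. by rewrite /ys /= /repl -val_eqE /= => /negbTE ->. Qed.

Lemma xs_repl n (z : Omega) (i j : 'I_n) : i != j -> xs (z \o repl n j) i = xs z i.
Proof. by rewrite /xs /= /repl -val_eqE /= => /negbTE ->. Qed.

Lemma nbmin_unchanged n z (i j : 'I_n) : ~~ changed z j i ->
  nbmin (z \o repl n j) i = nbmin z i.
Proof.
rewrite /changed !negb_or => /and3P[ij nj nj'].
have e : nb (z \o repl n j) i = nb z i.
  apply: (nb_local rule ij) => // k kj; exact: xs_repl.
by rewrite /pair_min e !ys_repl.
Qed.

(** Besides j itself, only the indices having j as neighbor before or after the
    replacement are affected, at most C of each kind. *)
Definition max_changed := (2 * C).+1.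
Notation D := max_changed.

Lemma card_changed n z (j : 'I_n) : separated z -> (#|changed z j| <= D)%N.
Proof.
move=> gz; have h := @card_le_add3 _ (changed z j) (pred1 j)
  (fun i => nb z i == j) (fun i => nb (z \o repl n j) i == j).
apply: leq_trans (h _) _; first by move=> i.
rewrite card1 /max_changed mul2n -addnn add1n addSn ltnS leq_add//.
  by apply: (nb_indegree rule); apply: (separated_distinct (tau := id) gz).
by apply: (nb_indegree rule); apply: (separated_distinct gz); exact: repl_inj.
Qed.

Lemma sum_unchanged n z (j : 'I_n) (f : 'I_n -> R) K : separated z -> 0 <= K ->
  (forall i, ~~ changed z j i -> f i = 0) -> (forall i, `|f i| <= K) ->
  `|\sum_i f i| <= D%:R * K.
Proof.
move=> gz K0 f0 fK; rewrite (le_trans (ler_norm_sum _ _ _))//.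
apply: (@le_trans _ _ (\sum_i (changed z j i)%:R * K)).
  apply: ler_sum => i _; case: (boolP (changed z j i)) => [_|/f0 ->].
    by rewrite mul1r.
  by rewrite normr0 mul0r.
by rewrite -mulr_suml ler_wpM2r// sum_pred_card ler_nat card_changed.
Qed.

Lemma sum_nbmin_repl n z (j : 'I_n) t : separated z ->
  `|\sum_(i < n) (t <= nbmin z i)%R%:R - \sum_(i < n) (t <= nbmin (z \o repl n j) i)%R%:R|
   <= D%:R :> R.
Proof.
move=> gz; rewrite -sumrB -[leRHS]mulr1; apply: (sum_unchanged (j := j) gz) => // i.
  by move/nbmin_unchanged ->; rewrite subrr.
by case: (t <= nbmin z i)%R; case: (t <= nbmin (z \o repl n j) i)%R;
  rewrite ?subrr ?subr0 ?sub0r ?normrN ?normr1 ?normr0.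
Qed.

Lemma dep_nb n (z z' : Omega) : (forall i, (i < n)%N -> z i = z' i) ->
  (forall i, @ys R d n z i = ys z' i) /\ (forall i, @nb n z i = nb z' i).
Proof.
move=> zz'; split=> i; first by rewrite /ys zz'.
by rewrite /neighbor; congr (N _ _); apply/funext => k; rewrite /xs zz'.
Qed.

Lemma dep_nbmin n (z z' : Omega) : (forall i, (i < n)%N -> z i = z' i) ->
  forall i : 'I_n, nbmin z i = nbmin z' i.
Proof.
by move=> /dep_nb[e1 e2] i; rewrite /pair_min e2 !e1.
Qed.

Lemma dep_upper_frac n (z z' : Omega) t : (forall i, (i < n)%N -> z i = z' i) ->
  L n z t = L n z' t.
Proof.
move=> zz'; rewrite /upper_frac; congr (_ * _); apply: eq_bigr => i _.
by rewrite (dep_nbmin zz').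
Qed.

(** Efron-Stein: a replacement moves the fraction by at most D/n. *)
Lemma dev_upper_frac n t : (0 < n)%N ->
  mean_sqr_dev Q (fun z => L n z t) <= D%:R ^+ 2 / n%:R.
Proof.
move=> n0; have n0' : 0 < n%:R :> R by rewrite ltr0n.
have bL := bmeas_upper_frac rule n t.
apply: le_trans (efron_stein iidQ bL (fun z z' => @dep_upper_frac n z z' t)) _.
apply: (@le_trans _ _ (2^-1 * \sum_(j < n) (D%:R / n%:R) ^+ 2)).
  rewrite ler_wpM2l//; apply: ler_sum => j _.
  rewrite -[leRHS](mean_cst Q); apply: ler_mean_ae.
  - by apply: bmeasX; apply: bmeasB => //; exact: (bmeas_reindex _ bL).
  - exact: bmeas_cst.
  apply: ae_imply ae_separated => z gz.
  rewrite -sqr_norm lerXn2r ?nnegrE ?divr_ge0//.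
  rewrite /upper_frac -mulrBr normrM gtr0_norm ?invr_gt0// mulrC.
  by rewrite ler_pM2r ?invr_gt0// sum_nbmin_repl.
rewrite sumr_const card_ord -[X in 2^-1 * X]mulr_natl expr_div_n.
set a := D%:R ^+ 2; have a0 : 0 <= a by exact: sqr_ge0.
rewrite (_ : n%:R * (a / n%:R ^+ 2) = a / n%:R); last by field; rewrite gt_eqF.
have : 0 <= a / n%:R by rewrite divr_ge0.
lra.
Qed.

Variable h : R -> R.
Hypothesis mean_L : forall t, mean Q (fun z => L n z t) @[n --> \oo] --> h t.

(** Monotonicity passes to the limit, and makes h measurable. *)
Lemma limit_frac_anti s t : s <= t -> h t <= h s.
Proof.
move=> st; apply: ler_cvg_to (@mean_L t) (@mean_L s) _.
apply: nearW => n; apply: ler_mean => [||z]; try exact: bmeas_upper_frac rule _ _.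
exact: upper_frac_anti.
Qed.

Lemma limit_frac01 t : 0 <= h t <= 1.
Proof.
apply/andP; split.
  apply: ler_cvg_to (cvg_cst 0) (@mean_L t) _.
  by apply: nearW => n; apply: mean_ge0 => z; exact: upper_frac_ge0.
apply: ler_cvg_to (@mean_L t) (cvg_cst (1 : R)) _.
apply: nearW => n; apply: mean_le1; first exact: bmeas_upper_frac rule _ _.
by move=> z; exact: upper_frac_le1.
Qed.

Lemma measurable_limit_frac : measurable_fun setT h.
Proof.
have -> : h = fun t => - (- h t) by apply/funext => t; rewrite opprK.
apply: measurableT_comp => //.
by apply: nondecreasing_measurable => // s t st; rewrite lerN2 limit_frac_anti.
Qed.

Lemma bmeas_limit_frac : bmeas h.
Proof. exact: bmeas_of01 measurable_limit_frac limit_frac01. Qed.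

(** Variance plus squared bias. *)
Lemma upper_frac_L2 t : mean Q (fun z => (L n z t - h t) ^+ 2) @[n --> \oo] --> 0.
Proof.
have bL n := bmeas_upper_frac rule n t.
have E n : mean Q (fun z => (L n z t - h t) ^+ 2) =
    mean_sqr_dev Q (fun z => L n z t) + (mean Q (fun z => L n z t) - h t) ^+ 2.
  by rewrite mean_sqrB_cst// mean_sqr_devE//; ring.
have lim : (mean Q (fun z => L n z t) - h t) ^+ 2 @[n --> \oo] --> 0.
  have c : (mean Q (fun z => L n z t) - h t) @[n --> \oo] --> 0.
    by rewrite -(subrr (h t)); apply: cvgB; [exact: mean_L|exact: cvg_cst].
  have := cvgM c c; rewrite mulr0; apply.
apply: cvg0_ge0 => [n|e e0]; first by apply: mean_ge0 => z; exact: sqr_ge0.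
have e2 : 0 < e / 2 by rewrite divr_gt0.
have ne := cvg0_le lim e2.
near=> n.
have n0 : (0 < n)%N by near: n; exact: nbhs_infty_gt.
rewrite E; apply: (@le_trans _ _ (e / 2 + e / 2)); last lra.
rewrite lerD//; last by near: n; exact: ne.
rewrite (le_trans (dev_upper_frac t n0))// ler_pdivrMr ?ltr0n//.
rewrite mulrC -ler_pdivrMr//; near: n; exact: nbhs_infty_ger.
Unshelve. all: by end_near. Qed.

(** The level is an observation that is independent of the first n ones. *)
Definition level_err n (z : Omega) : R := (L n z (z n).2 - h (z n).2) ^+ 2.

Lemma bmeas_limit_frac_coord n : bmeas (fun z : Omega => h (z n).2).
Proof.
apply: bmeas_comp bmeas_limit_frac.
exact: measurableT_comp measurable_snd (measurable_coord n).
Qed.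

Lemma bmeas_level_err_pair n : bmeas (fun p : Omega * Omega =>
  (L n p.1 (p.2 n).2 - h (p.2 n).2) ^+ 2).
Proof.
apply: bmeasX; apply: bmeasB; last first.
  exact: bmeas_comp measurable_snd (bmeas_limit_frac_coord n).
apply: bmeasM; first exact: bmeas_cst.
apply: bmeas_sum => i; apply: bmeas_bool; apply: measurable_ler.
  apply: (measurableT_comp measurable_snd).
  exact: (measurableT_comp (measurable_coord n) measurable_snd).
exact: (measurableT_comp (measurable_nbmin rule i) measurable_fst).
Qed.

Lemma bmeas_level_err n : bmeas (level_err n).
Proof.
apply: (bmeas_comp (phi := fun z : Omega => (z, z)) _ (bmeas_level_err_pair n)).
exact: measurable_fun_pair.
Qed.

(** Freezing the level reduces to the convergence at a fixed level, and bounded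
    convergence integrates over the level. *)
Lemma mean_level_err : mean Q (level_err n) @[n --> \oo] --> 0.
Proof.
pose w n t := mean Q (fun z => (L n z t - h t) ^+ 2).
have bw n : bmeas (fun z' : Omega => w n (z' n).2).
  exact: (bmeas_mean_l Q Q (bmeas_level_err_pair n)).
have E n : mean Q (level_err n) = mean Q (fun z' : Omega => w n (z' n).2).
  rewrite (mean_resample iidQ n (bmeas_level_err n)).
  congr mean; apply/funext => z'; congr mean; apply/funext => z.
  rewrite /level_err (@dep_upper_frac n _ z); first by rewrite /upd eqxx.
  by move=> i im; rewrite /upd ltn_eqF.
pose sw n j := if j == 0%N then n else if j == n then 0%N else j.
have isw n : injective (sw n) by move=> a b; rewrite /sw; repeat case: ifP; lia.
have E' n : mean Q (level_err n) = mean Q (fun z' : Omega => w n (z' 0%N).2).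
  rewrite E (mean_reindex iidQ (isw n) (bw n)); congr mean; apply/funext => z.
  by congr (w n (z _).2); rewrite /sw; repeat case: ifP; lia.
under eq_fun do rewrite E'.
apply: (@mean_cvg0 _ _ _ _ _ 1) => [n|n z|z].
- have := bmeas_reindex (sw n) (bw n); congr bmeas; apply/funext => z.
  by congr (w n (z _).2); rewrite /sw; repeat case: ifP; lia.
- rewrite ger0_norm; last by apply: mean_ge0 => ?; exact: sqr_ge0.
  apply: mean_le1 => [|z'].
    by apply: bmeasX; apply: bmeasB; [exact: bmeas_upper_frac rule _ _|exact: bmeas_cst].
  have /andP[a0 a1] := limit_frac01 (z 0%N).2.
  have b0 := @upper_frac_ge0 _ _ N n z' (z 0%N).2; have b1 := @upper_frac_le1 _ _ N n z' (z 0%N).2.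
  by rewrite -sqr_norm expr_le1// ler_norml; apply/andP; split; lra.
- exact: upper_frac_L2.
Qed.

End Replacement.

(** * The variance of the core statistic *)

Section MainVariance.
Context {R : realType} {d : nat} (k0 : 'I_d).
Notation S := (d.-tuple R * R)%type.
Notation Omega := (seq_space S).
Variable Q : probability Omega R.
Hypothesis iidQ : iid_law Q.
Hypothesis atomlessX : forall k s,
  Q [set z : Omega | tnth (z 0%N).1 k == s] = 0%E.
Variables (N : forall n, ('I_n -> d.-tuple R) -> 'I_n -> 'I_n) (C : nat).
Hypothesis rule : neighbor_rule k0 N C.

Notation nb := (neighbor N).
Notation nbmin := (pair_min N).
Notation L := (upper_frac N).
Notation D := (max_changed C).
Notation separated := (separated k0).

Variable h : R -> R.
Hypothesis mean_L : forall t, mean Q (fun z => L n z t) @[n --> \oo] --> h t.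

Variable F : R -> R.
Hypothesis FE : forall t, F t = mean Q (fun z => ((z 0%N).2 <= t)%R%:R).
Hypothesis cF : continuous F.

Let ble i t : bmeas (fun z : Omega => ((z i).2 <= t)%R%:R : R).
Proof. by apply: bmeas_coord_le => //; exact: measurable_snd. Qed.

Lemma F_mono s t : s <= t -> F s <= F t.
Proof.
move=> st; rewrite !FE; apply: ler_mean => // z.
by case: (boolP (_ <= s)) => // /le_trans -> //.
Qed.

Lemma cdf_unit t : 0 <= F t <= 1.
Proof.
rewrite FE mean_ge0//=; apply: mean_le1 => // z; by case: (_ <= t)%R.
Qed.

Lemma cdf_low e : 0 < e -> exists t, F t <= e.
Proof.
move=> e0.
have lim : F (- n%:R) @[n --> \oo] --> 0.
  under eq_fun do rewrite FE.
  apply: (@mean_cvg0 _ _ _ _ _ 1) => [//|n z|z].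
    by case: ((z 0%N).2 <= _)%R; rewrite ?normr1 ?normr0.
  apply: cvg_near_cst; near=> n; rewrite leNgt ltrNl (_ : _ < n%:R)//.
  by near: n; exact: nbhs_infty_gtr.
have [n _ /(_ n (leqnn n)) hn] := cvg0_le lim e0.
by exists (- n%:R).
Unshelve. all: by end_near. Qed.

Lemma cdf_high e : 0 < e -> exists t, 1 - e <= F t.
Proof.
move=> e0.
have lim : mean Q (fun z => 1 - ((z 0%N).2 <= n%:R)%R%:R) @[n --> \oo] --> 0.
  apply: (@mean_cvg0 _ _ _ _ _ 1) => [n|n z|z].
  - by apply: bmeasB => //; exact: bmeas_cst.
  - by case: ((z 0%N).2 <= _)%R; rewrite ?subrr ?subr0 ?normr1 ?normr0.
  apply: cvg_near_cst; near=> n; rewrite (_ : _ <= n%:R) ?subrr//.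
  by near: n; exact: nbhs_infty_ger.
have [n _ /(_ n (leqnn n))] := cvg0_le lim e0.
rewrite /= meanB//; last exact: bmeas_cst.
by rewrite mean_cst -FE => hn; exists n%:R; lra.
Unshelve. all: by end_near. Qed.

Definition ecdf n (z : Omega) (t : R) : R := n%:R^-1 * \sum_(i < n) (ys z i <= t)%R%:R.

Lemma ecdf_mono n z s t : s <= t -> ecdf n z s <= ecdf n z t.
Proof.
move=> st; rewrite ler_wpM2l//; apply: ler_sum => i _.
by case: (boolP (_ <= s)) => //= h1; rewrite (le_trans h1 st).
Qed.

Lemma ecdf01 n z t : 0 <= ecdf n z t <= 1.
Proof.
case: n => [|n] in z *; first by rewrite /ecdf invr0 mul0r lexx ler01.
rewrite /ecdf mulr_ge0 ?sumr_ge0//= mulrC ler_pdivrMr// mul1r.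
rewrite -[n.+1 in leRHS]card_ord -sumr_const.
by apply: ler_sum => i _; case: (_ <= t)%R; rewrite ?ler01.
Qed.

Lemma bmeas_ecdf n t : bmeas (fun z => ecdf n z t).
Proof.
apply: bmeasM; first exact: bmeas_cst.
by apply: bmeas_sum => i; exact: ble.
Qed.

Lemma mean_ecdf n t : (0 < n)%N -> mean Q (fun z => ecdf n z t) = F t.
Proof.
move=> n0; rewrite meanZ; last by apply: bmeas_sum => i; exact: ble.
rewrite mean_sum; last by move=> i; exact: ble.
rewrite (eq_bigr (fun=> F t)); last first.
  have bt : bmeas (fun s : S => (s.2 <= t)%R%:R : R).
    by apply: bmeas_bool; apply: measurable_ler; [|exact: measurable_cst].
  by move=> i _; rewrite FE /ys (mean_coord iidQ i bt).
rewrite sumr_const card_ord -[X in _ * X]mulr_natl mulKf// pnatr_eq0; lia.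
Qed.

Lemma ecdf_repl n z (j : 'I_n) t : n%:R * (ecdf n z t - ecdf n (z \o repl n j) t) =
  ((z j).2 <= t)%R%:R - ((z n).2 <= t)%R%:R.
Proof.
have n0 : n%:R != 0 :> R.
  by rewrite pnatr_eq0 -lt0n (leq_ltn_trans (leq0n j) (ltn_ord j)).
rewrite /ecdf -mulrBr mulVKf// -sumrB (bigD1 j)//= big1 ?addr0.
  by rewrite /ys /= /repl eqxx.
by move=> i ij; rewrite ys_repl// subrr.
Qed.

(** Efron-Stein: a replacement moves the empirical distribution function by at
    most 1/n. *)
Lemma ecdf_L2 n t : (0 < n)%N ->
  mean Q (fun z => (ecdf n z t - F t) ^+ 2) <= n%:R^-1.
Proof.
move=> n0; have n0' : 0 < n%:R :> R by rewrite ltr0n.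
rewrite -(mean_ecdf t n0).
have dep (z z' : Omega) : (forall i, (i < n)%N -> z i = z' i) -> ecdf n z t = ecdf n z' t.
  by move=> zz'; congr (_ * _); apply: eq_bigr => i _; rewrite /ys zz'.
apply: le_trans (efron_stein iidQ (bmeas_ecdf n t) dep) _.
apply: (@le_trans _ _ (2^-1 * \sum_(j < n) n%:R^-1 ^+ 2)).
  rewrite ler_wpM2l//; apply: ler_sum => j _.
  rewrite -[leRHS](mean_cst Q); apply: ler_mean.
  - apply: bmeasX; apply: bmeasB; first exact: bmeas_ecdf.
    exact: (bmeas_reindex _ (bmeas_ecdf n t)).
  - exact: bmeas_cst.
  move=> z; rewrite -sqr_norm lerXn2r ?nnegrE ?invr_ge0//.
  rewrite -(ler_pM2l n0') -{1}[n%:R]gtr0_norm// -normrM ecdf_repl divff ?gt_eqF//.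
  by case: (_ <= t)%R; case: (_ <= t)%R;
    rewrite ?subrr ?subr0 ?sub0r ?normrN ?normr1 ?normr0.
rewrite sumr_const card_ord -[X in 2^-1 * X]mulr_natl.
rewrite (_ : n%:R * n%:R^-1 ^+ 2 = n%:R^-1); last by field; rewrite gt_eqF.
have : 0 <= n%:R^-1 :> R by rewrite invr_ge0.
lra.
Qed.

Definition ecdf_err (r : seq R) n z : R := \sum_(a <- r) `|ecdf n z a - F a|.

Lemma ecdf_err_L2 r n e : (0 < n)%N -> 0 <= e ->
  mean Q (fun z => (ecdf_err r n z + e) ^+ 2) <=
  2 * (size r)%:R ^+ 2 / n%:R + 2 * e ^+ 2.
Proof.
move=> n0 e0.
have bE a : bmeas (fun z => ecdf n z a - F a).
  by apply: bmeasB; [exact: bmeas_ecdf|exact: bmeas_cst].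
have bS : bmeas (fun z => \sum_(a <- r) (ecdf n z a - F a) ^+ 2).
  by apply: bmeas_sum => a; exact: bmeasX.
apply: (@le_trans _ _ (mean Q (fun z => 2 * (size r)%:R *
   (\sum_(a <- r) (ecdf n z a - F a) ^+ 2) + 2 * e ^+ 2))).
  apply: ler_mean => [||z].
  - apply: bmeasX; apply: bmeasD; last exact: bmeas_cst.
    by apply: bmeas_sum => a; exact: bmeas_norm.
  - by apply: bmeasD; [apply: bmeasM => //|]; exact: bmeas_cst.
  have := sqr_sum_le r (fun a => `|ecdf n z a - F a|).
  under [in leRHS]eq_bigr do rewrite sqr_norm.
  rewrite -/(ecdf_err r n z); set u := ecdf_err _ _ _ => hu.
  have := sqr_ge0 (u - e); rewrite -mulrA; nra.
rewrite meanD; [|by apply: bmeasM => //; exact: bmeas_cst|exact: bmeas_cst].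
rewrite mean_cst lerD2r meanZ// mean_sum; last by move=> a; exact: bmeasX.
rewrite expr2 !mulrA -[leRHS]mulrA ler_wpM2l ?mulr_ge0//.
apply: (@le_trans _ _ (\sum_(a <- r) n%:R^-1)).
  by apply: ler_sum => a _; exact: ecdf_L2.
by rewrite big_const_seq count_predT iter_addr_0 mulr_natl.
Qed.

(** The difference of the two statistics, up to the factor 6/(n^2-1) and an
    additive constant. *)
Definition core n (z : Omega) : R :=
  \sum_(i < n) (n%:R * ecdf n z (nbmin z i) - n%:R * F (nbmin z i))
  - n%:R * \sum_(i < n) h (ys z i).

Lemma bmeas_F : bmeas F.
Proof.
apply: (bmeas_of01 _ cdf_unit); apply: nondecreasing_measurable => //.
by move=> s t; exact: F_mono.
Qed.

Lemma bmeas_core n : bmeas (core n).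
Proof.
apply: bmeasB; last first.
  apply: bmeasM; first exact: bmeas_cst.
  by apply: bmeas_sum => i; exact: (bmeas_limit_frac_coord rule mean_L).
apply: bmeas_sum => i; apply: bmeasB; apply: bmeasM; try exact: bmeas_cst.
  apply: bmeasM; first exact: bmeas_cst.
  apply: bmeas_sum => j; apply: bmeas_bool; apply: measurable_ler.
    exact: measurable_ys.
  exact: measurable_nbmin rule _ _.
exact: bmeas_comp (measurable_nbmin rule i) bmeas_F.
Qed.

Lemma dep_core n (z z' : Omega) : (forall i, (i < n)%N -> z i = z' i) ->
  core n z = core n z'.
Proof.
move=> zz'; have [ey _] := dep_nb N zz'.
have ee t : ecdf n z t = ecdf n z' t.
  by rewrite /ecdf; congr (_ * _); apply: eq_bigr => i _; rewrite ey.
rewrite /core; congr (_ - _ * _); apply: eq_bigr => i _; last by rewrite ey.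
by rewrite (dep_nbmin N zz') ee.
Qed.

(** The replacement acts on [core] in three ways. The few changed pairs move
    the argument of the empirical process, at cost n B each. The empirical
    distribution function itself changes by a difference of two indicators;
    summed over the pairs it gives n L at the two values of the replaced
    observation, which the terms n h compensate. Finally L is evaluated for the
    sample that does not contain the level, so that the level is independent of
    it; this costs at most D. *)
Lemma core_repl n z (j : 'I_n) (B : R) : separated z -> 0 <= B ->
  (forall t, `|ecdf n z t - F t| <= B) ->
  `|core n z - core n (z \o repl n j)| <=
  2 * D%:R * n%:R * B +
  n%:R * `|L n (z \o repl n j) (z j).2 - h (z j).2| +
  n%:R * `|L n z (z n).2 - h (z n).2| + D%:R.
Proof.
move=> gz B0 hB; set z' := z \o repl n j.
have n0 : n%:R != 0 :> R.
  by rewrite pnatr_eq0 -lt0n (leq_ltn_trans (leq0n j) (ltn_ord j)).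
have n0' : 0 <= n%:R :> R by [].
pose nu t := ecdf n z t - F t.
pose A := \sum_(i < n) (nu (nbmin z i) - nu (nbmin z' i)).
have LE (u : Omega) t : n%:R * L n u t = \sum_(i < n) (t <= nbmin u i)%R%:R.
  by rewrite /upper_frac mulVKf.
have hE : \sum_(i < n) h (ys z i) - \sum_(i < n) h (ys z' i) = h (z j).2 - h (z n).2.
  rewrite -sumrB (bigD1 j)//= big1 ?addr0; first by rewrite /z' /ys /= /repl eqxx.
  by move=> i ij; rewrite /z' ys_repl// subrr.
have -> : core n z - core n z' = n%:R * A +
    n%:R * (L n z' (z j).2 - h (z j).2) - n%:R * (L n z (z n).2 - h (z n).2)
    + (\sum_(i < n) ((z n).2 <= nbmin z i)%R%:R - \sum_(i < n) ((z n).2 <= nbmin z' i)%R%:R).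
  have e1 : \sum_(i < n) (n%:R * ecdf n z (nbmin z i) - n%:R * F (nbmin z i)) -
      \sum_(i < n) (n%:R * ecdf n z' (nbmin z' i) - n%:R * F (nbmin z' i)) =
      n%:R * A + (n%:R * L n z' (z j).2 - n%:R * L n z' (z n).2).
    rewrite !LE /A mulr_sumr -!sumrB -big_split/=; apply: eq_bigr => i _.
    rewrite -ecdf_repl -/z' /nu; ring.
  rewrite -!LE /core.
  move: e1 hE; set a := \sum_i _; set b := \sum_i _; set p := \sum_i _; set q := \sum_i _.
  move=> /eqP; rewrite subr_eq => /eqP -> /eqP; rewrite subr_eq => /eqP ->; ring.
rewrite (le_trans (ler_normD _ _))// lerD//; last exact: (sum_nbmin_repl rule j _ gz).
rewrite (le_trans (ler_normB _ _))// lerD//; last first.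
  by rewrite normrM ger0_norm.
rewrite (le_trans (ler_normD _ _))// lerD//; last first.
  by rewrite normrM ger0_norm.
rewrite normrM ger0_norm//.
have hA : `|A| <= D%:R * (2 * B).
  apply: (sum_unchanged rule (j := j) gz) => [|i hi|i].
  - by rewrite mulr_ge0.
  - by rewrite /z' (nbmin_unchanged rule hi) subrr.
  rewrite (le_trans (ler_normB _ _))// mulr_natl mulr2n lerD//; exact: hB.
have := ler_wpM2l n0' hA; lra.
Qed.

(** Exchanging the entries j and n turns the term with the old value of y_j into
    the one with the new value. *)
Lemma mean_core_repl n (j : 'I_n) r (e : R) : 0 < e ->
  (forall K : R -> R,
    (forall s t, s <= t -> K s <= K t) -> (forall t, 0 <= K t <= 1) ->
    forall t, `|K t - F t| <= \sum_(a <- r) `|K a - F a| + e) ->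
  mean Q (fun z => (core n z - core n (z \o repl n j)) ^+ 2) <=
  4 * (4 * D%:R ^+ 2 * n%:R ^+ 2 * mean Q (fun z => (ecdf_err r n z + e) ^+ 2)
    + 2 * n%:R ^+ 2 * mean Q (level_err N h n) + D%:R ^+ 2).
Proof.
move=> e0 grid.
pose sw i := if i == j :> nat then n else if i == n then nat_of_ord j else i.
have isw : injective sw.
  by move=> a b; have := ltn_ord j; rewrite /sw; repeat case: ifP; lia.
have bl := bmeas_level_err rule mean_L n.
have bl' : bmeas (fun z : Omega => level_err N h n (z \o sw)) by exact: bmeas_reindex.
have lE : mean Q (level_err N h n) = mean Q (fun z : Omega => level_err N h n (z \o sw)).
  exact: mean_reindex.
have lsw (z : Omega) : level_err N h n (z \o sw) =
    (L n (z \o repl n j) (z j).2 - h (z j).2) ^+ 2.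
  rewrite /level_err /= {2 3}/sw eqxx.
  have -> : (if n == j then n else nat_of_ord j) = j.
    by case: eqP => // nj; have := ltn_ord j; rewrite -nj ltnn.
  rewrite (@dep_upper_frac _ _ N n _ (z \o repl n j))// => i im.
  by congr (z _); rewrite /sw /repl; repeat case: ifP; lia.
have bE : bmeas (fun z => (ecdf_err r n z + e) ^+ 2).
  apply: bmeasX; apply: bmeasD; last exact: bmeas_cst.
  apply: bmeas_sum => a; apply: bmeas_norm; apply: bmeasB; last exact: bmeas_cst.
  exact: bmeas_ecdf.
pose bound (z : Omega) := 4 * (4 * D%:R ^+ 2 * n%:R ^+ 2 * (ecdf_err r n z + e) ^+ 2 +
  n%:R ^+ 2 * (level_err N h n (z \o sw) + level_err N h n z) + D%:R ^+ 2) : R.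
have b1 : bmeas (fun z => 4 * D%:R ^+ 2 * n%:R ^+ 2 * (ecdf_err r n z + e) ^+ 2).
  by apply: bmeasM => //; exact: bmeas_cst.
have b2 : bmeas (fun z : Omega => n%:R ^+ 2 * (level_err N h n (z \o sw) + level_err N h n z)).
  by apply: bmeasM; [exact: bmeas_cst|exact: bmeasD].
have b12 := bmeasD b1 b2.
have b3 := bmeasD b12 (bmeas_cst (D%:R ^+ 2)).
apply: (@le_trans _ _ (mean Q bound)).
  apply: ler_mean_ae.
  - apply: bmeasX; apply: bmeasB; first exact: bmeas_core.
    exact: (bmeas_reindex _ (bmeas_core n)).
  - by apply: bmeasM b3; exact: bmeas_cst.
  apply: ae_imply (ae_separated k0 iidQ atomlessX) => z gz.
  have E0 : 0 <= ecdf_err r n z + e by apply: addr_ge0 (ltW e0); exact: sumr_ge0.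
  have hz := core_repl j gz E0 (grid _ (@ecdf_mono n z) (@ecdf01 n z)).
  rewrite /bound lsw /level_err -[leLHS]sqr_norm.
  move: hz; set w := core n z - _.
  set a := L n _ _ - _; set b := L n z _ - _; set u := ecdf_err _ _ _ + _ in E0 *.
  rewrite -[a ^+ 2]sqr_norm -[b ^+ 2]sqr_norm.
  move: (normr_ge0 w) (normr_ge0 a) (normr_ge0 b) E0.
  move: `|w| `|a| `|b| u => {}w {}a {}b u w0 a0 b0 u0 hw.
  set p1 := 2 * D%:R * n%:R * u in hw; set p2 := n%:R * a in hw.
  set p3 := n%:R * b in hw; set p4 := D%:R in hw *.
  have -> : 4 * p4 ^+ 2 * n%:R ^+ 2 * u ^+ 2 = p1 ^+ 2 by rewrite /p1 /p4; ring.
  have -> : n%:R ^+ 2 * (a ^+ 2 + b ^+ 2) = p2 ^+ 2 + p3 ^+ 2 by rewrite /p2 /p3; ring.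
  have h1 : w ^+ 2 <= (p1 + p2 + p3 + p4) ^+ 2.
    by rewrite lerXn2r// nnegrE (le_trans w0).
  apply: (le_trans h1).
  have := sqr_ge0 (p1 - p2); have := sqr_ge0 (p1 - p3); have := sqr_ge0 (p1 - p4).
  have := sqr_ge0 (p2 - p3); have := sqr_ge0 (p2 - p4); have := sqr_ge0 (p3 - p4).
  lra.
rewrite meanZ// meanD//; last exact: bmeas_cst.
rewrite meanD// meanZ// meanZ; last exact: bmeasD.
rewrite meanD// -lE mean_cst; lra.
Qed.

(** Efron-Stein on [core]: n replacements, each of mean square o(n^2). *)
Theorem core_variance :
  mean_sqr_dev Q (core n) / n%:R ^+ 3 @[n --> \oo] --> 0.
Proof.
apply: cvg0_ge0 => [n|e e0].
  by rewrite divr_ge0 ?exprn_ge0// mean_ge0// => z; exact: sqr_ge0.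
have D0 : 0 < D%:R :> R by [].
have D20 : 0 < D%:R ^+ 2 :> R by rewrite exprn_gt0.
(* the tolerance dl of the grid and the threshold on n make each of the four
   terms of the bound at most a quarter of the target *)
pose eps := e / (64 * D%:R ^+ 2).
have eps0 : 0 < eps by rewrite divr_gt0// mulr_gt0.
pose dl := Num.min 1 eps.
have dl0 : 0 < dl by rewrite lt_min ltr01.
have dl_le1 : dl <= 1 by rewrite ge_min lexx.
have dl_eps : dl <= eps by rewrite ge_min lexx orbT.
have dl2 : dl ^+ 2 <= eps by apply: le_trans dl_eps; rewrite expr2 ler_piMl// ltW.
have [r grid] := cdf_grid cF F_mono cdf_unit cdf_low cdf_high dl0.
have e16 : 0 < e / 16 by rewrite divr_gt0.
have lv := cvg0_le (mean_level_err iidQ atomlessX rule mean_L) e16.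
pose K1 := 64 * D%:R ^+ 2 * (size r)%:R ^+ 2 / e : R.
pose K2 := 8 * D%:R ^+ 2 / e : R.
near=> n.
have n1 : (0 < n)%N by near: n; exact: nbhs_infty_gt.
have nK1 : K1 <= n%:R by near: n; exact: nbhs_infty_ger.
have nK2 : K2 <= n%:R by near: n; exact: nbhs_infty_ger.
have nv : mean Q (level_err N h n) <= e / 16 by near: n; exact: lv.
have n0 : 0 < n%:R :> R by rewrite ltr0n.
have n30 : 0 < n%:R ^+ 3 :> R by rewrite exprn_gt0.
rewrite ler_pdivrMr//.
apply: le_trans (efron_stein iidQ (bmeas_core n) (@dep_core n)) _.
set T := 4 * (4 * D%:R ^+ 2 * n%:R ^+ 2 * (2 * (size r)%:R ^+ 2 / n%:R + 2 * dl ^+ 2)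
    + 2 * n%:R ^+ 2 * (e / 16) + D%:R ^+ 2).
apply: (@le_trans _ _ (2^-1 * \sum_(j < n) T)).
  rewrite ler_wpM2l//; apply: ler_sum => j _.
  apply: le_trans (mean_core_repl j dl0 grid) _.
  have c1 : 0 <= 4 * D%:R ^+ 2 * n%:R ^+ 2 :> R by rewrite !mulr_ge0 ?exprn_ge0.
  have c2 : 0 <= 2 * n%:R ^+ 2 :> R by rewrite mulr_ge0 ?exprn_ge0.
  have := ler_wpM2l c1 (ecdf_err_L2 r n1 (ltW dl0)).
  have := ler_wpM2l c2 nv; rewrite /T; lra.
rewrite sumr_const card_ord -[X in 2^-1 * X]mulr_natl.
have n21 : 1 <= n%:R ^+ 1 :> R by rewrite expr1 ler1n.
move: nK1 nK2; rewrite /K1 /K2 !ler_pdivrMr// => nK1 nK2.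
have eE : 64 * D%:R ^+ 2 * eps = e by rewrite /eps mulrC divfK ?gt_eqF// mulr_gt0.
have h1 : 64 * D%:R ^+ 2 * dl ^+ 2 <= e.
  by rewrite -[leRHS]eE ler_wpM2l// mulr_ge0// ltW.
set D2 := D%:R ^+ 2 in h1 nK1 nK2 D20 T *.
set r2 := (size r)%:R ^+ 2 in nK1 T *.
have TE : T = 16 * D2 * n%:R ^+ 2 * (2 * r2 / n%:R) + n%:R ^+ 2 * (32 * D2 * dl ^+ 2)
  + n%:R ^+ 2 * (e / 2) + 4 * D2 by rewrite /T; lra.
have T1 : 16 * D2 * n%:R ^+ 2 * (2 * r2 / n%:R) = 32 * D2 * r2 * n%:R.
  by field; rewrite gt_eqF.
rewrite TE T1.
set x := n%:R in n0 n30 n21 nK1 nK2 *.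
have x1 : 1 <= x by rewrite -[x]expr1.
have x20 : 0 <= x ^+ 2 by exact: sqr_ge0.
have xx2 : x <= x ^+ 2 by rewrite expr2 ler_peMr// ltW.
have a1 : 32 * D2 * r2 * x <= x ^+ 2 * (e / 2).
  have := ler_wpM2r (ltW n0) nK1; rewrite expr2; lra.
have a2 : x ^+ 2 * (32 * D2 * dl ^+ 2) <= x ^+ 2 * (e / 2).
  by rewrite ler_wpM2l//; lra.
have a3 : 4 * D2 <= x ^+ 2 * (e / 2).
  have : x * (e / 2) <= x ^+ 2 * (e / 2) by rewrite ler_wpM2r// divr_ge0// ltW.
  lra.
have : x * (32 * D2 * r2 * x + x ^+ 2 * (32 * D2 * dl ^+ 2) + x ^+ 2 * (e / 2) +
   4 * D2) <= x * (x ^+ 2 * (e * 2)).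
  by apply: ler_wpM2l; [exact: ltW|lra].
rewrite (_ : e * x ^+ 3 = 2^-1 * (x * (x ^+ 2 * (e * 2)))); last by field.
by move=> ?; rewrite ler_wpM2l.
Unshelve. all: by end_near. Qed.

End MainVariance.

(** * The law of the sample and its marginals *)

Section SampleLaw.
Context {dS d d0 : measure_display} {S : measurableType dS}
  {T : measurableType d} {T0 : measurableType d0} {R : realType}.
Variables (P : probability T R) (P0 : probability T0 R).
Variables (Z0 : T0 -> S) (Z : nat -> T -> S).
Hypothesis mZ : forall i, measurable_fun setT (Z i).
Hypothesis copies : independent_copies P P0 Z0 Z.

Definition sample (w : T) : seq_space S := fun i => Z i w.

Lemma measurable_sample : measurable_fun setT sample.
Proof. exact: measurable_seq_space. Qed.

Definition sample_mfun : {mfun T >-> seq_space S} :=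
  HB.pack sample (isMeasurableFun.Build _ _ _ _ sample measurable_sample).

Definition sample_law : probability (seq_space S) R :=
  [the probability _ _ of distribution P sample_mfun].

Lemma sample_law_coord (B : set S) i : measurable B ->
  sample_law [set z | B (z i)] = P0 (Z0 @^-1` B).
Proof. by move=> mB; rewrite -(proj2 copies i B mB). Qed.

Lemma iid_sample_law : iid_law sample_law.
Proof.
move=> J B uJ mB.
transitivity (P (\bigcap_(j in [set` J]) (Z j @^-1` B j))).
  by congr (P _); apply/seteqP; split => w.
rewrite (proj1 copies)//; apply: eq_bigr => j _.
by rewrite sample_law_coord// (proj2 copies).
Qed.

Lemma mean_sample (f : seq_space S -> R) : bmeas f ->
  mean sample_law f = mean P (fun w => f (sample w)).
Proof. by move=> mf; apply: mean_pushforward => //; exact: measurable_sample. Qed.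

Lemma mean_sample0 (f : S -> R) : measurable_fun setT Z0 -> bmeas f ->
  mean sample_law (fun z => f (z 0%N)) = mean P0 (fun w => f (Z0 w)).
Proof.
move=> mZ0 mf.
pose Z0' : {mfun T0 >-> S} := HB.pack Z0 (isMeasurableFun.Build _ _ _ _ Z0 mZ0).
pose mu : probability S R := [the probability _ _ of distribution P0 Z0'].
rewrite -(@mean_pushforward _ _ _ _ _ sample_law mu (fun z => z 0%N) f) => [|| A mA|//].
- exact: (@mean_pushforward _ _ _ _ _ P0 mu Z0 f).
- exact: measurable_coord.
- by rewrite (sample_law_coord 0%N mA).
Qed.

End SampleLaw.

Section AtomlessMarginals.
Context {d0 : measure_display} {T0 : measurableType d0} {R : realType} {d : nat}.
Variables (P0 : probability T0 R) (X : {RV P0 >-> d.-tuple R}) (Y : {RV P0 >-> R}).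
Hypothesis cJ : continuous (joint_cdf X Y).

Let orthant (p : 'rV[R]_d * R) : set T0 :=
  [set w | (forall k, tnth (X w) k <= p.1 0 k) /\ Y w <= p.2].

Let measurable_Xk k : measurable_fun setT (fun w => tnth (X w) k).
Proof. exact: measurableT_comp (measurable_tnth k) (measurable_funPT X). Qed.

Let measurable_orthant p : measurable (orthant p).
Proof.
rewrite (_ : orthant p = (\bigcap_(k in [set: 'I_d]) [set w | tnth (X w) k <= p.1 0 k])
    `&` [set w | Y w <= p.2]); last first.
  apply/seteqP; split => w /= [h1 h2]; split=> // k; [|exact: h1].
  by move=> _; exact: h1.
apply: measurableI.
  apply: fin_bigcap_measurable => // k _.
  by apply: measurable_ler; [exact: measurable_Xk|exact: measurable_cst].
by apply: measurable_ler; [exact: measurable_funPT|exact: measurable_cst].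
Qed.

(** A set squeezed between orthants whose corners converge is null, as its
    probability is at most the increment of the distribution function. *)
Let gap_null (E : set T0) (p : nat -> 'rV[R]_d * R) q : measurable E ->
  p @ \oo --> q -> (forall m, orthant (p m) `<=` orthant q) ->
  (forall m, E `<=` orthant q `\` orthant (p m)) -> P0 E = 0%E.
Proof.
move=> mE pq sub Esub; apply/eqP; rewrite eq_le measure_ge0 andbT.
have c : joint_cdf X Y (p m) @[m --> \oo] --> joint_cdf X Y q.
  exact: (cvg_comp _ _ pq (@cJ q)).
have bound m : fine (P0 E) <= joint_cdf X Y q - joint_cdf X Y (p m).
  rewrite /joint_cdf -/(orthant q) -/(orthant (p m)).
  have qE : orthant q = orthant (p m) `|` (orthant q `\` orthant (p m)).
    by rewrite setDUK//; exact: sub.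
  rewrite [in leRHS]qE measureU//; last 2 first.
  - exact: measurableD.
  - by rewrite setDE setICA setICr setI0.
  rewrite fineD ?fin_num_measure//; last exact: measurableD.
  rewrite addrC addKr fine_le ?fin_num_measure//; first exact: measurableD.
  by apply: le_measure; rewrite ?inE//; exact: measurableD.
have c0 : (joint_cdf X Y q - joint_cdf X Y (p m)) @[m --> \oo] --> 0.
  by rewrite -(subrr (joint_cdf X Y q)); apply: cvgB => //; exact: cvg_cst.
have : fine (P0 E) <= 0.
  by apply: ler_cvg_to (cvg_cst (fine (P0 E))) c0 _; exact: nearW.
by rewrite -(lee_fin _ 0) fineK ?fin_num_measure.
Qed.

Let cvg_pairR (u : nat -> 'rV[R]_d) (v : nat -> R) (a : 'rV[R]_d) (b : R) :
  u @ \oo --> a -> v @ \oo --> b -> (u m, v m) @[m --> \oo] --> (a, b).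
Proof.
move=> /cvg_ballP ua /cvg_ballP vb; apply/cvg_ballP => e e0; near=> m.
by split; near: m; [exact: ua|exact: vb].
Unshelve. all: by end_near. Qed.

Let cvg_natSinv (s : R) : (s - m.+1%:R^-1) @[m --> \oo] --> s.
Proof.
by rewrite -[X in _ --> X]subr0; apply: cvgB; [exact: cvg_cst|exact: cvg_harmonic].
Qed.

Let nat_bound (w : T0) : exists M : nat, (forall k, tnth (X w) k <= M%:R) /\ Y w <= M%:R.
Proof.
pose b := \sum_k `|tnth (X w) k| + `|Y w|.
have b0 : 0 <= b by rewrite addr_ge0// sumr_ge0.
have bM : b <= (Num.truncn b).+1%:R by apply: ltW; have /andP[] := truncn_itv b0.
exists (Num.truncn b).+1; split=> [k|]; apply: le_trans bM.
  rewrite (le_trans (ler_norm _))// /b (bigD1 k)//= -addrA lerDl addr_ge0//.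
  exact: sumr_ge0.
by rewrite (le_trans (ler_norm _))// /b lerDr sumr_ge0.
Qed.

Let null_union (A : set T0) (E : nat -> set T0) : measurable A ->
  (forall M, measurable (E M)) -> (forall M, P0 (E M) = 0%E) ->
  (forall w, A w -> exists M, E M w) -> P0 A = 0%E.
Proof.
move=> mA mE E0 AE; apply: (measure_negligible (mu := P0)) => //.
apply: (@negligibleS _ _ _ P0 (\bigcup_M E M)).
  by move=> w /AE[M EM]; exists M.
by apply: negligible_bigcup => M; exists (E M); split; [exact: mE|exact: E0|].
Qed.

(** Moving the last coordinate of the corner only gives the part of the event on
    which X is bounded; let the bound tend to infinity. *)
Lemma atomless_Y s : P0 [set w | Y w == s] = 0%E.
Proof.
have mY : measurable [set w | Y w == s].
  apply: measurable_bool_set; apply: measurable_fun_eqr; last exact: measurable_cst.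
  exact: measurable_funPT.
pose q (M : nat) : 'rV[R]_d * R := (const_mx M%:R, s).
pose E M := [set w | Y w == s] `&` orthant (q M).
apply: (@null_union _ E) => // [M|M|w /= Ys].
- exact: (measurableI _ _ mY (measurable_orthant (q M))).
- apply: (@gap_null _ (fun m => (const_mx M%:R, s - m.+1%:R^-1)) (q M)).
  + exact: (measurableI _ _ mY (measurable_orthant (q M))).
  + have h1 : (fun m : nat => const_mx M%:R : 'rV[R]_d) @ \oo --> (const_mx M%:R : 'rV[R]_d).
      exact: cvg_cst.
    exact: (cvg_pairR h1 (@cvg_natSinv s)).
  + move=> m w [/= h1 h2]; split=> //=; rewrite (le_trans h2)//.
    by rewrite gerBl invr_ge0.
  + move=> m w [/= /eqP h1 h2]; split=> // -[_] /=; rewrite h1.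
    by apply/negP; rewrite -ltNge ltrBlDr ltrDl invr_gt0.
- have [M [hX hY]] := nat_bound w; exists M; split=> //; split=> [k|] /=.
    by rewrite mxE.
  by rewrite (eqP Ys).
Qed.

Lemma atomless_X k s : P0 [set w | tnth (X w) k == s] = 0%E.
Proof.
have mX : measurable [set w | tnth (X w) k == s].
  apply: measurable_bool_set; apply: measurable_fun_eqr; last exact: measurable_cst.
  exact: measurable_Xk.
pose c (M : nat) (u : R) : 'rV[R]_d * R :=
  (\row_l (if l == k then u else M%:R), M%:R).
pose E M := [set w | tnth (X w) k == s] `&` orthant (c M s).
apply: (@null_union _ E) => // [M|M|w /= Xs].
- exact: (measurableI _ _ mX (measurable_orthant (c M s))).
- apply: (@gap_null _ (fun m => c M (s - m.+1%:R^-1)) (c M s)).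
  + exact: (measurableI _ _ mX (measurable_orthant (c M s))).
  + suff h : (c M (s - m.+1%:R^-1)).1 @[m --> \oo] --> (c M s).1.
      have h2 : (fun m : nat => M%:R : R) @ \oo --> (M%:R : R) by exact: cvg_cst.
      exact: (cvg_pairR h h2).
    apply/cvg_ballP => e e0; near=> m.
    split=> // i j; rewrite !mxE; case: ifP => _; last exact: ballxx.
    by near: m; have /cvg_ballP := @cvg_natSinv s; apply.
  + move=> m w [/= h1 h2]; split=> //= l; rewrite (le_trans (h1 l))// !mxE.
    by case: ifP => // _; rewrite gerBl invr_ge0.
  + move=> m w [/= /eqP h1 h2]; split=> // -[/= /(_ k)] + _.
    rewrite mxE eqxx h1.
    by apply/negP; rewrite -ltNge ltrBlDr ltrDl invr_gt0.
- have [M [hX hY]] := nat_bound w; exists M; split=> //; split=> [l|] //=.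
  by rewrite mxE; case: eqP => // ->; rewrite (eqP Xs).
Unshelve. all: by end_near. Qed.

End AtomlessMarginals.

(** * Regression functions *)

Section Regression.
Context {d1 d2 : measure_display} {T : measurableType d1} {S : measurableType d2}
  {R : realType} (P : probability T R) (X : {RV P >-> S}) (E : set T) (G : T -> R).
Hypothesis mE : measurable E.
Hypothesis GP : is_cond_prob X E G.

Let sigmaG B : measurable B -> exists A, measurable A /\ X @^-1` A = G @^-1` B.
Proof.
by case: GP => h _ _ /h[A mA <-]; exists A; rewrite setTI.
Qed.

Let mG : measurable_fun setT G.
Proof.
by case: GP => _ /integrableP[mG _] _; exact/measurable_EFinP.
Qed.

Let mpre B : measurable B -> measurable (G @^-1` B).
Proof. by move=> mB; rewrite -[X in measurable X]setTI; exact: mG. Qed.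

Let intG A : measurable A -> P.-integrable A (EFin \o G).
Proof.
by case: GP => _ h _ mA; apply: integrableS h.
Qed.

Let intc A (c : R) : measurable A -> P.-integrable A (EFin \o cst c).
Proof.
move=> mA; apply: (integrableS (E := setT)) => //.
exact: (bmeas_integrable P (bmeas_cst c)).
Qed.

Let intGE B : measurable B ->
  (\int[P]_(w in G @^-1` B) (G w)%:E)%E = P ((G @^-1` B) `&` E).
Proof.
move=> mB; case: GP => h _; apply; exact: h.
Qed.

Let low c : c < 0 -> P (G @^-1` `]-oo, c]) = 0%E.
Proof.
move=> c0; set A := G @^-1` _.
have mA : measurable A by exact: mpre.
have h : (P (A `&` E) <= c%:E * P A)%E.
  rewrite -intGE// -(integral_cst P mA); apply: le_integral => //.
  - exact: intG.
  - exact: intc.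
  - by move=> w; rewrite inE /A /= in_itv /= lee_fin.
have : (0 <= c%:E * P A)%E by apply: le_trans h; exact: measure_ge0.
rewrite -[P A]fineK ?fin_num_measure// -EFinM lee_fin => cp.
have p0 : 0 <= fine (P A) by apply: fine_ge0; exact: measure_ge0.
by congr EFin; nra.
Qed.

Let high c : 1 < c -> P (G @^-1` `[c, +oo[) = 0%E.
Proof.
move=> c0; set A := G @^-1` _.
have mA : measurable A by exact: mpre.
have h : (c%:E * P A <= P (A `&` E))%E.
  rewrite -intGE// -(integral_cst P mA); apply: le_integral => //.
  - exact: intc.
  - exact: intG.
  - by move=> w; rewrite inE /A /= in_itv /= andbT lee_fin.
have : (c%:E * P A <= P A)%E.
  by apply: (le_trans h); apply: le_measure; rewrite ?inE//; exact: measurableI.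
rewrite -[P A]fineK ?fin_num_measure// -EFinM lee_fin => cp.
have p0 : 0 <= fine (P A) by apply: fine_ge0; exact: measure_ge0.
by congr EFin; nra.
Qed.

(** A version G of the conditional probability may leave [0, 1], but the events
    G <= -1/(k+1) and G >= 1 + 1/(k+1) belong to the conditioning sigma-algebra,
    and integrating G over them shows that they are null. *)
Lemma cond_prob01 : {ae P, forall w, 0 <= G w <= 1}.
Proof.
pose B (k : nat) := (G @^-1` `]-oo, (- k.+1%:R^-1 : R)]) `|`
  (G @^-1` `[(1 + k.+1%:R^-1 : R), +oo[).
have Bk k : P.-negligible (B k).
  apply: negligibleU.
    exists (G @^-1` `]-oo, (- k.+1%:R^-1 : R)]); split=> //; first exact: mpre.
    by apply: low; rewrite oppr_lt0 invr_gt0.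
  exists (G @^-1` `[(1 + k.+1%:R^-1 : R), +oo[); split=> //; first exact: mpre.
  by apply: high; rewrite ltrDl invr_gt0.
have := negligible_bigcup Bk; apply: negligibleS => w /= /negP.
rewrite negb_and -!ltNge => /orP[Gw|Gw].
  have e0 : 0 < - G w by rewrite oppr_gt0.
  have [k _ /(_ k (leqnn k)) /= hk] := near_infty_natSinv_lt (PosNum e0).
  by exists k => //; left; rewrite /= in_itv/= lerNr ltW.
have e0 : 0 < G w - 1 by rewrite subr_gt0.
have [k _ /(_ k (leqnn k)) /= hk] := near_infty_natSinv_lt (PosNum e0).
by exists k => //; right; rewrite /= in_itv/= andbT addrC -lerBrDr ltW.
Qed.

(** The events G >= c are preimages under X of sets A_c, and a function with
    values in [0, 1] is recovered from them as a limit of averages of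
    indicators. *)
Lemma cond_prob_factor : exists g : S -> R,
  [/\ measurable_fun setT g, (forall u, 0 <= g u <= 1) &
      {ae P, forall w, G w = g (X w)}].
Proof.
have [A hA] := choice (fun c : R => sigmaG (measurable_itv `[c, +oo[)).
have mA c : measurable (A c) by case: (hA c).
have AE c w : \1_(A c) (X w) = (c <= G w)%R%:R :> R.
  rewrite indicE; congr (nat_of_bool _)%:R.
  have := congr1 (fun Z => Z w) (proj2 (hA c)).
  rewrite /preimage /= in_itv /= andbT => e.
  by apply/idP/idP => [/set_mem|cG]; [|apply/mem_set]; rewrite e.
(* averages of threshold indicators; the clipping in g matters off the range
   of X only *)
pose gm m (u : S) : R :=
  m.+1%:R^-1 * \sum_(l < m.+1) \1_(A (m.+1%:R^-1 * l.+1%:R)) u.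
have gm01 m u : 0 <= gm m u <= 1.
  rewrite /gm mulr_ge0 ?sumr_ge0//= mulrC ler_pdivrMr// mul1r.
  rewrite -[m.+1 in leRHS]card_ord -sumr_const; apply: ler_sum => l _.
  by rewrite indicE; case: (_ \in _); rewrite ?ler01.
have mgm m : measurable_fun setT (gm m).
  apply: measurable_funM; first exact: measurable_cst.
  by apply: measurable_sum => l; exact: measurable_indic.
pose g u := Num.min 1 (Num.max 0 (limn_sup (gm ^~ u))).
exists g; split.
- apply: measurable_minr; first exact: measurable_cst.
  apply: measurable_maxr; first exact: measurable_cst.
  apply: measurable_fun_limn_sup => // u _.
    by exists 1 => _ [m _ <-]; case/andP: (gm01 m u).
  by exists 0 => _ [m _ <-]; case/andP: (gm01 m u).
- by move=> u; rewrite /g le_min ler01 le_max lexx /= ge_min lexx.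
- move: cond_prob01; apply: ae_imply => w Gw.
  have lim : gm m (X w) @[m --> \oo] --> G w.
    apply/cvgrPdist_le => e e0; near=> m.
    apply: (@le_trans _ _ m.+1%:R^-1).
      rewrite /gm; under eq_bigr do rewrite AE mulrC ler_pdivrMr// [_ * m.+1%:R]mulrC.
      exact: layer_approx.
    by apply: ltW; near: m; exact: near_infty_natSinv_lt (PosNum e0).
  rewrite /g (cvg_limn_inf_sup lim).2.
  by case/andP: Gw => /max_idPr -> /min_idPr ->.
Unshelve. all: by end_near. Qed.

Variable g : S -> R.
Hypothesis mg : measurable_fun setT g.
Hypothesis g01 : forall u, 0 <= g u <= 1.
Hypothesis Gg : {ae P, forall w, G w = g (X w)}.

Let mX : measurable_fun setT X. Proof. exact: measurable_funPT. Qed.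

Lemma mean_cond_prob B : measurable B ->
  mean P (fun w => \1_B (X w) * \1_E w) = mean P (fun w => \1_B (X w) * g (X w)).
Proof.
move=> mB; have mXB : measurable (X @^-1` B).
  by rewrite -[X in measurable X]setTI; exact: mX.
rewrite /mean /Rintegral; congr fine.
transitivity (P (X @^-1` B `&` E)).
  rewrite -[X in P X](setIT) -integral_indic//; last exact: measurableI.
  apply: eq_integral => w _; rewrite !indicE in_setI -natrM mulnb.
  by congr ((nat_of_bool (_ && _))%:R%:E); apply/idP/idP => /set_mem ?; exact/mem_set.
case: GP => _ _ <-; last by exists B; rewrite ?setTI.
rewrite [LHS]integral_mkcond; apply: ae_eq_integral => //.
- by apply/(measurable_restrictT _ mXB); apply: measurable_funTS; exact/measurable_EFinP.
- apply/measurable_EFinP; apply: measurable_funM; last exact: measurableT_comp.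
  by apply: measurableT_comp => //; exact: measurable_indic.
move: Gg; apply: ae_imply => w e _.
rewrite patchE indicE e; case: ifPn => [/set_mem h|/negP h].
  by rewrite mem_set// mul1r.
by rewrite memNset ?mul0r// => Bw; apply: h; exact/mem_set.
Qed.

Lemma expectation_cond_prob_sqr :
  fine ('E_P[fun w => (G w ^+ 2)%R]) = mean P (fun w => g (X w) ^+ 2).
Proof.
have bg : bmeas (fun w => g (X w)).
  exact: (bmeas_comp mX (bmeas_of01 mg g01)).
rewrite unlock /mean /Rintegral; congr fine.
apply: ae_eq_integral => //.
- by apply/measurable_EFinP; exact: measurable_funX.
- by apply/measurable_EFinP; case: (bmeasX 2 bg).
- by move: Gg; apply: ae_imply => w -> _.
Qed.

End Regression.

(** * The rank statistics *)

Lemma norm_diff_le (R : realType) (u v M : R) : 0 <= u -> u <= M ->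
  0 <= v -> v <= M -> `|u - v| <= M.
Proof. by move=> *; rewrite ler_norml; apply/andP; split; lra. Qed.

Section Ranks.
Context {R : realType} {n : nat}.
Implicit Types (y : 'I_n -> R) (N : 'I_n -> 'I_n).

Lemma rankE y i : (rank y i)%:R = \sum_(j < n) (y j <= y i)%R%:R :> R.
Proof. by rewrite natr_sum. Qed.

Lemma rank_le y i : (rank y i <= n)%N.
Proof.
rewrite /rank -[leqRHS]card_ord -sum1_card; apply: leq_sum => j _.
by case: (_ <= _)%R.
Qed.

Lemma leq_rank y i k : y i <= y k -> (rank y i <= rank y k)%N.
Proof.
move=> ik; apply: leq_sum => j _.
by case: (boolP (y j <= y i)) => // /le_trans -> //.
Qed.

Lemma minn_rankE y i k : (minn (rank y i) (rank y k))%:R =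
  \sum_(j < n) (y j <= Num.min (y i) (y k))%R%:R :> R.
Proof.
case/orP: (le_total (y i) (y k)) => h.
  by rewrite (minn_idPl (leq_rank h)) (min_idPl h) rankE.
by rewrite (minn_idPr (leq_rank h)) (min_idPr h) rankE.
Qed.

(** Without ties every pair of distinct indices is ordered in exactly one way. *)
Lemma sum_rank y : injective y -> 2 * \sum_i (rank y i)%:R = n%:R * (n%:R + 1) :> R.
Proof.
move=> iy; under eq_bigr do rewrite rankE.
rewrite mulr_natl mulr2n {2}exchange_big/= -big_split/=.
have pair i j : (y j <= y i)%R%:R + (y i <= y j)%R%:R = 1 + (j == i)%:R :> R.
  have [->|ji] := eqVneq j i; first by rewrite lexx.
  have : y j != y i by rewrite (inj_eq iy).
  by case: (ltgtP (y j) (y i)); rewrite ?addr0 ?add0r.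
rewrite (eq_bigr (fun=> n%:R + 1)) ?sumr_const ?card_ord ?mulr_natl// => i _.
rewrite -big_split/= (eq_bigr _ (fun j _ => pair i j)) big_split/= sumr_const card_ord.
by rewrite (sum_pred_card R (pred1 i)) card1.
Qed.

Lemma abs_rank_diff y i k : `|(rank y k)%:R - (rank y i)%:R| =
  (rank y k)%:R + (rank y i)%:R - 2 * (minn (rank y i) (rank y k))%:R :> R.
Proof.
case/orP: (leq_total (rank y i) (rank y k)) => h.
  by rewrite (minn_idPl h) ger0_norm ?subr_ge0 ?ler_nat//; ring.
by rewrite (minn_idPr h) ler0_norm ?subr_le0 ?ler_nat//; ring.
Qed.

(** Off its fixed points N is injective, so the two sums share all terms but at
    most one on either side. *)
Lemma sum_rank_shift y N :
  (forall i i', N i != i -> N i' != i' -> N i = N i' -> i = i') ->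
  (forall i i', N i = i -> N i' = i' -> i = i') ->
  `|\sum_i (rank y (N i))%:R - \sum_i (rank y i)%:R| <= n%:R :> R.
Proof.
move=> injN fixN; pose A := [set i | N i != i]%SET.
have cA : (#|~: A| <= 1)%N.
  apply/card_le1_eqP => i i'; rewrite !inE !negbK => /eqP h /eqP h'.
  exact: fixN.
have iA : {in A &, injective N} by move=> i i'; rewrite !inE; exact: injN.
have cim : (#|~: (N @: A)%SET| <= 1)%N.
  by apply: leq_trans cA; rewrite [leqLHS]cardsCs [leqRHS]cardsCs !finset.setCK card_in_imset.
have small (B : {set 'I_n}) (f : 'I_n -> 'I_n) : (#|B| <= 1)%N ->
    0 <= (\sum_(i in B) (rank y (f i))%:R : R) <= n%:R.
  move=> B1; rewrite sumr_ge0//=.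
  apply: (@le_trans _ _ (\sum_(i in B) n%:R)).
    by apply: ler_sum => i _; rewrite ler_nat rank_le.
  by rewrite sumr_const -[leLHS]mulr_natl -[leRHS]mul1r ler_wpM2r// lern1.
have split (B : {set 'I_n}) (f : 'I_n -> R) :
    \sum_i f i = \sum_(i in B) f i + \sum_(i in ~: B) f i.
  rewrite (bigID (mem B))/=; congr (_ + _).
  by apply: eq_bigl => i; rewrite finset.in_setC.
rewrite (split A) [X in _ - X](split (N @: A)%SET) (big_imset _ iA)/=.
rewrite opprD addrACA subrr add0r.
have /andP[a0 a1] := small _ N cA; have /andP[b0 b1] := small _ id cim.
exact: norm_diff_le.
Qed.

End Ranks.

Section Statistics.
Context {R : realType} {d : nat}.
Notation S := (d.-tuple R * R)%type.
Notation Omega := (seq_space S).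
Variable N : forall n, ('I_n -> d.-tuple R) -> 'I_n -> 'I_n.
Variables h F : R -> R.
Hypothesis F_mono : forall s t, s <= t -> F s <= F t.

Lemma F_min a b : F (Num.min a b) = Num.min (F a) (F b).
Proof.
case/orP: (le_total a b) => ab.
  by rewrite (min_idPl ab) (min_idPl (F_mono ab)).
by rewrite (min_idPr ab) (min_idPr (F_mono ab)).
Qed.

Lemma sum_minn_rank n (z : Omega) :
  \sum_(i < n) (minn (rank (ys z) i) (rank (ys z) (neighbor N z i)))%:R =
  \sum_(i < n) n%:R * ecdf n z (pair_min N z i) :> R.
Proof.
apply: eq_bigr => i _; rewrite minn_rankE /ecdf mulVKf//.
by rewrite pnatr_eq0 -lt0n (leq_ltn_trans (leq0n i) (ltn_ord i)).
Qed.

Definition xi_scale n : R := 6 / (n%:R ^+ 2 - 1).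

Lemma xi_starE n (z : Omega) :
  xi_star F h (@ys _ _ n z) (@neighbor _ _ N n z) = 6 * n%:R / (n%:R ^+ 2 - 1) *
    (\sum_(i < n) F (pair_min N z i) + \sum_(i < n) h (ys z i)).
Proof.
by rewrite /xi_star; congr (_ * (_ + _)); apply: eq_bigr => i _; rewrite -F_min.
Qed.

Lemma xi_core n (z : Omega) :
  xi (@ys _ _ n z) (@neighbor _ _ N n z) - xi_star F h (@ys _ _ n z) (@neighbor _ _ N n z) =
  - ((2 * n%:R + 1) / (n%:R - 1)) + xi_scale n * core N h F n z.
Proof.
rewrite /xi sum_minn_rank xi_starE /core /xi_scale sumrB -(mulr_sumr (index_enum 'I_n) xpredT (fun i => F (pair_min N z i)) n%:R).
ring.
Qed.

(** The distance of two numbers is their sum minus twice their minimum. *)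
Lemma xi_bar_core n (z : Omega) :
  xi_bar (@ys _ _ n z) (@neighbor _ _ N n z) -
    xi_star F h (@ys _ _ n z) (@neighbor _ _ N n z) =
  1 + xi_scale n * core N h F n z -
  3 / (n%:R ^+ 2 - 1) * (\sum_(i < n) (rank (ys z) (neighbor N z i))%:R
                         + \sum_(i < n) (rank (ys z) i)%:R).
Proof.
rewrite /xi_bar; under [X in 1 - _ * X]eq_bigr do rewrite abs_rank_diff.
rewrite sumrB big_split/= -mulr_sumr sum_minn_rank.
rewrite xi_starE /core /xi_scale sumrB -(mulr_sumr (index_enum 'I_n) xpredT (fun i => F (pair_min N z i)) n%:R).
ring.
Qed.

End Statistics.

Section VarianceTransfer.
Context {R : realType} {d : nat}.
Notation S := (d.-tuple R * R)%type.
Notation Omega := (seq_space S).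
Variable Q : probability Omega R.

Lemma quartic_ratio_le n : (1 < n)%N -> n%:R ^+ 4 / (n%:R ^+ 2 - 1) ^+ 2 <= 4 :> R.
Proof.
move=> n1; have n2 : 2 <= n%:R :> R by rewrite ler_nat.
have q : 0 < n%:R ^+ 2 - 1 :> R by nra.
rewrite ler_pdivrMr ?exprn_gt0//.
have : n%:R ^+ 2 <= 2 * (n%:R ^+ 2 - 1) :> R by nra.
have : 0 <= n%:R ^+ 2 :> R by exact: sqr_ge0.
rewrite (_ : n%:R ^+ 4 = (n%:R ^+ 2) ^+ 2); last by rewrite -exprM.
move: (n%:R ^+ 2) => u; nra.
Qed.

(** As n^4/(n^2-1)^2 is bounded, the factor 6/(n^2-1) turns o(n^3) into o(1/n),
    and an error of order 1/n contributes O(1/n^2) to the variance. *)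
Lemma variance_transfer (V f : nat -> Omega -> R) (c : nat -> R) :
  (forall n, bmeas (V n)) -> (forall n, bmeas (f n)) ->
  mean_sqr_dev Q (f n) / n%:R ^+ 3 @[n --> \oo] --> 0 ->
  (forall n, (1 < n)%N ->
    {ae Q, forall z, `|V n z - (c n + xi_scale n * f n z)| <= 3 * n%:R / (n%:R ^+ 2 - 1)}) ->
  n%:R * mean_sqr_dev Q (V n) @[n --> \oo] --> 0.
Proof.
move=> bV bf f0 Vf.
apply: cvg0_ge0 => [n|e e0].
  by rewrite mulr_ge0// mean_ge0// => z; exact: sqr_ge0.
have half : e / 2 + e / 2 = e by field.
have e1 : 0 < e / 24 / 24 by rewrite !divr_gt0 ?ltr0n.
have nf := cvg0_le f0 e1.
near=> n.
have n1 : (1 < n)%N by near: n; exact: nbhs_infty_gt.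
have fn : mean_sqr_dev Q (f n) / n%:R ^+ 3 <= e / 24 / 24 by near: n; exact: nf.
have ne : 36 * 4 / e <= n%:R by near: n; exact: nbhs_infty_ger.
have n0 : 0 < n%:R :> R by rewrite ltr0n; lia.
have n2 : 2 <= n%:R :> R by rewrite ler_nat.
have q0 : 0 < n%:R ^+ 2 - 1 :> R by nra.
pose m := mean Q (f n); pose a : R := xi_scale n; pose b := 3 * n%:R / (n%:R ^+ 2 - 1) : R.
have b0 : 0 <= b by rewrite divr_ge0 ?mulr_ge0// ltW.
have bd : bmeas (fun z => (f n z - m) ^+ 2).
  by apply: bmeasX; apply: bmeasB => //; exact: bmeas_cst.
have h1 : mean_sqr_dev Q (V n) <= 2 * a ^+ 2 * mean_sqr_dev Q (f n) + 2 * b ^+ 2.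
  apply: le_trans (mean_sqr_dev_le _ (c n + a * m) (bV n)) _.
  have -> : 2 * a ^+ 2 * mean_sqr_dev Q (f n) + 2 * b ^+ 2 =
      mean Q (fun z => 2 * a ^+ 2 * (f n z - m) ^+ 2 + 2 * b ^+ 2).
    rewrite meanD ?mean_cst ?meanZ//; last exact: bmeas_cst.
    by apply: bmeasM => //; exact: bmeas_cst.
  apply: ler_mean_ae.
  - by apply: bmeasX; apply: bmeasB => //; exact: bmeas_cst.
  - by apply: bmeasD; [apply: bmeasM => //|]; exact: bmeas_cst.
  apply: ae_imply (Vf n n1) => z hz.
  rewrite -/a -/b in hz.
  rewrite (_ : V n z - _ = (V n z - (c n + a * f n z)) + a * (f n z - m)); last by ring.
  rewrite -mulrA -exprMn; move: hz; set u := V n z - _; set v := a * (_ - _) => hz.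
  have hu : u ^+ 2 <= b ^+ 2 by rewrite -sqr_norm lerXn2r// nnegrE.
  have := sqr_ge0 (u - v); nra.
have := ler_wpM2l (ltW n0) h1; rewrite mulrDr.
have nbd := quartic_ratio_le n1.
have E1 : n%:R * (2 * a ^+ 2 * mean_sqr_dev Q (f n)) =
   72 * (n%:R ^+ 4 / (n%:R ^+ 2 - 1) ^+ 2) * (mean_sqr_dev Q (f n) / n%:R ^+ 3).
  by rewrite /a /xi_scale; field; rewrite !gt_eqF.
have E2 : n%:R * (2 * b ^+ 2) = 18 * (n%:R ^+ 4 / (n%:R ^+ 2 - 1) ^+ 2) / n%:R.
  by rewrite /b; field; rewrite !gt_eqF.
rewrite E1 E2; move: nbd; set k := n%:R ^+ 4 / _ => nbd.
have k0' : 0 <= k by rewrite divr_ge0 ?exprn_ge0// ltW.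
have t1 : 72 * k * (mean_sqr_dev Q (f n) / n%:R ^+ 3) <= 72 * 4 * (e / 24 / 24).
  apply: ler_pM => //.
  - by rewrite mulr_ge0.
  - by rewrite divr_ge0 ?exprn_ge0// mean_ge0// => z; exact: sqr_ge0.
  - by rewrite ler_wpM2l.
have t2 : 18 * k / n%:R <= e / 2.
  rewrite ler_pdivrMr//; move: ne; rewrite ler_pdivrMr// => ne.
  apply: (@le_trans _ _ (18 * 4)); first by rewrite ler_wpM2l.
  rewrite mulrAC ler_pdivlMr// [e * _]mulrC; apply: le_trans ne.
  by rewrite mulrAC ler_wpM2r// -natrM ler_nat.
have t3 : 72 * 4 * (e / 24 / 24) = e / 2 by field.
rewrite t3 in t1; move=> h2; apply: (le_trans h2).
by apply: le_trans (lerD t1 t2) _; rewrite half.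
Unshelve. all: by end_near. Qed.

End VarianceTransfer.

(** * Asymptotic variances of the two differences *)

Section AsymptoticVariances.
Context {R : realType} {d : nat} (k0 : 'I_d).
Context {disp0 : measure_display} {T0 : measurableType disp0}
  {P0 : probability T0 R} (X : {RV P0 >-> d.-tuple R}) (Y : {RV P0 >-> R})
  {disp : measure_display} {T : measurableType disp} {P : probability T R}
  (Xs : nat -> {RV P >-> d.-tuple R}) (Ys : nat -> {RV P >-> R})
  (G : R -> T0 -> R).
Notation S := (d.-tuple R * R)%type.
Notation Omega := (seq_space S).

Let Z0 (w : T0) : S := (X w, Y w).
Let Z (i : nat) (w : T) : S := (Xs i w, Ys i w).

Hypothesis F_continuous : continuous (joint_cdf X Y).
Hypothesis copies : independent_copies P P0 Z0 Z.
Hypothesis GP : forall t, is_cond_prob X [set w | t <= Y w] (G t).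

Let mZ0 : measurable_fun setT Z0.
Proof. by apply: measurable_fun_pair; exact: measurable_funPT. Qed.

Let mZ i : measurable_fun setT (Z i).
Proof. by apply: measurable_fun_pair; exact: measurable_funPT. Qed.

Let Q : probability Omega R := sample_law P mZ.
Let iidQ : iid_law Q := iid_sample_law mZ copies.

Let F_Y (t : R) : R := fine (cdf Y t).
Let h (t : R) : R := fine 'E_P0[fun w => (G t w ^+ 2)%R].

Let Q_atomless (phi : S -> R) s : measurable_fun setT phi ->
  Q [set z | phi (z 0%N) == s] = P0 [set w | phi (Z0 w) == s].
Proof.
move=> mphi.
rewrite (sample_law_coord mZ copies (B := [set u | phi u == s]))//.
by apply: measurable_bool_set; apply: measurable_fun_eqr; last exact: measurable_cst.
Qed.

Let mtnth1 k : measurable_fun setT (fun u : S => tnth u.1 k).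
Proof. exact: measurableT_comp (measurable_tnth k) measurable_fst. Qed.

Let Q_atomlessX k s : Q [set z : Omega | tnth (z 0%N).1 k == s] = 0%E.
Proof. by rewrite (Q_atomless s (mtnth1 k)); exact: atomless_X. Qed.

Let Q_atomlessY s : Q [set z : Omega | (z 0%N).2 == s] = 0%E.
Proof.
by rewrite (Q_atomless s (@measurable_snd _ _ _ _)); exact: atomless_Y.
Qed.

Let F_YE t : F_Y t = mean Q (fun z => ((z 0%N).2 <= t)%R%:R).
Proof.
have mB : measurable [set u : S | u.2 <= t].
  by apply: measurable_ler; [exact: measurable_snd|exact: measurable_cst].
rewrite mean_bool; last first.
  apply: measurable_ler; last exact: measurable_cst.
  exact: measurableT_comp measurable_snd (measurable_coord 0%N).
rewrite (sample_law_coord mZ copies 0%N mB) /F_Y /cdf /distribution /pushforward.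
by congr (fine (P0 _)); apply/seteqP; split => w /=; rewrite in_itv.
Qed.

Let cF : continuous F_Y.
Proof.
rewrite (_ : F_Y = fun t => mean Q (fun z => ((z 0%N).2 <= t)%R%:R)).
  exact: (continuous_atomless_cdf (@measurable_snd _ _ _ _) Q_atomlessY).
by apply/funext => t; rewrite F_YE.
Qed.

(** h is the second moment of the regression function at level t. *)
Let mean_L (N : forall n, ('I_n -> d.-tuple R) -> 'I_n -> 'I_n) C t :
  neighbor_rule k0 N C -> mean Q (fun z => upper_frac N n z t) @[n --> \oo] --> h t.
Proof.
move=> rule.
have mE : measurable [set w | t <= Y w].
  by apply: measurable_ler; [exact: measurable_cst|exact: measurable_funPT].
have [g [mg g01 Gg]] := cond_prob_factor mE (GP t).
have -> : h t = mean Q (fun z => g (z 0%N).1 ^+ 2).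
  rewrite /h (expectation_cond_prob_sqr (GP t) mg g01 Gg).
  rewrite (mean_sample0 mZ copies (f := fun u => g u.1 ^+ 2))//.
  by apply: bmeasX; exact: bmeas_comp measurable_fst (bmeas_of01 mg g01).
apply: (mean_upper_frac iidQ Q_atomlessX rule mg g01) => B mB.
have bB : bmeas (fun u : S => \1_B u.1 : R).
  exact: bmeas_comp measurable_fst (bmeas_indic mB).
rewrite (mean_sample0 mZ copies (f := fun u => \1_B u.1 * (t <= u.2)%R%:R))//.
  rewrite (mean_sample0 mZ copies (f := fun u => \1_B u.1 * g u.1))//.
    rewrite /= -(mean_cond_prob mE (GP t) mg Gg mB).
    by congr mean; apply/funext => w; congr (_ * _); rewrite indicE mem_setE.
  by apply: bmeasM => //; exact: bmeas_comp measurable_fst (bmeas_of01 mg g01).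
apply: bmeasM => //; apply: bmeas_bool; apply: measurable_ler.
  exact: measurable_cst.
exact: measurable_snd.
Qed.

Let variance_sample (f : Omega -> R) : bmeas f ->
  ('V_P[fun w => f (fun i => Z i w)] = (mean_sqr_dev Q f)%:E)%E.
Proof.
move=> mf.
have mfs : bmeas (fun w => f (sample Z w)) by exact: bmeas_comp (measurable_sample mZ) mf.
have mE : fine 'E_P[fun w => f (fun i => Z i w)] = mean Q f.
  by rewrite unlock (mean_sample P mZ mf).
have bsq : bmeas (fun z => (f z - mean Q f) ^+ 2).
  by apply: bmeasX; apply: bmeasB => //; exact: bmeas_cst.
have bsqs : bmeas (fun w => (f (sample Z w) - mean Q f) ^+ 2).
  exact: bmeas_comp (measurable_sample mZ) bsq.
have dE : mean_sqr_dev Q f = mean P (fun w => (f (sample Z w) - mean Q f) ^+ 2).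
  exact: (mean_sample P mZ bsq).
rewrite dE /variance covariance.unlock mE unlock.
by rewrite -integral_mean//; apply: eq_integral => w _; rewrite expr2.
Qed.

Lemma scaled_variance_cvg0 (N : forall n, ('I_n -> d.-tuple R) -> 'I_n -> 'I_n) C
    (V : nat -> Omega -> R) (c : nat -> R) :
  neighbor_rule k0 N C -> (forall n, bmeas (V n)) ->
  (forall n, (1 < n)%N -> {ae Q, forall z,
    `|V n z - (c n + xi_scale n * core N h F_Y n z)| <= 3 * n%:R / (n%:R ^+ 2 - 1)}) ->
  (fun n : nat => n%:R%:E * 'V_P[fun w => V n (fun i => Z i w)])%E @ \oo --> 0%E.
Proof.
move=> rule bV Vc.
have mL t := @mean_L N C t rule.
have bc n := bmeas_core rule mL F_YE n.
have lim := variance_transfer bV bc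
  (core_variance iidQ Q_atomlessX rule mL F_YE cF) Vc.
have E n : (n%:R%:E * 'V_P[fun w => V n (fun i => Z i w)])%E =
    (n%:R * mean_sqr_dev Q (V n))%:E by rewrite variance_sample.
rewrite (funext E); apply: cvg_EFin; first exact: nearW.
exact: lim.
Qed.

Lemma bmeas_xi (N : forall n, ('I_n -> d.-tuple R) -> 'I_n -> 'I_n) C n :
  neighbor_rule k0 N C ->
  bmeas (fun z : Omega => xi (ys z) (@neighbor _ _ N n z)
                          - xi_star F_Y h (ys z) (@neighbor _ _ N n z)).
Proof.
move=> rule; have mL t := @mean_L N C t rule.
have bc n' := bmeas_core rule mL F_YE n'.
rewrite (_ : (fun z => _) = fun z => - ((2 * n%:R + 1) / (n%:R - 1)) +
    xi_scale n * core N h F_Y n z).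
  by apply: bmeasD; [|apply: bmeasM => //]; exact: bmeas_cst.
by apply/funext => z; rewrite xi_core//; exact: (F_mono F_YE).
Qed.

Lemma xi_variance (N : forall n, ('I_n -> d.-tuple R) -> 'I_n -> 'I_n) C :
  neighbor_rule k0 N C ->
  (fun n : nat => n%:R%:E * 'V_P[fun w =>
     (xi (fun i : 'I_n => Ys i w) (@N n (fun i => Xs i w))
      - xi_star F_Y h (fun i : 'I_n => Ys i w) (@N n (fun i => Xs i w)))%R])%E
   @ \oo --> 0%E.
Proof.
move=> rule.
apply: (scaled_variance_cvg0 (V := fun n z => xi (ys z) (@neighbor _ _ N n z)
    - xi_star F_Y h (ys z) (@neighbor _ _ N n z))
  (c := fun n => - ((2 * n%:R + 1) / (n%:R - 1))) rule).
  by move=> n; exact: bmeas_xi rule.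
move=> n n1; apply: aeW => z.
rewrite xi_core; last exact: (F_mono F_YE).
by rewrite subrr normr0 divr_ge0 ?mulr_ge0// subr_ge0 -natrX ler1n expn_gt0; lia.
Qed.

(** The sum of the ranks is deterministic, and that of the ranks of the right
    neighbors differs from it by at most n. *)
Lemma xi_bar_variance : (forall k : 'I_d, k = k0) ->
  (fun n : nat => n%:R%:E * 'V_P[fun w =>
     (xi_bar (fun i : 'I_n => Ys i w) (right_nearest (fun i => tnth (Xs i w) k0))
      - xi_star F_Y h (fun i : 'I_n => Ys i w)
          (right_nearest (fun i => tnth (Xs i w) k0)))%R])%E
   @ \oo --> 0%E.
Proof.
move=> d1; pose N n (x : 'I_n -> d.-tuple R) := right_nearest (fun i => tnth (x i) k0).
have rule : neighbor_rule k0 N 2 := right_nearest_rule d1.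
have mL t := @mean_L N 2 t rule.
have bc n' := bmeas_core rule mL F_YE n'.
pose V n (z : Omega) : R := xi_bar (ys z) (@neighbor _ _ N n z)
    - xi_star F_Y h (ys z) (@neighbor _ _ N n z).
pose rk n (i : 'I_n) (z : Omega) : R := (rank (ys z) i)%:R.
have brk n i : bmeas (@rk n i).
  rewrite (_ : @rk n i = fun z => \sum_(j < n) (ys z j <= ys z i)%R%:R).
    apply: bmeas_sum => j; apply: bmeas_bool; apply: measurable_ler;
    exact: measurable_ys.
  by apply/funext => z; rewrite /rk rankE.
have bV n : bmeas (V n).
  rewrite (_ : V n = fun z => 1 + xi_scale n * core N h F_Y n z -
      3 / (n%:R ^+ 2 - 1) * (\sum_(i < n) rk n (neighbor N z i) z + \sum_(i < n) rk n i z)).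
    apply: bmeasB.
      by apply: bmeasD; [|apply: bmeasM => //]; exact: bmeas_cst.
    apply: bmeasM; first exact: bmeas_cst.
    apply: bmeasD; apply: bmeas_sum => i; last exact: brk.
    exact: (bmeas_nb rule i (fun j => brk n j)).
  by apply/funext => z; rewrite /V xi_bar_core//; exact: (F_mono F_YE).
apply: (scaled_variance_cvg0 (N := N) (V := V)
  (c := fun n => 1 - 3 / (n%:R ^+ 2 - 1) * (n%:R * (n%:R + 1))) rule bV) => n n1.
have aeX := ae_separated k0 iidQ Q_atomlessX.
have aeY := ae_coord_neq iidQ (@measurable_snd _ _ _ _) Q_atomlessY.
have q0 : 0 < n%:R ^+ 2 - 1 :> R.
  by rewrite subr_gt0 -natrX ltr1n; lia.
apply: filterS2 aeX aeY => z gX gY.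
have iY : injective (@ys _ _ n z).
  move=> i j e; apply/eqP; apply: contraT => ij; have := gY i j ij.
  by rewrite [X in X != _]e eqxx.
have iX : distinct k0 (@xs _ _ n z) by exact: (separated_distinct (tau := id) gX).
rewrite /V xi_bar_core; last exact: (F_mono F_YE).
have := sum_rank iY; have := sum_rank_shift (ys z) (N := neighbor N z)
  (fun i i' => right_nearest_inj iX) (fun i i' => right_nearest_last iX).
set A := \sum_i _; set B := \sum_i _; set c := _ * core _ _ _ _ _.
move=> hAB hB.
rewrite (_ : _ - _ = - (3 / (n%:R ^+ 2 - 1)) * (A - B)).
  have p0 : 0 <= 3 / (n%:R ^+ 2 - 1) :> R by rewrite divr_ge0// ltW.
  rewrite normrM normrN (ger0_norm p0) [leRHS]mulrAC.
  exact: ler_wpM2l.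
rewrite -hB; ring.
Qed.

End AsymptoticVariances.

Theorem theorem1p3 (R : realType) (d : nat) (d_gt0 : (0 < d)%N)
  (disp0 : measure_display) (T0 : measurableType disp0)
  (P0 : probability T0 R)
  (X : {RV P0 >-> d.-tuple R}) (Y : {RV P0 >-> R})
  (F_continuous : continuous (joint_cdf X Y))
  (disp : measure_display) (T : measurableType disp) (P : probability T R)
  (Xs : nat -> {RV P >-> d.-tuple R}) (Ys : nat -> {RV P >-> R})
  (copies : independent_copies P P0 (fun w => (X w, Y w))
              (fun i w => (Xs i w, Ys i w)))
  (G : R -> T0 -> R)
  (GP : forall t, is_cond_prob X [set w | t <= Y w] (G t)) :
  let F_Y : R -> R := fun t => fine (cdf Y t) in
  let h : R -> R := fun t => fine 'E_P0[fun w => (G t w ^+ 2)%R] in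
  let x : forall n, T -> 'I_n -> d.-tuple R := fun n w i => Xs i w in
  let y : forall n, T -> 'I_n -> R := fun n w i => Ys i w in
  let N1 : forall n, T -> 'I_n -> 'I_n := fun n w => nearest (x n w) in
  (fun n : nat => n%:R%:E *
     'V_P[fun w => (xi (y n w) (N1 n w)
                    - xi_star F_Y h (y n w) (N1 n w))%R])%E @ \oo --> 0%E
  /\
  (d = 1%N ->
   let N1bar : forall n, T -> 'I_n -> 'I_n := fun n w =>
     right_nearest (fun i => tnth (x n w i) (Ordinal d_gt0)) in
   (fun n : nat => n%:R%:E *
      'V_P[fun w => (xi_bar (y n w) (N1bar n w)
                     - xi_star F_Y h (y n w) (N1bar n w))%R])%E @ \oo --> 0%E).
Proof.
move=> F_Y h x y N1; split.
  exact: (xi_variance F_continuous copies GP (nearest_rule (Ordinal d_gt0))).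
move=> d1 N1bar; apply: (xi_bar_variance F_continuous copies GP) => k.
by apply/val_inj; case: k => k /=; rewrite d1; case: k.
Qed.
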